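(* Let $Q$ be a non-empty finite quiver, $d=(d_a)_{a\in Q_0}$ a non-zero element of $\mathbf{N}^{Q_0}$, and $V=(V_a)_{a\in Q_0}$ a family of $\mathbf{C}$-vector spaces with $\dim_{\mathbf{C}}(V_a)=d_a$ for all $a\in Q_0$. Let $\mathcal{A}=\bigoplus_{\alpha\in Q_1}\mathrm{Hom}_{\mathbf{C}}(V_{\mathrm{s}(\alpha)},V_{\mathrm{t}(\alpha)})$, let $G=\prod_{a\in Q_0}\mathrm{Aut}_{\mathbf{C}}(V_a)$ act on the right of $\mathcal{A}$ by $(\rho g)_\alpha=g_{\mathrm{t}(\alpha)}^{-1}\circ\rho_\alpha\circ g_{\mathrm{s}(\alpha)}$, let $H=\mathbf{C}^\times e\subset G$, where $e=(\mathbf{1}_{V_a})_{a\in Q_0}$, and let $\overline{G}=H\backslash G$. Let $\mathcal{B}\subset\mathcal{A}$ be the set of all $\rho$ such that the representation $(V,\rho)$ of $Q$ is Schur, let $M=\mathcal{B}/G$ with the quotient topology (the moduli space of complex Schur representations of $Q$ with dimension vector $d$), and let $p:\mathcal{B}\to M$ be the canonical projection. Then the induced action of $\overline{G}$ on $\mathcal{B}$ is principal. In particular, there exists a unique structure of a complex premanifold on $M$ such that $p:\mathcal{B}\to M$ is a holomorphic submersion. Moreover, this structure makes the map $p$ a holomorphic principal $\overline{G}$-bundle.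
   Context: $\mathbf{N}=\{0,1,2,\dots\}$. A quiver $Q=(Q_0,Q_1,\mathrm{s},\mathrm{t})$ consists of sets $Q_0$ (vertices), $Q_1$ (arrows) and maps $\mathrm{s},\mathrm{t}:Q_1\to Q_0$ (source, target); it is finite if $Q_0$ and $Q_1$ are finite, and non-empty if $Q_0\neq\emptyset$. A (complex) representation of $Q$ is a pair $(V,\rho)$ with $V=(V_a)_{a\in Q_0}$ a family of finite-dimensional $\mathbf{C}$-vector spaces and $\rho=(\rho_\alpha)_{\alpha\in Q_1}$ a family of linear maps $\rho_\alpha:V_{\mathrm{s}(\alpha)}\to V_{\mathrm{t}(\alpha)}$. A morphism $(V,\rho)\to(W,\sigma)$ is a family of linear maps $f_a:V_a\to W_a$ with $f_{\mathrm{t}(\alpha)}\circ\rho_\alpha=\sigma_\alpha\circ f_{\mathrm{s}(\alpha)}$ for all $\alpha\in Q_1$. A representation is Schur if its endomorphism ring is a division ring (over $\mathbf{C}$, equivalently, every endomorphism is $\lambda\cdot\mathrm{id}$ for a unique $\lambda\in\mathbf{C}$). The set $\mathcal{B}$ is a $G$-invariant open subset of $\mathcal{A}$ (hence an open complex submanifold), and the stabiliser in $G$ of every point of $\mathcal{B}$ is $H$, so $\overline{G}$ acts holomorphically on the right of $\mathcal{B}$. A complex premanifold is a topological space with a maximal holomorphic atlas, with no separation or countability conditions. A continuous right action of a topological group $\Gamma$ on a topological space $X$ is principal if it is free and the translation map $\phi:R\to \Gamma$ is continuous, where $R=\{(x,xg):x\in X,\ g\in \Gamma\}\subset X\times X$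 has the subspace topology and $\phi(x,y)$ is the unique element of $\Gamma$ with $y=x\phi(x,y)$. *)

(* Defs.v *)
From HB Require Import structures.
From mathcomp Require Import all_boot all_order all_algebra.
From mathcomp Require Import complex.
From mathcomp Require Import all_classical all_reals all_analysis.
Set Implicit Arguments.
Unset Strict Implicit.
Unset Printing Implicit Defensive.
Import numFieldNormedType.Exports.
Import Order.TTheory GRing.Theory Num.Theory.
Local Open Scope classical_set_scope.
Local Open Scope ring_scope.
Local Open Scope quotient_scope.

(* The ascription to numClosedFieldType gives access to the topology that every
   numFieldType carries, so that ['rV[Cx R]_n] is a normed space over C. *)
Definition Cx (R : realType) : numClosedFieldType := (complex R : numClosedFieldType).

Section Premanifolds.
Context {R : realType}.
Local Notation C := (Cx R).

(* The value of [chart_map] outside [chart_dom] is irrelevant. A maximal atlas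
   contains all the charts that differ from one of its members only outside the
   domain, so Leibniz equality of maximal atlases is the intended one. *)
Record chart (X : Type) := Chart {
  chart_dim : nat;
  chart_dom : set X;
  chart_map : X -> 'rV[C]_chart_dim }.

(* A homeomorphism of an open subset of X onto an open subset of C^n. *)
Definition is_chart (X : topologicalType) (c : chart X) : Prop :=
  [/\ open (chart_dom c),
      set_inj (chart_dom c) (chart_map c),
      {within chart_dom c, continuous (chart_map c)} &
      forall U : set X, open U -> U `<=` chart_dom c ->
        open (chart_map c @` U)].

(* [h] represents [f] on [D] in the charts [c] and [c'] and is holomorphic,
   i.e. complex differentiable at each point of c(D /\ dom c /\ f^-1(dom c')). *)
Definition local_rep (X Y : Type) (D : set X) (f : X -> Y)
    (c : chart X) (c' : chart Y)
    (h : 'rV[C]_(chart_dim c) -> 'rV[C]_(chart_dim c')) : Prop :=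
  forall x, D x -> chart_dom c x -> chart_dom c' (f x) ->
    h (chart_map c x) = chart_map c' (f x) /\
    differentiable h (chart_map c x).

Arguments local_rep {X Y} D f c c' h.

Definition compatible (X : Type) (c c' : chart X) : Prop :=
  (exists h, local_rep setT id c c' h) /\ (exists h, local_rep setT id c' c h).

Definition premanifold (X : topologicalType) (S : set (chart X)) : Prop :=
  [/\ forall c, S c -> is_chart c,
      forall x, exists2 c, S c & chart_dom c x,
      forall c c', S c -> S c' -> compatible c c' &
      forall c, is_chart c -> (forall c', S c' -> compatible c c') -> S c].

Definition atlas_generated (X : topologicalType) (S : set (chart X)) :
    set (chart X) :=
  [set c | is_chart c /\ forall c', S c' -> compatible c c'].

(* Used only for open sets [D]. *)
Definition holomorphic_on (X Y : topologicalType) (SX : set (chart X))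
    (SY : set (chart Y)) (D : set X) (f : X -> Y) : Prop :=
  {within D, continuous f} /\
  forall c c', SX c -> SY c' -> exists h, local_rep D f c c' h.

Definition holomorphic (X Y : topologicalType) (SX : set (chart X))
    (SY : set (chart Y)) (f : X -> Y) : Prop :=
  holomorphic_on SX SY setT f.

Definition submersive_in_charts (X Y : Type) (f : X -> Y)
    (c : chart X) (c' : chart Y) : Prop :=
  exists2 h, local_rep setT f c c' h &
    forall x, chart_dom c x -> chart_dom c' (f x) ->
      range ('d h (chart_map c x)) = setT.

Definition holomorphic_submersion (X Y : topologicalType) (SX : set (chart X))
    (SY : set (chart Y)) (f : X -> Y) : Prop :=
  holomorphic SX SY f /\
  forall c c', SX c -> SY c' -> submersive_in_charts f c c'.

Definition prod_chart (X Y : Type) (c : chart X) (c' : chart Y) :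
    chart (X * Y) :=
  @Chart (X * Y) (chart_dim c + chart_dim c') (chart_dom c `*` chart_dom c')
    (fun z => row_mx (chart_map c z.1) (chart_map c' z.2)).

Definition prod_atlas (X Y : topologicalType) (SX : set (chart X))
    (SY : set (chart Y)) : set (chart (X * Y)%type) :=
  atlas_generated [set prod_chart c c' | c in SX & c' in SY].

(* If Y has a premanifold structure that makes p : X -> Y a surjective
   holomorphic submersion, then its charts are the topological charts c of Y
   for which c \o p is a holomorphic submersion on p^-1(dom c). *)
Definition quotient_atlas (X Y : topologicalType) (SX : set (chart X))
    (p : X -> Y) : set (chart Y) :=
  [set c | is_chart c /\ forall c0, SX c0 -> submersive_in_charts p c0 c].

End Premanifolds.

(* No compatibility of the two structures is required here; it is the content
   of [topological_group] below. *)
HB.structure Definition PreTopologicalGroup :=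
  {G of Topological G & Group G}.

Arguments local_rep {R X Y} D f c c' h.

Section PrincipalActions.
Local Open Scope group_scope.

Definition topological_group (Gam : PreTopologicalGroup.type) : Prop :=
  continuous (fun z : Gam * Gam => z.1 * z.2) /\
  continuous (fun g : Gam => g^-1).

Definition right_action (X : Type) (Gam : groupType) (act : X -> Gam -> X) :
    Prop :=
  (forall x, act x 1 = x) /\
  (forall x g h, act x (g * h) = act (act x g) h).

(* The values of [phi] outside R = {(x, x g)} do not matter. *)
Definition principal_action (X : topologicalType)
    (Gam : PreTopologicalGroup.type) (act : X -> Gam -> X) : Prop :=
  [/\ topological_group Gam,
      right_action act,
      continuous (fun z : X * Gam => act z.1 z.2),
      forall x g, act x g = x -> g = 1 &
      exists2 phi : X * X -> Gam,
        forall x g, phi (x, act x g) = g &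
        {within [set (z.1, act z.1 z.2) | z in [set: X * Gam]],
          continuous phi}].

Context {R : realType}.

Definition complex_lie_group (Gam : PreTopologicalGroup.type)
    (SG : set (@chart R Gam)) : Prop :=
  [/\ premanifold SG,
      holomorphic (prod_atlas SG SG) SG (fun z : Gam * Gam => z.1 * z.2) &
      holomorphic SG SG (fun g : Gam => g^-1)].

(* [psi] and [chi] restrict to mutually inverse biholomorphisms between
   U * Gam and p^-1(U) over U, equivariant for the right action of Gam. *)
Definition local_trivialisation (Gam : PreTopologicalGroup.type)
    (X M : topologicalType) (SG : set (@chart R Gam)) (SX : set (@chart R X))
    (SM : set (@chart R M)) (act : X -> Gam -> X) (p : X -> M) (U : set M)
    (psi : M * Gam -> X) (chi : X -> M * Gam) : Prop :=
  [/\ holomorphic_on (prod_atlas SM SG) SX (U `*` setT) psi,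
      holomorphic_on SX (prod_atlas SM SG) (p @^-1` U) chi,
      forall m g, U m -> p (psi (m, g)) = m /\ chi (psi (m, g)) = (m, g),
      forall x, U (p x) -> (chi x).1 = p x /\ psi (chi x) = x &
      forall m g h, U m -> psi (m, g * h) = act (psi (m, g)) h].

Definition holomorphic_principal_bundle (Gam : PreTopologicalGroup.type)
    (X M : topologicalType) (SG : set (@chart R Gam)) (SX : set (@chart R X))
    (SM : set (@chart R M)) (act : X -> Gam -> X) (p : X -> M) : Prop :=
  [/\ [/\ complex_lie_group SG, premanifold SX & premanifold SM],
      right_action act,
      holomorphic (prod_atlas SX SG) SX (fun z : X * Gam => act z.1 z.2),
      holomorphic SX SM p &
      forall m, exists U psi chi,
        [/\ open U, U m & local_trivialisation SG SX SM act p U psi chi]].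

End PrincipalActions.

Section LinearFamilies.
Context {R : realType}.
Local Notation C := (Cx R).

Definition lin_coord (E : vectType C) : E -> 'rV[C]_(\dim {:E}) :=
  passmx.rVof (vbasis {:E}).

(* The canonical topology of a finite-dimensional complex vector space. *)
Definition lin_topology (E : vectType C) : topologicalType :=
  initial_topology (@lin_coord E).

Definition lin_family (I : finType) (E : I -> vectType C) : topologicalType :=
  prod_topology (fun i => lin_topology (E i)).

(* The coordinates of all the components, listed in one row. *)
Definition family_coord (I : finType) (E : I -> vectType C) (x : lin_family E) :
    'rV[C]_#|{: {i : I & 'I_(\dim {:E i})}}| :=
  \row_k lin_coord (x (tag (enum_val k)) : E _) 0 (tagged (enum_val k)).

Definition open_atlas (I : finType) (E : I -> vectType C)
    (U : set (lin_family E)) : set (@chart R U) :=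
  atlas_generated [set Chart setT (fun x : U => family_coord (\val x))].

End LinearFamilies.

Arguments open_atlas {R I E} U _.

Record quiver := Quiver {
  vertex : finType;
  arrow : finType;
  source : arrow -> vertex;
  target : arrow -> vertex }.

Section Quivers.
Context {R : realType} {Q : quiver}.
Local Notation C := (Cx R).

Section Representations.
Variable V : vertex Q -> vectType C.

Definition rep_space : topologicalType :=
  lin_family (fun al : arrow Q => 'Hom(V (source al), V (target al))).

Definition endo_space : topologicalType :=
  lin_family (fun a : vertex Q => 'Hom(V a, V a)).

End Representations.

Definition rep_morphism (V W : vertex Q -> vectType C) (rho : rep_space V)
    (sig : rep_space W) (f : forall a, 'Hom(V a, W a)) : Prop :=
  forall al : arrow Q,
    (f (target al) \o (rho al : 'Hom(_, _)) =
     (sig al : 'Hom(_, _)) \o f (source al))%VF.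

(* The endomorphism ring is a division ring: 1 <> 0, and every non-zero
   endomorphism has a two-sided inverse endomorphism. *)
Definition schur (V : vertex Q -> vectType C) (rho : rep_space V) : Prop :=
  (exists a, \1%VF != 0 :> 'Hom(V a, V a)) /\
  forall f : forall a, 'Hom(V a, V a), rep_morphism rho rho f ->
    (exists a, f a != 0) ->
    exists2 g : forall a, 'Hom(V a, V a), rep_morphism rho rho g &
      forall a, (g a \o f a)%VF = \1%VF /\ (f a \o g a)%VF = \1%VF.

Section Moduli.
Variable V : vertex Q -> vectType C.

Definition AutV_set : set (endo_space V) :=
  [set g | forall a, bijective (g a : 'Hom(V a, V a))].

Definition AutV : Type := AutV_set.
HB.instance Definition _ := Topological.on AutV.

Definition AutV_val (g : AutV) (a : vertex Q) : 'Hom(V a, V a) := \val g a.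

Lemma AutV_lker (g : AutV) a : lker (AutV_val g a) == 0%VS.
Proof. by apply/lker0P; apply: bij_inj; exact: (set_mem (valP g)). Qed.

Lemma AutV_eq (g h : AutV) : (forall a, AutV_val g a = AutV_val h a) -> g = h.
Proof. by move=> gh; apply/val_inj/functional_extensionality_dep. Qed.

Lemma AutV_mk_subproof (f f' : forall a, 'Hom(V a, V a)) :
  (forall a, (f' a \o f a)%VF = \1%VF /\ (f a \o f' a)%VF = \1%VF) ->
  (f : endo_space V) \in AutV_set.
Proof.
move=> ff'; apply/mem_set => a; have [f'f f_f'] := ff' a.
by exists (f' a) => x; rewrite -comp_lfunE ?f'f ?f_f' id_lfunE.
Qed.

Definition AutV_mk (f f' : forall a, 'Hom(V a, V a))
    (ff' : forall a, (f' a \o f a)%VF = \1%VF /\ (f a \o f' a)%VF = \1%VF) :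
    AutV :=
  exist (fun x => x \in AutV_set) (f : endo_space V) (AutV_mk_subproof ff').

Fact AutV_one_subproof a :
  (\1 \o \1 = \1 :> 'Hom(V a, V a))%VF /\ (\1 \o \1 = \1 :> 'Hom(V a, V a))%VF.
Proof. by rewrite comp_lfun1l. Qed.

Definition AutV_one : AutV := AutV_mk AutV_one_subproof.

Fact AutV_inv_subproof (g : AutV) a :
  (AutV_val g a \o (AutV_val g a)^-1 = \1)%VF /\
  ((AutV_val g a)^-1 \o AutV_val g a = \1)%VF.
Proof. by rewrite lker0_compVf ?lker0_compfV ?AutV_lker. Qed.

Definition AutV_inv (g : AutV) : AutV := AutV_mk (AutV_inv_subproof g).

Fact AutV_mul_subproof (g h : AutV) a :
  (((AutV_val h a)^-1 \o (AutV_val g a)^-1) \o (AutV_val g a \o AutV_val h a) = \1)%VF /\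
  ((AutV_val g a \o AutV_val h a) \o ((AutV_val h a)^-1 \o (AutV_val g a)^-1) = \1)%VF.
Proof.
rewrite -!comp_lfunA lker0_compKf ?AutV_lker // lker0_compVf ?AutV_lker //.
by rewrite lker0_compVKf ?AutV_lker // lker0_compfV ?AutV_lker.
Qed.

Definition AutV_mul (g h : AutV) : AutV := AutV_mk (AutV_mul_subproof g h).

Fact AutV_mulA : associative AutV_mul.
Proof. by move=> g h k; apply: AutV_eq => a; exact: comp_lfunA. Qed.
Fact AutV_mul1 : left_id AutV_one AutV_mul.
Proof. by move=> g; apply: AutV_eq => a; exact: comp_lfun1l. Qed.
Fact AutV_mulr1 : right_id AutV_one AutV_mul.
Proof. by move=> g; apply: AutV_eq => a; exact: comp_lfun1r. Qed.
Fact AutV_mulV : left_inverse AutV_one AutV_inv AutV_mul.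
Proof. by move=> g; apply: AutV_eq => a; exact: lker0_compVf (AutV_lker g a). Qed.
Fact AutV_mulrV : right_inverse AutV_one AutV_inv AutV_mul.
Proof. by move=> g; apply: AutV_eq => a; exact: lker0_compfV (AutV_lker g a). Qed.

HB.instance Definition _ :=
  isGroup.Build AutV AutV_mulA AutV_mul1 AutV_mulr1 AutV_mulV AutV_mulrV.

Definition AutV_atlas : set (@chart R AutV) := open_atlas AutV_set.

Definition scalars : set AutV :=
  [set z | exists2 l : C, l != 0 & forall a, AutV_val z a = l *: \1%VF].

Lemma scalars1 : scalars 1%g.
Proof. by exists 1; [exact: oner_neq0|move=> a; rewrite scale1r]. Qed.

Lemma scalarsM z w : scalars z -> scalars w -> scalars (z * w)%g.
Proof.
move=> [l l0 zl] [m m0 wm]; exists (l * m); first by rewrite mulf_neq0.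
move=> a; rewrite /AutV_val /= -/(AutV_val z a) -/(AutV_val w a) zl wm.
by rewrite -comp_lfunZl comp_lfun1l scalerA.
Qed.

Lemma scalarsC z g : scalars z -> (z * g = g * z)%g.
Proof.
move=> [l l0 zl]; apply: AutV_eq => a.
rewrite /AutV_val /= -/(AutV_val z a) -/(AutV_val g a) zl.
by rewrite -comp_lfunZl -comp_lfunZr comp_lfun1l comp_lfun1r.
Qed.

Lemma scalarsV z : scalars z -> scalars z^-1%g.
Proof.
move=> zs; have [l l0 zl] := zs; exists l^-1; first by rewrite invr_eq0.
move=> a; apply/lfunP => x; apply: (lker0P (AutV_lker z a)).
rewrite -comp_lfunE (_ : AutV_val z^-1%g a = (AutV_val z a)^-1%VF) //.
rewrite lker0_compfV ?AutV_lker // zl scale_lfunE !id_lfunE scale_lfunE id_lfunE.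
by rewrite scalerA divff // scale1r.
Qed.

Definition scalars_rel (g h : AutV) : bool :=
  `[< exists2 z, scalars z & h = (z * g)%g >].

Lemma scalars_rel_equiv : equiv_class_of scalars_rel.
Proof.
split.
- by move=> g; apply/asboolP; exists 1%g; [exact: scalars1|rewrite mul1g].
- move=> g h; apply/asboolP/asboolP => -[z zs ->]; exists z^-1%g;
    by [exact: scalarsV|rewrite mulKg].
- move=> h g k /asboolP[z zs ->] /asboolP[w ws ->]; apply/asboolP.
  by exists (w * z)%g; [exact: scalarsM|rewrite mulgA].
Qed.

Canonical scalars_equiv := EquivRelPack scalars_rel_equiv.

(* The quotient of AutV on the left by the scalars. *)
Definition PAutV : Type := quotient_topology {eq_quot scalars_equiv}.
HB.instance Definition _ := Topological.on PAutV.

Definition PAutV_pi (g : AutV) : PAutV := \pi_{eq_quot scalars_equiv} g.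
Definition PAutV_repr (x : PAutV) : AutV := repr (x : {eq_quot scalars_equiv}).

Lemma PAutV_reprK x : PAutV_pi (PAutV_repr x) = x.
Proof. exact: reprK. Qed.

Lemma PAutV_piP g h :
  PAutV_pi g = PAutV_pi h <-> exists2 z, scalars z & h = (z * g)%g.
Proof.
have eP := @eqmodP _ scalars_equiv g h.
by split=> [/eP/asboolP //|zgh]; apply/eP/asboolP.
Qed.

Definition PAutV_one : PAutV := PAutV_pi 1%g.
Definition PAutV_inv (x : PAutV) : PAutV := PAutV_pi (PAutV_repr x)^-1%g.
Definition PAutV_mul (x y : PAutV) : PAutV := PAutV_pi (PAutV_repr x * PAutV_repr y)%g.

Lemma PAutV_piM g h : PAutV_pi (g * h)%g = PAutV_mul (PAutV_pi g) (PAutV_pi h).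
Proof.
have /PAutV_piP[z zs zE] := esym (PAutV_reprK (PAutV_pi g)).
have /PAutV_piP[w ws wE] := esym (PAutV_reprK (PAutV_pi h)).
apply/PAutV_piP; exists (z * w)%g; first exact: scalarsM.
by rewrite zE wE -!mulgA (mulgA g w) -(scalarsC _ ws) !mulgA.
Qed.

Lemma PAutV_piV g : PAutV_pi g^-1%g = PAutV_inv (PAutV_pi g).
Proof.
have /PAutV_piP[z zs zE] := esym (PAutV_reprK (PAutV_pi g)).
apply/PAutV_piP; exists z^-1%g; first exact: scalarsV.
by rewrite zE invgM (scalarsC _ (scalarsV zs)).
Qed.

Fact PAutV_mulA : associative PAutV_mul.
Proof.
by move=> x y z; rewrite -[x]PAutV_reprK -[y]PAutV_reprK -[z]PAutV_reprK -!PAutV_piM mulgA.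
Qed.
Fact PAutV_mul1 : left_id PAutV_one PAutV_mul.
Proof. by move=> x; rewrite -[x]PAutV_reprK -PAutV_piM mul1g. Qed.
Fact PAutV_mulr1 : right_id PAutV_one PAutV_mul.
Proof. by move=> x; rewrite -[x]PAutV_reprK -PAutV_piM mulg1. Qed.
Fact PAutV_mulV : left_inverse PAutV_one PAutV_inv PAutV_mul.
Proof. by move=> x; rewrite -[x]PAutV_reprK -PAutV_piV -PAutV_piM mulVg. Qed.
Fact PAutV_mulrV : right_inverse PAutV_one PAutV_inv PAutV_mul.
Proof. by move=> x; rewrite -[x]PAutV_reprK -PAutV_piV -PAutV_piM mulgV. Qed.

HB.instance Definition _ :=
  isGroup.Build PAutV PAutV_mulA PAutV_mul1 PAutV_mulr1 PAutV_mulV PAutV_mulrV.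

Definition PAutV_atlas : set (@chart R PAutV) := quotient_atlas AutV_atlas PAutV_pi.

Definition rep_act (rho : rep_space V) (g : AutV) : rep_space V :=
  fun al => ((AutV_val g (target al))^-1 \o
             ((rho al : 'Hom(_, _)) \o AutV_val g (source al)))%VF.

Lemma rep_act1 rho : rep_act rho 1%g = rho.
Proof.
apply/functional_extensionality_dep => al; rewrite /rep_act.
rewrite -[(AutV_val 1%g (target al))^-1%VF]/(AutV_val 1%g^-1%g (target al)) invg1.
by rewrite /AutV_val /= comp_lfun1l comp_lfun1r.
Qed.

Lemma rep_actM rho g h : rep_act rho (g * h)%g = rep_act (rep_act rho g) h.
Proof.
apply/functional_extensionality_dep => al; rewrite /rep_act.
rewrite -[(AutV_val (g * h)%g (target al))^-1%VF]/(AutV_val (g * h)^-1%g (target al)).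
by rewrite invgM /AutV_val /= !comp_lfunA.
Qed.

Lemma rep_act_scalars rho z : scalars z -> rep_act rho z = rho.
Proof.
move=> [l l0 zl]; apply/functional_extensionality_dep => al; rewrite /rep_act.
apply: (can_inj (lker0_compKf (AutV_lker z (target al)) (aT := V (source al)))).
rewrite lker0_compVKf ?AutV_lker // !zl.
by rewrite -comp_lfunZr -comp_lfunZl comp_lfun1l comp_lfun1r.
Qed.

Definition conj_endo (g : AutV) (f : forall a, 'Hom(V a, V a)) a : 'Hom(V a, V a) :=
  ((AutV_val g a)^-1 \o (f a \o AutV_val g a))%VF.

Lemma rep_morphism_conj rho g f :
  rep_morphism rho rho f ->
  rep_morphism (rep_act rho g) (rep_act rho g) (conj_endo g f).
Proof.
move=> frho al; rewrite /conj_endo /rep_act.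
rewrite -!comp_lfunA !(lker0_compVKf (AutV_lker _ _)); congr (_ \o _)%VF.
by rewrite !comp_lfunA frho.
Qed.

Lemma rep_actK rho g : rep_act (rep_act rho g) g^-1%g = rho.
Proof. by rewrite -rep_actM mulgV rep_act1. Qed.

Lemma schur_act rho g : schur rho -> schur (rep_act rho g).
Proof.
move=> [nt rhoS]; split=> // f frho [a fa].
have frho' := rep_morphism_conj g^-1%g frho; rewrite rep_actK in frho'.
have conjK k b : conj_endo g (conj_endo g^-1%g k) b = k b.
  rewrite /conj_endo.
  rewrite -[(AutV_val g^-1%g b)^-1%VF]/(AutV_val g^-1%g^-1%g b) invgK.
  rewrite -[AutV_val g^-1%g b]/((AutV_val g b)^-1%VF).
  rewrite -!comp_lfunA (lker0_compVf (AutV_lker _ _)) comp_lfun1r.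
  by rewrite (lker0_compKf (AutV_lker _ _)).
have [|k krho kf] := rhoS _ frho'.
  exists a; apply: contra_neq fa => fa0.
  rewrite -conjK; move: (conj_endo g^-1%g f) fa0 => f' fa0.
  by rewrite /conj_endo fa0 comp_lfun0l comp_lfun0r.
exists (conj_endo g k); first exact: rep_morphism_conj.
move=> b; rewrite -(conjK f b); move: (kf b).
move: (conj_endo g^-1%g f) => f' [kf1 kf2]; rewrite /conj_endo.
rewrite -!comp_lfunA !(lker0_compVKf (AutV_lker _ _)).
rewrite (comp_lfunA (k b)) kf1 (comp_lfunA (f' b)) kf2.
by rewrite comp_lfun1l (lker0_compVf (AutV_lker _ _)).
Qed.

Definition schur_set : set (rep_space V) := [set rho | schur rho].

Definition schur_space : topologicalType := schur_set.

Definition schur_atlas : set (@chart R schur_space) := open_atlas schur_set.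

Definition schur_act_AutV (x : schur_space) (g : AutV) : schur_space :=
  exist (fun rho => rho \in schur_set) (rep_act (\val x) g)
    (mem_set (schur_act g (set_mem (valP x)))).

Fact schur_act_AutV1 x : schur_act_AutV x 1%g = x.
Proof. by apply/val_inj; exact: rep_act1. Qed.

Fact schur_act_AutVM x g h :
  schur_act_AutV x (g * h)%g = schur_act_AutV (schur_act_AutV x g) h.
Proof. by apply/val_inj; exact: rep_actM. Qed.

Fact schur_act_AutV_scalars x z : scalars z -> schur_act_AutV x z = x.
Proof. by move=> zs; apply/val_inj; exact: rep_act_scalars. Qed.

(* Independent of the representative, see [schur_act_PAutVE]. *)
Definition schur_act_PAutV (x : schur_space) (c : PAutV) : schur_space :=
  schur_act_AutV x (PAutV_repr c).

Lemma schur_act_PAutVE x g : schur_act_PAutV x (PAutV_pi g) = schur_act_AutV x g.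
Proof.
have /PAutV_piP[z zs zE] := esym (PAutV_reprK (PAutV_pi g)).
by rewrite /schur_act_PAutV zE schur_act_AutVM (schur_act_AutV_scalars x zs).
Qed.

Definition orbit_rel (x y : schur_space) : bool :=
  `[< exists g, y = schur_act_AutV x g >].

Lemma orbit_rel_equiv : equiv_class_of orbit_rel.
Proof.
split.
- by move=> x; apply/asboolP; exists 1%g; rewrite schur_act_AutV1.
- by move=> x y; apply/asboolP/asboolP => -[g ->]; exists g^-1%g;
    rewrite -schur_act_AutVM mulgV schur_act_AutV1.
- move=> y x z /asboolP[g ->] /asboolP[h ->]; apply/asboolP.
  by exists (g * h)%g; rewrite schur_act_AutVM.
Qed.

Canonical orbit_equiv := EquivRelPack orbit_rel_equiv.

Definition moduli : topologicalType :=
  quotient_topology {eq_quot orbit_equiv}.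

Definition moduli_pi (x : schur_space) : moduli :=
  \pi_{eq_quot orbit_equiv} x.

End Moduli.
End Quivers.

(* Main.v *)
Require Import Defs.
From HB Require Import structures.
From mathcomp Require Import all_boot all_order all_algebra.
From mathcomp Require Import complex.
From mathcomp Require Import all_classical all_reals all_analysis.
From mathcomp Require Import lra ring.
Set Implicit Arguments.
Unset Strict Implicit.
Unset Printing Implicit Defensive.
Import numFieldNormedType.Exports.
Import Order.TTheory GRing.Theory Num.Theory.
Local Open Scope classical_set_scope.
Local Open Scope ring_scope.

(** Write E for the algebra of all families of endomorphisms of the V_a; the
    representation space A is an E-bimodule, G is the group of units of E, and
    g in G sends r to g^-1 r g.  Fix a Schur point r0, a complement E0 of C.1
    in E, a linear map pi from A to E0 with pi(r0 x - x r0) = x for x in E0,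
    and let N = ker pi.  For r, s in r0 + N close to r0 the linear map
    x |-> pi(r x - x s) of E0 is still invertible, so that an intertwiner
    r g = g s has no E0-component: g is a scalar and r = s.  Hence a small
    ball of r0 + N meets each orbit at most once, with stabiliser C^*.
    Conversely r (1 + x) = (1 + x) (s + n), for given r close to s in the slice,
    is a contractive fixed point problem for (n, x) in N x E0, whose solution is
    differentiable in r at s.  So the slices are charts of M over which p is a
    trivial bundle, and continuity of the translation map is read off these
    trivialisations.

    For uniqueness, let S be any structure for which p is a submersion.  The
    local sections make the identity, read in a slice chart and a chart of S, a
    homeomorphism f between open sets of C^n and C^m which is differentiable
    with surjective derivative at every point.  Derivatives are not assumed
    continuous, so the inverse function theorem is not available; instead Baire's
    theorem gives a ball and a matrix L such that w |-> f(z + wL) is uniformly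
    close to a translation for all z in the ball, and Banach's fixed point
    theorem then contradicts injectivity if n > m.  Once n = m, the inverse is
    differentiable because it is continuous. *)

(** * The norm of a complex normed space as a real number *)

(** Holomorphic means here complex differentiable at each point, so the argument stays pointwise
    throughout. The fixed point problem yields a solution known to be differentiable only at the
    slice point itself. This suffices: the problem can be posed at every point of the slice, and a
    Schur point whose orbit meets the slice is first moved onto it by a group element, which acts
    holomorphically. The slice parameter depends only on the orbit, so the solutions found at
    different points all compute one and the same chart map.

    The projective group and the moduli space are treated by the same statement on quotients. It
    asks for topological charts of the quotient in which the projection is holomorphic, and for a
    holomorphic local section through every point of the total space. A section through each point
    makes the projection a submersion there, and it lets any competing structure be compared with
    the given charts. The comparison goes in one direction only, from the given chart to the
    competing one; the reverse direction is what the Baire argument is for.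

    All algebra is transported to coordinate rows, where the products become bilinear maps with
    explicit bounds. *)

Section RowNorm.
Context {R : realType}.
Local Notation C := (Cx R).

(** The norm of a space over C takes values in C, whose order is partial. Its real part is the same
    number seen in R, where [lra], suprema and minima are available. *)
Definition rnorm (V : normedZmodType C) (x : V) : R := complex.Re (`|x| : complex R).

Lemma rnormE (V : normedZmodType C) (x : V) : `|x| = ((rnorm x)%:C)%C :> C.
Proof.
rewrite /rnorm; have := normr_ge0 x; case: (`|x|) => a b.
by rewrite lecE /= => /andP[/eqP -> _].
Qed.

Lemma lerc (a b : R) : ((a%:C)%C <= (b%:C)%C :> C) = (a <= b).
Proof. by rewrite lecR. Qed.
Lemma ltrc (a b : R) : ((a%:C)%C < (b%:C)%C :> C) = (a < b).
Proof. by rewrite ltcR. Qed.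

Lemma rnorm_ge0 (V : normedZmodType C) (x : V) : 0 <= rnorm x.
Proof. by rewrite -lerc -rnormE normr_ge0. Qed.

Lemma rnormD (V : normedZmodType C) (x y : V) : rnorm (x + y) <= rnorm x + rnorm y.
Proof. by rewrite -lerc rmorphD/= -!rnormE ler_normD. Qed.

Lemma rnormN (V : normedZmodType C) (x : V) : rnorm (- x) = rnorm x.
Proof. by rewrite /rnorm normrN. Qed.

Lemma rnormB (V : normedZmodType C) (x y : V) : rnorm (x - y) = rnorm (y - x).
Proof. by rewrite /rnorm distrC. Qed.

Lemma rnorm0 (V : normedZmodType C) : rnorm (0 : V) = 0.
Proof. by rewrite /rnorm normr0. Qed.

Lemma rnorm_eq0 (V : normedZmodType C) (x : V) : (rnorm x == 0) = (x == 0).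
Proof.
rewrite -[RHS]normr_eq0 rnormE; apply/eqP/eqP => [-> //|[] //].
Qed.

Lemma rnormZ (V : normedModType C) (a : C) (x : V) : rnorm (a *: x) = rnorm a * rnorm x.
Proof.
have : ((rnorm (a *: x))%:C)%C = ((rnorm a * rnorm x)%:C)%C :> C.
  by rewrite rmorphM /= -!rnormE normrZ.
by case.
Qed.

Lemma rnormM (a b : C) : rnorm (a * b) = rnorm a * rnorm b.
Proof. exact: (@rnormZ C^o). Qed.

Lemma pos_rc (e : C) : 0 < e -> exists2 d : R, 0 < d & e = (d%:C)%C.
Proof.
case: e => a b; rewrite ltcE /= => /andP[/eqP -> a0]; by exists a.
Qed.

Lemma nbhs_rnormP (V : normedModType C) (x : V) (P : set V) :
  nbhs x P <-> exists2 d : R, 0 < d & forall y, rnorm (y - x) < d -> P y.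
Proof.
split.
  move/nbhs_ballP => [e /= /pos_rc[d d0 ->] H]; exists d => // y yx.
  by apply: H; rewrite -ball_normE /= rnormE ltrc rnormB.
move=> [d d0 H]; apply/nbhs_ballP; exists ((d%:C)%C : C); first by have := d0; rewrite -ltrc.
by move=> y; rewrite -ball_normE /= rnormE ltrc rnormB => /H.
Qed.

(** The matrix norm is the maximum of the norms of the entries; [0 <= b] covers matrices without
    entries, whose norm is 0. *)
Lemma rnorm_mx_le m n (x : 'M[C]_(m, n)) (b : R) :
  0 <= b -> (rnorm x <= b) <-> forall i j, rnorm (x i j) <= b.
Proof.
move=> b0; have xE : `|x| = _ := mx_normE x.
rewrite -lerc -rnormE xE; split => [H i j|H].
  rewrite -lerc -rnormE; apply: le_trans H.
  by rewrite -[leLHS]nngE num_le; exact: (le_bigmax _ _ (i, j)).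
have : 0 <= ((b%:C)%C : C) by have := b0; rewrite -lerc.
move bE : ((b%:C)%C : C) => c c0.
move: c0 bE => /nonnegP[{}c] bE.
rewrite num_le; apply/bigmax_leP; split=> [|[i j] _].
  by rewrite -num_le/=.
by rewrite -num_le/= -bE rnormE lerc.
Qed.


Lemma rnorm_nearP (V : normedModType C) (x : V) (P : V -> Prop) :
  (\forall y \near x, P y) <->
  exists2 d : R, 0 < d & forall v, rnorm v < d -> P (x + v).
Proof.
apply: (iff_trans (nbhs_rnormP _ _)); split=> -[d d0 H]; exists d => // y yd.
  by apply: H; rewrite addrC addKr.
by rewrite -(subrKC x y); exact: H.
Qed.

Lemma rnorm_cvgP (T : topologicalType) (V : normedModType C) (f : T -> V) (x : T) :
  {for x, continuous f} <->
  forall e : R, 0 < e -> \forall y \near x, rnorm (f y - f x) < e.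
Proof.
split.
  by move=> fc e e0; apply: (fc [set z | rnorm (z - f x) < e]); apply/nbhs_rnormP; exists e.
move=> H A /nbhs_rnormP[e e0 eA]; near=> y; apply: eA; near: y; exact: H.
Unshelve. all: by end_near. Qed.

(** The summand 1 keeps the constant positive for the zero map, so that later constants may divide
    by it. *)
Lemma linear_rnorm_bound n (V : normedModType C) (f : {linear 'rV[C]_n -> V}) :
  exists2 M : R, 0 < M & forall x, rnorm (f x) <= M * rnorm x.
Proof.
exists (1 + \sum_i rnorm (f (delta_mx 0 i))).
  by rewrite ltr_wpDr// sumr_ge0// => i _; exact: rnorm_ge0.
move=> x; rewrite {1}(row_sum_delta x) linear_sum.
apply: (@le_trans _ _ (\sum_i rnorm (x 0 i) * rnorm (f (delta_mx 0 i)))).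
  elim/big_ind2: _ => [|a b c d ab cd|i _]; first by rewrite rnorm0.
    exact: le_trans (rnormD _ _) (lerD ab cd).
  by rewrite linearZ rnormZ.
rewrite mulrDl mul1r addrC ler_wpDr ?rnorm_ge0// mulr_suml ler_sum// => i _.
rewrite mulrC ler_wpM2l ?rnorm_ge0//.
by move: i; apply/(rnorm_mx_le x (rnorm_ge0 _)): 0.
Qed.

End RowNorm.

(** * Completeness and contractions *)

Section Completeness.
Context {R : realType}.
Local Notation C := (Cx R).

Lemma half_pow_lt (a e : R) : 0 < e -> exists k, a * 2^-1 ^+ k < e.
Proof.
move=> e0; have : (geometric a 2^-1 n : R) @[n --> \oo] --> (0 : R).
  by apply: cvg_geometric; rewrite ger0_norm; lra.
move=> /cvgrPdist_lt /(_ _ e0)[k _ /(_ k (leqnn k))] /=; rewrite sub0r normrN => H.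
by exists k; exact: le_lt_trans (ler_norm _) H.
Qed.

Lemma le_half_pow (a b M : R) : (forall k, a <= b + M * 2^-1 ^+ k) -> a <= b.
Proof.
move=> H; rewrite leNgt; apply/negP => ab.
have [|k kM] := @half_pow_lt M (a - b); first by lra.
by have := H k; lra.
Qed.

(** Nested intervals: the interval of radius [M * 2 * 2^-1 ^+ k] about [u k] contains the next one,
    because the radius drops by exactly the allowed step. The limit is the supremum of the left
    ends. *)
Lemma half_pow_complete_real (u : nat -> R) (M : R) :
  (forall k, `|u k.+1 - u k| <= M * 2^-1 ^+ k) ->
  exists l, forall k, `|l - u k| <= M * 2 * 2^-1 ^+ k.
Proof.
move=> uM; pose c k := u k - M * 2 * 2^-1 ^+ k; pose b k := u k + M * 2 * 2^-1 ^+ k.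
have cS k : c k <= c k.+1.
  by move: (uM k); rewrite /c exprSr ler_norml; move: (_ ^+ k) => t; lra.
have bS k : b k.+1 <= b k.
  by move: (uM k); rewrite /b exprSr ler_norml; move: (_ ^+ k) => t; lra.
have cb k : c k <= b k.
  rewrite /c /b; have : 0 <= M * 2^-1 ^+ k by exact: le_trans (uM k).
  by move: (_ ^+ k) => t; lra.
have cm i j : (i <= j)%N -> c i <= c j.
  by apply: (homo_leq (r := fun x y => x <= y)) => //; exact: le_trans.
have bm i j : (i <= j)%N -> b j <= b i.
  by apply: (homo_leq (r := fun x y => y <= x)) => // x y z /[swap]; exact: le_trans.
have cbm i j : c i <= b j.
  have [ij|/ltnW ji] := leqP i j.
    exact: le_trans (cm _ _ ij) (cb _).
  exact: le_trans (cb _) (bm _ _ ji).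
have hs : has_sup (range c).
  by split; [exists (c 0%N), 0%N|exists (b 0%N) => _ [i _ <-]].
exists (sup (range c)) => k.
have c1 : c k <= sup (range c) by apply: sup_upper_bound => //; exists k.
have b1 : sup (range c) <= b k by apply: ge_sup => [|_ [i _ <-]//]; case: hs.
by rewrite ler_norml; move: c1 b1; rewrite /c /b; move: (sup _) => s; lra.
Qed.

Lemma rnorm_complex (x y : R) :
  rnorm (Complex x y : C) = Num.sqrt (x ^+ 2 + y ^+ 2).
Proof.
have nE : `|Complex x y : C| = ((Num.sqrt (x ^+ 2 + y ^+ 2))%:C)%C := normc_def _.
by rewrite /rnorm nE.
Qed.

Lemma rnorm_Re (z : C) : `|complex.Re (z : complex R)| <= rnorm z.
Proof.
case: z => x y; rewrite rnorm_complex /=.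
rewrite -sqrtr_sqr ler_sqrt ?lerDl ?sqr_ge0//.
by rewrite addr_ge0 ?sqr_ge0.
Qed.

Lemma rnorm_Im (z : C) : `|complex.Im (z : complex R)| <= rnorm z.
Proof.
case: z => x y; rewrite rnorm_complex /=.
rewrite -sqrtr_sqr ler_sqrt ?lerDr ?sqr_ge0//.
by rewrite addr_ge0 ?sqr_ge0.
Qed.

Lemma rnorm_le_ReIm (z : C) :
  rnorm z <= `|complex.Re (z : complex R)| + `|complex.Im (z : complex R)|.
Proof.
case: z => x y; rewrite rnorm_complex /=.
have xy : 0 <= `|x| * `|y| by rewrite mulr_ge0.
have H : x ^+ 2 + y ^+ 2 <= (`|x| + `|y|) ^+ 2.
  by rewrite sqrrD !real_normK ?num_real// -mulr_natl; lra.
by rewrite -[leRHS]ger0_norm ?addr_ge0// -sqrtr_sqr ler_sqrt ?sqr_ge0.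
Qed.

(** Real and imaginary parts of each coordinate converge with factor 2, and the modulus is at most
    the sum of the two parts; hence the factor 4. *)
Lemma half_pow_complete n (u : nat -> 'rV[C]_n) (M : R) :
  (forall k, rnorm (u k.+1 - u k) <= M * 2^-1 ^+ k) ->
  exists l, forall k, rnorm (l - u k) <= M * 4 * 2^-1 ^+ k.
Proof.
move=> uM.
have uM' k i : rnorm (u k.+1 0 i - u k 0 i) <= M * 2^-1 ^+ k.
  have M0 := le_trans (rnorm_ge0 _) (uM k).
  by have /(rnorm_mx_le _ M0)/(_ 0 i) := uM k; rewrite !mxE.
have re i : exists l, forall k, `|l - complex.Re (u k 0 i : complex R)| <= M * 2 * 2^-1 ^+ k.
  apply: half_pow_complete_real => k; apply: le_trans (uM' k i).
  by rewrite -raddfB; exact: rnorm_Re.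
have im i : exists l, forall k, `|l - complex.Im (u k 0 i : complex R)| <= M * 2 * 2^-1 ^+ k.
  apply: half_pow_complete_real => k; apply: le_trans (uM' k i).
  by rewrite -raddfB; exact: rnorm_Im.
have [a aP] := choice re; have [b bP] := choice im.
exists (\row_i (Complex (a i) (b i) : C)) => k.
have M0 : 0 <= M * 4 * 2^-1 ^+ k.
  have := le_trans (rnorm_ge0 _) (uM k); move: (_ ^+ k) => t; lra.
apply/rnorm_mx_le => // i j; rewrite !mxE ord1.
apply: le_trans (rnorm_le_ReIm _) _; rewrite !raddfB /=.
by move: (aP j k) (bP j k); move: (_ ^+ k) => t; lra.
Qed.

(** Banach's theorem on a closed ball about 0 with contraction factor 1/2. The bound by
    [2 * rnorm (T 0)] is what later makes a solution depend differentiably on a parameter. *)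
Lemma contraction_fixpoint n (T : 'rV[C]_n -> 'rV[C]_n) (r : R) :
  (forall u v, rnorm u <= r -> rnorm v <= r ->
     rnorm (T u - T v) <= rnorm (u - v) * 2^-1) ->
  rnorm (T 0) <= r * 2^-1 ->
  exists z, [/\ rnorm z <= r, rnorm z <= 2 * rnorm (T 0) & T z = z].
Proof.
move=> TL T0.
pose u k := iter k T 0.
have [uS ur] : (forall k, rnorm (u k.+1 - u k) <= rnorm (T 0) * 2^-1 ^+ k) /\
    (forall k, rnorm (u k) <= r).
  (* The middle bound is the partial sum of the geometric series of the steps; it keeps all iterates
     in the ball on which [T] contracts. *)
  have H k : rnorm (u k.+1 - u k) <= rnorm (T 0) * 2^-1 ^+ k /\
      rnorm (u k.+1) <= 2 * rnorm (T 0) * (1 - 2^-1 ^+ k.+1) /\ rnorm (u k) <= r.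
    have p0 j : 0 <= (2^-1 : R) ^+ j by rewrite exprn_ge0//; lra.
    elim: k => [|k [IH1 [IH2 IH3]]].
      rewrite /u/= subr0 expr0 expr1 mulr1 rnorm0; split; first by [].
      by split; [lra|have := rnorm_ge0 (T 0); lra].
    have IH4 : rnorm (u k.+1) <= r.
      apply: le_trans IH2 _; have := rnorm_ge0 (T 0); move: (p0 k.+1).
      move: (_ ^+ _) => t; nra.
    have IH5 : rnorm (u k.+2 - u k.+1) <= rnorm (T 0) * 2^-1 ^+ k.+1.
      apply: le_trans (TL _ _ IH4 IH3) _; rewrite exprSr mulrA ler_wpM2r//; lra.
    split=> //; split=> //.
    rewrite -(subrK (u k.+1) (u k.+2)); apply: le_trans (rnormD _ _) _.
    apply: (le_trans (lerD IH5 IH2)); rewrite [in leRHS]exprSr.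
    by move: (_ ^+ k.+1) => t; lra.
  by split=> k; case: (H k) => [? []].
have [l lP] := half_pow_complete uS.
have lr : rnorm l <= r.
  apply: (@le_half_pow _ _ (rnorm (T 0) * 4)) => k.
  rewrite -(subrK (u k) l) addrC; apply: le_trans (rnormD _ _) _.
  exact: lerD.
have Tl : T l = l.
  apply/eqP; rewrite -subr_eq0 -rnorm_eq0 eq_le rnorm_ge0 andbT.
  apply: (@le_half_pow _ _ (rnorm (T 0) * 8)) => k; rewrite add0r.
  rewrite -(subrK (u k.+1) (T l)) -addrA; apply: le_trans (rnormD _ _) _.
  have := TL _ _ lr (ur k); rewrite -/(u k.+1) => H.
  have := lP k; have := lP k.+1; rewrite exprSr rnormB => H1 H2.
  move: H H1 H2; have := rnorm_ge0 (T 0); have : 0 <= (2^-1 : R) ^+ k by rewrite exprn_ge0//; lra.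
  rewrite -/(u k.+1); move: (_ ^+ k) => t; nra.
exists l; split=> //.
have : rnorm (T l - T 0) <= rnorm (l - 0) * 2^-1.
  by apply: TL => //; rewrite rnorm0; exact: le_trans (rnorm_ge0 l) lr.
have := rnormD (T l - T 0) (T 0); rewrite subrK Tl subr0; lra.
Qed.

End Completeness.

(** * Complex differentiability *)

Section Differentiability.
Context {R : realType}.
Local Notation C := (Cx R).

Lemma linear_row_continuous n (V : normedModType C) (f : {linear 'rV[C]_n -> V}) :
  continuous f.
Proof.
have [M M0 fM] := linear_rnorm_bound f.
move=> x; apply/rnorm_cvgP => e e0; apply/nbhs_rnormP; exists (e / M); first exact: divr_gt0.
move=> y yx; rewrite -linearB; apply: le_lt_trans (fM _) _.
by rewrite mulrC -ltr_pdivlMr.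
Qed.

(** With [rnorm_diff] this replaces the little-o calculus by real epsilons and deltas. *)
Lemma diff_rnorm (V W : normedModType C) (f : V -> W) (x : V) : differentiable f x ->
  forall e : R, 0 < e -> exists2 d : R, 0 < d &
    forall v, rnorm v < d -> rnorm (f (x + v) - f x - 'd f x v) <= e * rnorm v.
Proof.
move=> /diff_locally /eqaddoP fo e e0.
have e0' : 0 < ((e%:C)%C : C) by have := e0; rewrite -ltrc.
have /nbhs_rnormP[d d0 H] := fo _ e0'.
exists d => // v vd; have := H v; rewrite subr0 => /(_ vd) /=.
rewrite (_ : (_ : V -> W) v = f (x + v) - f x - 'd f x v).
  by rewrite !rnormE -rmorphM/= lerc.
by rewrite -[LHS]/(f (v + x) - (f x + 'd f x v)) (addrC v) opprD addrA.
Qed.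

Lemma rnorm_diff (V W : normedModType C) (f : V -> W) (x : V) (L : {linear V -> W}) :
  continuous L ->
  (forall e : R, 0 < e -> exists2 d : R, 0 < d &
    forall v, rnorm v < d -> rnorm (f (x + v) - f x - L v) <= e * rnorm v) ->
  differentiable f x /\ 'd f x = L :> (V -> W).
Proof.
move=> Lc H.
have fo : f \o shift x = cst (f x) + L +o_ 0 id.
  apply/eqaddoP => _ /pos_rc[e e0 ->]; have [d d0 {}H] := H e e0.
  apply/nbhs_rnormP; exists d => // v; rewrite subr0 => /H.
  have E : (f \o shift x - (cst (f x) + L)) v = f (x + v) - f x - L v.
    by rewrite -[LHS]/(f (v + x) - (f x + L v)) (addrC v) opprD addrA.
  by rewrite -lerc rmorphM/= -!rnormE E.
have dL := diff_unique Lc fo.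
by split=> //; apply/diff_locallyP; rewrite dL.
Qed.

Lemma near_eq_diff (V W : normedModType C) (f g : V -> W) (x : V) :
  (\forall y \near x, f y = g y) -> differentiable f x ->
  differentiable g x /\ 'd g x = 'd f x :> (V -> W).
Proof.
move=> fg df; apply: rnorm_diff => [|e e0]; first exact: diff_continuous.
have /rnorm_nearP[d1 d10 H1] := fg.
have [d2 d20 H2] := diff_rnorm df e0.
exists (Order.min d1 d2); first by rewrite lt_min d10.
move=> v; rewrite lt_min => /andP[v1 v2].
rewrite -H1// -(nbhs_singleton fg); exact: H2.
Qed.

Lemma differentiable_row (V : normedModType C) m (f : V -> 'rV[C]_m) (x : V) :
  (forall j, differentiable (fun v => f v 0 j : C) x) -> differentiable f x.
Proof.
move=> H.
have -> : f = \sum_(j < m) (fun v => f v 0 j *: delta_mx 0 j).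
  apply/funext => v; rewrite fct_sumE {1}(row_sum_delta (f v)).
  by apply: eq_bigr.
by apply: differentiable_sum => j; exact: differentiableZl.
Qed.

Lemma differentiable_row_coord (V : normedModType C) m (f : V -> 'rV[C]_m) (x : V) j :
  differentiable f x -> differentiable (fun v => f v 0 j : C) x.
Proof.
move=> df; apply: (@differentiable_comp _ _ _ _ f (fun r : 'rV_m => r 0 j : C)) => //.
exact: differentiable_coord.
Qed.

Lemma differentiable_sumr (V W : normedModType C) (I : Type) (r : seq I) (P : pred I)
    (f : I -> V -> W) (x : V) :
  (forall i, differentiable (f i) x) ->
  differentiable (fun v => \sum_(i <- r | P i) f i v) x.
Proof.
move=> H; elim: r => [|i r IH].
  have -> : (fun v => \sum_(i <- [::] | P i) f i v) = cst 0.
    by apply/funext => v; rewrite big_nil.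
  exact: differentiable_cst.
have [Pi|nPi] := boolP (P i).
  have -> : (fun v => \sum_(i <- i :: r | P i) f i v) =
      f i + (fun v => \sum_(i <- r | P i) f i v).
    by apply/funext => v; rewrite big_cons Pi.
  exact: differentiableD.
have -> // : (fun v => \sum_(i <- i :: r | P i) f i v) =
    (fun v => \sum_(i <- r | P i) f i v).
by apply/funext => v; rewrite big_cons (negPf nPi).
Qed.

Lemma differentiable_prodr (V : normedModType C) (I : Type) (r : seq I) (P : pred I)
    (f : I -> V -> C) (x : V) :
  (forall i, differentiable (f i) x) ->
  differentiable (fun v => \prod_(i <- r | P i) f i v : C) x.
Proof.
move=> H; elim: r => [|i r IH].
  have -> : (fun v => \prod_(i <- [::] | P i) f i v) = cst 1.
    by apply/funext => v; rewrite big_nil.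
  exact: differentiable_cst.
have [Pi|nPi] := boolP (P i).
  have -> : (fun v => \prod_(i <- i :: r | P i) f i v) =
      f i * (fun v => \prod_(i <- r | P i) f i v).
    by apply/funext => v; rewrite big_cons Pi.
  exact: differentiableM.
have -> // : (fun v => \prod_(i <- i :: r | P i) f i v) =
    (fun v => \prod_(i <- r | P i) f i v).
by apply/funext => v; rewrite big_cons (negPf nPi).
Qed.

Lemma differentiable_mul (V : normedModType C) (f g : V -> C) (x : V) :
  differentiable f x -> differentiable g x ->
  differentiable (fun v => f v * g v : C) x.
Proof. exact: differentiableM. Qed.

Lemma differentiable_det (V : normedModType C) k (A : V -> 'M[C]_k) (x : V) :
  (forall i j, differentiable (fun v => A v i j : C) x) ->
  differentiable (fun v => \det (A v) : C) x.
Proof.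
move=> H; apply: differentiable_sumr => s; apply: differentiable_mul.
  exact: differentiable_cst.
exact: differentiable_prodr.
Qed.

Lemma differentiable_mulmx (V : normedModType C) k l m (A : V -> 'M[C]_(k, l))
    (B : V -> 'M[C]_(l, m)) (x : V) :
  (forall i j, differentiable (fun v => A v i j : C) x) ->
  (forall i j, differentiable (fun v => B v i j : C) x) ->
  forall i j, differentiable (fun v => (A v *m B v) i j : C) x.
Proof.
move=> HA HB i j.
have -> : (fun v => (A v *m B v) i j) = (fun v => \sum_l A v i l * B v l j).
  by apply/funext => v; rewrite mxE.
by apply: differentiable_sumr => s; exact: differentiable_mul.
Qed.

Lemma unitmx_near (V : normedModType C) k (A : V -> 'M[C]_k) (x : V) :
  (forall i j, differentiable (fun v => A v i j : C) x) -> A x \in unitmx ->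
  \forall y \near x, A y \in unitmx.
Proof.
move=> H; rewrite unitmxE unitfE => Ax.
have c : {for x, continuous (fun v => \det (A v) : C)}.
  exact/differentiable_continuous/differentiable_det.
have Ay : \forall y \near x, \det (A y) != 0 by exact: cvgr_neq0 c Ax.
by apply: filterS Ay => y; rewrite unitmxE unitfE.
Qed.

(** Cramer's rule: near [x] the inverse is the adjugate divided by the determinant. *)
Lemma differentiable_invmx (V : normedModType C) k (A : V -> 'M[C]_k) (x : V) :
  (forall i j, differentiable (fun v => A v i j : C) x) -> A x \in unitmx ->
  forall i j, differentiable (fun v => invmx (A v) i j : C) x.
Proof.
move=> H Ax i j.
have := @near_eq_diff _ _ (fun v => (\det (A v))^-1 * \adj (A v) i j : C)
  (fun v => invmx (A v) i j : C) x.
case => //.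
  by apply: filterS (unitmx_near H Ax) => y Ay; rewrite /invmx Ay [RHS]mxE.
apply: differentiable_mul.
  by apply: differentiableV; [exact: differentiable_det|rewrite -unitfE -unitmxE].
have -> : (fun v => \adj (A v) i j : C) = (fun v => (-1) ^+ (j + i) *
    \det (row' j (col' i (A v))) : C) by apply/funext => v; rewrite mxE.
apply: differentiable_mul; first exact: differentiable_cst.
apply: differentiable_det => k1 k2.
have -> // : (fun v => row' j (col' i (A v)) k1 k2) = (fun v => A v (lift j k1) (lift i k2)).
by apply/funext => v; rewrite !mxE.
Qed.

(** Put [v = g (f x + w) - x]. Continuity of [g] makes [v] small, and differentiability of [f] at
    [x] bounds [w - 'd f x v] by a small multiple of [v]; multiplying by [B] does the same for
    [v - w *m B]. The tolerance [e2] first gives [rnorm v <= 2 * M * rnorm w]; the tolerance [e1]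
    then turns the error into [e * rnorm w]. Only the derivative at the one point is involved. *)
Lemma inverse_differentiable n m (f : 'rV[C]_n -> 'rV[C]_m) (g : 'rV[C]_m -> 'rV[C]_n)
    (x : 'rV[C]_n) (B : 'M[C]_(m, n)) :
  differentiable f x -> (forall v, 'd f x v *m B = v) -> (forall w, 'd f x (w *m B) = w) ->
  g (f x) = x -> (\forall w \near f x, f (g w) = w) -> {for f x, continuous g} ->
  differentiable g (f x) /\ 'd g (f x) = mulmxr B :> ('rV[C]_m -> 'rV[C]_n).
Proof.
move=> df fB Bf gfx fgw gc.
have gB : continuous (mulmxr B : 'rV[C]_m -> 'rV[C]_n) by exact: linear_row_continuous.
apply: rnorm_diff => // e e0.
have [M M0 BM] := linear_rnorm_bound (mulmxr B : {linear 'rV[C]_m -> 'rV[C]_n}).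
have e1 : 0 < e / (2 * M * M) by rewrite divr_gt0// !mulr_gt0.
have e2 : 0 < 1 / (2 * M) by rewrite divr_gt0// !mulr_gt0.
have [d1 d10 H1] := diff_rnorm df e1.
have [d2 d20 H2] := diff_rnorm df e2.
have /rnorm_nearP[d3 d30 H3] := fgw.
have m0 : 0 < Order.min d1 d2 by rewrite lt_min d10.
have /rnorm_cvgP/(_ _ m0)/rnorm_nearP[d4 d40 H4] := gc.
exists (Order.min d3 d4); first by rewrite lt_min d30.
move=> w; rewrite lt_min => /andP[/H3 w3 /H4]; rewrite gfx lt_min => /andP[w1 w2].
set v := g (f x + w) - x in w1 w2 *.
have vE : f (x + v) = f x + w by rewrite /v subrKC.
have := H1 v w1; have := H2 v w2; rewrite vE [f x + w]addrC addrK => h2 h1.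
have vB : v - w *m B = - ((w - 'd f x v) *m B) by rewrite mulmxBl fB opprB.
have nv : rnorm v <= 2 * M * rnorm w.
  have : rnorm v <= rnorm (v - w *m B) + rnorm (w *m B).
    by have := rnormD (v - w *m B) (w *m B); rewrite subrK.
  rewrite vB rnormN; have := BM w; have := BM (w - 'd f x v); rewrite /= => a b c.
  have := ler_wpM2l (ltW M0) h2.
  rewrite (_ : M * (1 / (2 * M) * rnorm v) = rnorm v / 2); first by lra.
  by field; rewrite lt0r_neq0.
rewrite /= vB rnormN; apply: le_trans (BM _) _.
apply: (le_trans (ler_wpM2l (ltW M0) h1)).
apply: (@le_trans _ _ (M * (e / (2 * M * M) * (2 * M * rnorm w)))).
  by rewrite !ler_wpM2l// ltW.
rewrite (_ : M * _ = e * rnorm w)//.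
by field; rewrite lt0r_neq0.
Qed.

End Differentiability.

(** * Baire's theorem and injective submersions *)

Section Dimension.
Context {R : realType}.
Local Notation C := (Cx R).

Lemma surj_right_inverse n m (f : {linear 'rV[C]_n -> 'rV[C]_m}) :
  range f = setT -> exists B : 'M[C]_(m, n), forall w, f (w *m B) = w.
Proof.
move=> fT; have pre j : exists v, f v = delta_mx 0 j.
  have [v _ fv] : range f (delta_mx 0 j) by rewrite fT.
  by exists v.
have [g gP] := choice pre; exists (\matrix_j g j) => w.
rewrite mulmx_sum_row linear_sum [RHS]row_sum_delta; apply: eq_bigr => j _.
by rewrite rowK linearZ gP.
Qed.

(** If no [F k] contained a ball, balls avoiding [F 0], [F 1], and so on could be chosen one inside
    the other, and their common point would lie in no [F k]. Closedness of [F k] is asked only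
    relative to the given ball. *)
Lemma baire_closed_cover n (F : nat -> set 'rV[C]_n) (x0 : 'rV[C]_n) (r0 : R) :
  0 < r0 ->
  (forall k x, rnorm (x - x0) < r0 -> ~ F k x ->
     exists2 d : R, 0 < d & forall y, rnorm (y - x) < d -> ~ F k y) ->
  (forall x, rnorm (x - x0) < r0 -> exists k, F k x) ->
  exists k x, exists2 r : R, 0 < r & forall y, rnorm (y - x) < r ->
    rnorm (y - x0) < r0 /\ F k y.
Proof.
move=> r00 Fcl Fcov; apply: contrapT => noball.
pose good (p : 'rV[C]_n * R) := 0 < p.2 /\ rnorm (p.1 - x0) + p.2 <= r0.
have step (kp : nat * ('rV[C]_n * R)) : exists q, good kp.2 ->
    [/\ good q, q.2 <= kp.2.2 / 4, rnorm (q.1 - kp.2.1) <= kp.2.2 / 4 &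
      forall z, rnorm (z - q.1) < q.2 -> ~ F kp.1 z].
  case: kp => k [x r] /=.
  (* For a pair that is not [good] the requirement is vacuous and any witness serves; the sequence
     below never meets this case. *)
  have [gx|] := pselect (good (x, r)); last by exists (x, r).
  have [/= r_gt0 rx] := gx.
  have [y yx nF] : exists2 y, rnorm (y - x) < r / 4 & ~ F k y.
    apply: contrapT => H; apply: noball; exists k, x, (r / 4); first by lra.
    move=> y yx; split; last by apply: contrapT => nF; apply: H; exists y.
    by have := rnormD (y - x) (x - x0); rewrite subrKA; lra.
  have yx0 : rnorm (y - x0) < r0 - r / 2.
    by have := rnormD (y - x) (x - x0); rewrite subrKA; lra.
  have [|d d0 dF] := Fcl k y _ nF; first by lra.
  exists (y, Order.min d (r / 4)) => _; split => /=.
  - split => /=; first by rewrite lt_min d0/=; lra.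
    have : Order.min d (r / 4) <= r / 4 by rewrite ge_min lexx orbT.
    by move: (Order.min _ _) => s; lra.
  - by rewrite ge_min lexx orbT.
  - exact: ltW.
  - by move=> z; rewrite lt_min => /andP[/dF].
have [st stP] := choice step.
pose s := fix s k := if k is k'.+1 then st (k', s k') else (x0, r0).
have sg k : good (s k).
  elim: k => [|k IH]; first by rewrite /good/= subrr rnorm0 add0r.
  by have [] := stP (k, s k) IH.
pose u k := (s k).1; pose r k := (s k).2.
have r_gt0 k : 0 < r k by case: (sg k).
have rS k : r k.+1 <= r k / 4 by case: (stP (k, s k) (sg k)).
have uS k : rnorm (u k.+1 - u k) <= r k / 4 by case: (stP (k, s k) (sg k)).
have nF k z : rnorm (z - u k.+1) < r k.+1 -> ~ F k z.
  by case: (stP (k, s k) (sg k)) => _ _ _; exact.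
have rk k : r k <= r0 * 2^-1 ^+ k.
  elim: k => [|k IH]; first by rewrite expr0 mulr1.
  by rewrite exprSr; move: (rS k) (r_gt0 k) IH; move: (_ ^+ k) => t; lra.
have [l lP] : exists l, forall k, rnorm (l - u k) <= r0 * 4 * 2^-1 ^+ k.
  apply: half_pow_complete => k; apply: le_trans (uS k) _.
  by move: (rk k) (r_gt0 k); move: (_ ^+ k) => t; lra.
(* One step moves the centre by at most [r / 4] and leaves half a radius of at most [r / 8],
   together less than [r / 2]. Hence the limit stays strictly inside every ball. *)
have near k j : rnorm (u (k + j)%N - u k) + r (k + j)%N / 2 <= r k / 2.
  elim: j => [|j IH]; first by rewrite addn0 subrr rnorm0 add0r.
  rewrite addnS; apply: le_trans IH.
  have := rnormD (u (k + j).+1 - u (k + j)%N) (u (k + j)%N - u k).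
  by rewrite subrKA; move: (uS (k + j)%N) (rS (k + j)%N) (r_gt0 (k + j)%N); lra.
have lk k : rnorm (l - u k) < r k.
  suff : rnorm (l - u k) <= r k / 2 by have := r_gt0 k; lra.
  apply: (@le_half_pow _ _ _ (r0 * 4)) => j.
  have := rnormD (l - u (k + j)%N) (u (k + j)%N - u k); rewrite subrKA.
  have := near k j; have := r_gt0 (k + j)%N; have := lP (k + j)%N.
  have : (2^-1 : R) ^+ (k + j) <= 2^-1 ^+ j.
    by rewrite exprD ler_piMl ?exprn_ge0// ?exprn_ile1//; lra.
  move: (2^-1 ^+ (k + j)) (2^-1 ^+ j) => a b; nra.
have [k Fk] := Fcov l (lk 0%N).
exact: nF (lk k.+1) Fk.
Qed.

Lemma rat_dense (x : R) (e : R) : 0 < e -> exists q : rat, `|ratr q - x| < e.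
Proof.
move=> e0; have [|q] := @rat_in_itvoo R (x - e) (x + e); first by lra.
by rewrite in_itv /= => /andP[a b]; exists q; rewrite ltr_norml; lra.
Qed.

Definition ratc (q : rat * rat) : C := Complex (ratr q.1 : R) (ratr q.2).

Lemma ratc_dense (x : C) (e : R) : 0 < e -> exists q, rnorm (ratc q - x) <= e.
Proof.
move=> e0; have e20 : 0 < e / 2 by lra.
have [q1 h1] := rat_dense (complex.Re (x : complex R)) e20.
have [q2 h2] := rat_dense (complex.Im (x : complex R)) e20.
exists (q1, q2); apply: le_trans (rnorm_le_ReIm _) _.
by rewrite !raddfB /=; lra.
Qed.

Lemma rnorm_sum (V : normedZmodType C) (I : Type) (r : seq I) (P : pred I) (F : I -> V) :
  rnorm (\sum_(i <- r | P i) F i) <= \sum_(i <- r | P i) rnorm (F i).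
Proof.
elim/big_ind2: _ => [|a b c d ab cd|//]; first by rewrite rnorm0.
exact: le_trans (rnormD _ _) (lerD ab cd).
Qed.

Lemma rnorm_coord m n (A : 'M[C]_(m, n)) i j : rnorm (A i j) <= rnorm A.
Proof. by move: i j; apply/(rnorm_mx_le A (rnorm_ge0 A)). Qed.

Lemma rnorm_mulmx m n (w : 'rV[C]_m) (A : 'M[C]_(m, n)) (d : R) : 0 <= d ->
  (forall i j, rnorm (A i j) <= d) -> rnorm (w *m A) <= m%:R * d * rnorm w.
Proof.
move=> d0 Ad; apply/rnorm_mx_le => [|i j]; first by rewrite !mulr_ge0// rnorm_ge0.
rewrite !mxE; apply: le_trans (rnorm_sum _ _ _) _.
apply: (@le_trans _ _ (\sum_(k < m) d * rnorm w)).
  by apply: ler_sum => k _; rewrite rnormM mulrC ler_pM ?rnorm_ge0// rnorm_coord.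
by rewrite sumr_const card_ord -[leLHS]mulr_natl mulrA.
Qed.

(* For a matrix L and N > 0, [cond N L] is a closed condition on z, and with
   [L] ranging over rational matrices these countably many conditions cover the
   domain: at z take for [L] an approximate right inverse of the derivative. *)
Lemma submersion_injective_dim n m (f : 'rV[C]_n -> 'rV[C]_m) (x0 : 'rV[C]_n) (r0 : R) :
  0 < r0 ->
  (forall x y, rnorm (x - x0) < r0 -> rnorm (y - x0) < r0 -> f x = f y -> x = y) ->
  (forall x, rnorm (x - x0) < r0 -> differentiable f x /\ range ('d f x) = setT) ->
  (n <= m)%N.
Proof.
move=> r00 finj fdiff.
pose cond (N : nat) (L : 'M[C]_(m, n)) z := forall w, rnorm w <= N.+1%:R^-1 ->
  rnorm (w *m L) < r0 / 2 -> rnorm (f (z + w *m L) - f z - w) <= rnorm w / 2.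
(* The index [k] encodes the pair of [N] and a matrix of rational complex numbers; numbers that
   encode nothing give the empty set. *)
pose F (k : nat) : set 'rV[C]_n :=
  if unpickle k is Some (N, L) then cond N (map_mx ratc L) else set0.
have fc x : rnorm (x - x0) < r0 -> {for x, continuous f}.
  by move=> /fdiff[df _]; exact: differentiable_continuous.
have r2 : 0 < r0 / 2 by lra.
have [||k [z [r r_gt0 zF]]] := @baire_closed_cover n F x0 (r0 / 2) r2.
(* Closedness: a failure of [cond] at [x] is a strict inequality for one fixed [w], and it persists
   near [x] by continuity of [f] at [x] and at [x + w *m L]. The second point stays in the domain
   because both displacements are below [r0 / 2]. *)
- move=> k x xx0; rewrite /F; case: unpickle => [[N L]|_]; last by exists 1 => // y _ [].
  move: (map_mx ratc L) => {}L ncond.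
  have [w [wN wL wf]] : exists w, [/\ rnorm w <= N.+1%:R^-1, rnorm (w *m L) < r0 / 2 &
      rnorm w / 2 < rnorm (f (x + w *m L) - f x - w)].
    apply: contrapT => H; apply: ncond => w wN wL; rewrite leNgt; apply/negP => wf.
    by apply: H; exists w.
  set e := rnorm (f (x + w *m L) - f x - w) - rnorm w / 2.
  have e0 : 0 < e / 2 by rewrite /e; lra.
  have x1 : rnorm (x - x0) < r0 by lra.
  have x2 : rnorm (x + w *m L - x0) < r0.
    by have := rnormD (w *m L) (x - x0); rewrite addrA [w *m L + x]addrC; lra.
  have /rnorm_cvgP/(_ _ e0)/nbhs_rnormP[d1 d10 H1] := fc _ x1.
  have /rnorm_cvgP/(_ _ e0)/nbhs_rnormP[d2 d20 H2] := fc _ x2.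
  exists (Order.min d1 d2); first by rewrite lt_min d10.
  move=> y; rewrite lt_min => /andP[/H1 y1 yx /(_ w wN wL) yw].
  have {H2 yx}y2 : rnorm (f (y + w *m L) - f (x + w *m L)) < e / 2.
    by apply: H2; rewrite opprD addrACA subrr addr0.
  have := rnormD (f (x + w *m L) - f (y + w *m L)) (f (y + w *m L) - f x - w).
  have := rnormD (f y - f x) (f (y + w *m L) - f y - w).
  rewrite [rnorm (f (x + _) - f (y + _))]rnormB.
  have -> : f y - f x + (f (y + w *m L) - f y - w) = f (y + w *m L) - f x - w.
    by rewrite addrA; congr (_ - _); rewrite addrC subrKA.
  have -> : f (x + w *m L) - f (y + w *m L) + (f (y + w *m L) - f x - w) =
      f (x + w *m L) - f x - w.
    by rewrite addrA; congr (_ - _); rewrite subrKA.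
  rewrite /e in y1 y2 *; lra.
- move=> x xx0; have xr0 : rnorm (x - x0) < r0 by lra.
  have [df dfT] := fdiff x xr0.
  have [B BP] := surj_right_inverse dfT.
  have [M M0 MP] := linear_rnorm_bound ('d f x).
  have m1 : 0 < (m%:R : R) + 1 by rewrite ltr_wpDl.
  (* Covering: this precision makes ['d f x (w *m Lc)] differ from [w] by at most a quarter of
     [rnorm w]; the differentiability error with tolerance [(4 * K)^-1] is another quarter. Using
     [m + 1] avoids a zero divisor when [m = 0]. *)
  pose dl : R := (M * (m%:R + 1) * 4)^-1.
  have dl0 : 0 < dl by rewrite invr_gt0 !mulr_gt0.
  have /choice[Lf LfP] : forall i, exists q, forall j, rnorm (ratc (q j) - B i j) <= dl.
    move=> i; have [q qP] := choice (fun j => ratc_dense (B i j) dl0).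
    by exists q.
  pose L : 'M[(rat * rat)%type]_(m, n) := \matrix_(i, j) Lf i j.
  pose Lc := map_mx ratc L.
  have LB w : rnorm ('d f x (w *m Lc) - w) <= rnorm w / 4.
    rewrite -{2}(BP w) -linearB -mulmxBr; apply: le_trans (MP _) _.
    apply: (@le_trans _ _ (M * (m%:R * dl * rnorm w))).
      rewrite ler_wpM2l ?(ltW M0)//; apply: rnorm_mulmx => [|i j]; first exact: ltW.
      by rewrite !mxE.
    rewrite !mulrA [leRHS]mulrC ler_wpM2r ?rnorm_ge0// /dl.
    have -> : M * m%:R / (M * (m%:R + 1) * 4) = m%:R / (m%:R + 1) * 4^-1.
      by field; rewrite !lt0r_neq0.
    rewrite ler_piMl ?invr_ge0// ler_pdivrMr//; lra.
  have [K K0 KP] := linear_rnorm_bound (mulmxr Lc : {linear 'rV[C]_m -> 'rV[C]_n}).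
  have e0 : 0 < (4 * K)^-1 by rewrite invr_gt0 mulr_gt0.
  have [d d0 dP] := diff_rnorm df e0.
  have dK : 0 < d / K by rewrite divr_gt0.
  have [N NP] : exists N, N.+1%:R^-1 < d / K.
    exists (Num.bound (d / K)^-1).
    rewrite invf_plt ?posrE//; have := archi_boundP (ltW _ : 0 <= (d / K)^-1).
    rewrite invr_gt0 => /(_ dK) /lt_trans; apply; by rewrite ltr_nat.
  exists (pickle (N, L)); rewrite /F pickleK => w wN wL; rewrite -/Lc in wL *.
  have := KP w; rewrite /= => wK.
  have wd : rnorm (w *m Lc) < d.
    apply: le_lt_trans wK _; rewrite mulrC -ltr_pdivlMr//; exact: le_lt_trans NP.
  have := dP (w *m Lc) wd; set A := f _ - f x => Aw.
  have := rnormD (A - 'd f x (w *m Lc)) ('d f x (w *m Lc) - w); rewrite subrKA.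
  have : (4 * K)^-1 * rnorm (w *m Lc) <= rnorm w / 4.
    by rewrite invfM -mulrA [leRHS]mulrC ler_wpM2l// ler_pdivrMl.
  by have := LB w; lra.
have [zx0 zFk] : rnorm (z - x0) < r0 / 2 /\ F k z by apply: zF; rewrite subrr rnorm0.
move: zFk zF; rewrite /F; case: (unpickle k) => [[N L]|//] _; move: (map_mx ratc L) => {}L zF.
(* If [m < n], some vector [v] lies outside the row space of [L]. For small [t] the equation
   [f (z + w *m L) = f (z + tv)] is solvable in [w], and injectivity then puts [v] into that row
   space. *)
rewrite leqNgt; apply/negP => mn.
have [v vL] : exists v : 'rV[C]_n, ~~ (v <= L)%MS.
  apply: contrapT => H; have : (1%:M <= L)%MS.
    apply/row_subP => i; apply: contrapT => /negP Hi; apply: H; by exists (row i 1%:M).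
  by move=> /mxrankS; rewrite mxrank1 leqNgt (leq_ltn_trans (rank_leq_row L)).
have [K K0 KP] := linear_rnorm_bound (mulmxr L : {linear 'rV[C]_m -> 'rV[C]_n}).
have N0 : 0 < (N.+1%:R^-1 : R) by rewrite invr_gt0.
have [rho [rho0 rhoN rhoK rhor]] : exists rho : R, [/\ 0 < rho, 2 * rho <= N.+1%:R^-1,
    K * (2 * rho) < r0 / 2 & K * rho < r].
  have a0 : 0 < r0 / (8 * K) by rewrite divr_gt0 ?mulr_gt0.
  have b0 : 0 < r / (2 * K) by rewrite divr_gt0 ?mulr_gt0.
  exists (Order.min (N.+1%:R^-1 / 2) (Order.min (r0 / (8 * K)) (r / (2 * K)))).
  set q := Order.min _ _.
  have q1 : q <= N.+1%:R^-1 / 2 by rewrite ge_min lexx.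
  have q2 : q <= r0 / (8 * K) by rewrite !ge_min lexx orbT.
  have q3 : q <= r / (2 * K) by rewrite !ge_min lexx !orbT.
  split; first by rewrite !lt_min a0 b0 divr_gt0.
  - by rewrite mulrC -ler_pdivlMr.
  - have := ler_wpM2l (ltW K0) q2; rewrite (_ : K * (r0 / (8 * K)) = r0 / 8); first by lra.
    by field; rewrite lt0r_neq0.
  - have := ler_wpM2l (ltW K0) q3; rewrite (_ : K * (r / (2 * K)) = r / 2); first by lra.
    by field; rewrite lt0r_neq0.
have z0 : rnorm (z - x0) < r0 by lra.
have rho2 : 0 < rho / 2 by lra.
have /rnorm_cvgP/(_ _ rho2)/rnorm_nearP[d d0 dP] := fc _ z0.
have [t t0 [tvd tvr]] : exists2 t : R, 0 < t & t * rnorm v < d /\ t * rnorm v < r.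
  have v1 : 0 < rnorm v + 1 by rewrite ltr_wpDl ?rnorm_ge0.
  have h (a : R) : 0 < a -> a / (rnorm v + 1) * rnorm v < a.
    move=> a0; rewrite mulrAC ltr_pdivrMr// ltr_pM2l//; lra.
  exists (Order.min d r / (rnorm v + 1)); first by rewrite divr_gt0// lt_min d0.
  have h1 := h (Order.min d r).
  by split; apply: lt_le_trans (h1 _) _; rewrite ?lt_min ?d0// ge_min lexx ?orbT.
pose tv := ((t%:C)%C : C) *: v.
have tvE : rnorm tv = t * rnorm v.
  by rewrite rnormZ rnorm_complex expr0n addr0 sqrtr_sqr gtr0_norm.
(* Fixed points of [T] are the solutions of the equation. The condition [cond] at the point
   [z + b *m L] with displacement [a - b] says precisely that [T] contracts by 1/2, which is why it
   must hold on a whole ball. *)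
pose T w := w - (f (z + w *m L) - f (z + tv)).
have Lw w : rnorm w <= rho -> rnorm (z + w *m L - z) < r.
  move=> wr; rewrite addrAC subrr add0r; apply: le_lt_trans (KP w) _.
  by apply: le_lt_trans rhor; rewrite ler_wpM2l// ltW.
have [||w [wr _ wT]] := @contraction_fixpoint R m T rho.
- move=> a b ar br.
  have ab : rnorm (a - b) <= 2 * rho by have := rnormD a (- b); rewrite rnormN; lra.
  have abL : rnorm ((a - b) *m L) < r0 / 2.
    apply: le_lt_trans (KP _) _; apply: le_lt_trans rhoK.
    by rewrite ler_wpM2l// ltW.
  have [_ /(_ (a - b) (le_trans ab rhoN) abL)] := zF _ (Lw b br).
  have -> : z + b *m L + (a - b) *m L = z + a *m L.
    by rewrite mulmxBl -addrA subrKC.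
  rewrite -rnormN; congr (rnorm _ <= _).
  by rewrite /T; apply/rowP => i; rewrite !mxE; ring.
- rewrite /T mul0mx addr0 sub0r opprB; apply: ltW; apply: dP; by rewrite tvE.
have fE : f (z + w *m L) = f (z + tv).
  by move/eqP: wT; rewrite /T -subr_eq0 addrAC subrr sub0r oppr_eq0 subr_eq0 => /eqP.
have in0 y : rnorm (y - z) < r -> rnorm (y - x0) < r0.
  by move=> /zF[]; lra.
have := finj _ _ (in0 _ (Lw w wr)) (in0 (z + tv) _) fE.
rewrite addrAC subrr add0r tvE => /(_ tvr) /addrI wtv.
move: vL; apply/negP; rewrite negbK.
have -> : v = (((t^-1)%:C)%C : C) *: (w *m L).
  by rewrite wtv scalerA -rmorphM/= mulVf ?lt0r_neq0// scale1r.
by rewrite scalemx_sub// submxMl.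
Qed.

End Dimension.

(** * Charts *)

Section Charts.
Context {R : realType}.
Local Notation C := (Cx R).

(** The germ form of [local_rep]: the representative may vary from point to point and is
    differentiable at one point only. [hol_at_local_rep] passes from such germs back to a single
    representative. *)
Definition rep_at (X Y : topologicalType) (c : @chart R X) (c' : @chart R Y) (f : X -> Y)
    (x : X) (h : 'rV[C]_(chart_dim c) -> 'rV[C]_(chart_dim c')) : Prop :=
  (\forall y \near x, h (chart_map c y) = chart_map c' (f y)) /\
  differentiable h (chart_map c x).

Definition hol_at (X Y : topologicalType) (c : @chart R X) (c' : @chart R Y) (f : X -> Y)
    (x : X) : Prop := exists h, rep_at (c := c) (c' := c') f x h.

Definition sub_at (X Y : topologicalType) (c : @chart R X) (c' : @chart R Y) (f : X -> Y)
    (x : X) : Prop :=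
  exists2 h, rep_at (c := c) (c' := c') f x h & range ('d h (chart_map c x)) = setT.

Lemma sub_hol_at (X Y : topologicalType) (c : @chart R X) (c' : @chart R Y) f x :
  sub_at c c' f x -> hol_at c c' f x.
Proof. by case=> h ? _; exists h. Qed.

Lemma chart_dom_nbhs (X : topologicalType) (c : @chart R X) x :
  is_chart c -> chart_dom c x -> nbhs x (chart_dom c).
Proof. by case=> oc _ _ _ cx; exact: open_nbhs_nbhs. Qed.

Lemma within_open_continuousP (X Y : topologicalType) (D : set X) (f : X -> Y) : open D ->
  {within D, continuous f} <-> forall x, D x -> {for x, continuous f}.
Proof.
move=> oD; rewrite continuous_open_subspace//; split=> H x.
  by move=> Dx; apply: H; rewrite inE.
by rewrite inE; exact: H.
Qed.

Lemma chart_map_continuous (X : topologicalType) (c : @chart R X) x :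
  is_chart c -> chart_dom c x -> {for x, continuous (chart_map c)}.
Proof. by case=> oc _ /(within_open_continuousP _ oc) cc _; exact: cc. Qed.

Lemma chart_map_open (X : topologicalType) (c : @chart R X) x A :
  is_chart c -> chart_dom c x -> nbhs x A ->
  nbhs (chart_map c x) (chart_map c @` (A `&` chart_dom c)).
Proof.
move=> [oc _ _ co] cx; rewrite nbhsE => -[B [oB Bx] BA].
have oBc : open (chart_map c @` (B `&` chart_dom c)) by apply: co; [exact: openI|exact: subIsetr].
apply: (@filterS _ _ _ _ _ _ (open_nbhs_nbhs (conj oBc _))).
  by apply: image_subset; exact: setSI.
by exists x.
Qed.

(** Chart maps are open, so agreement over a neighbourhood in the space becomes agreement over a
    neighbourhood in coordinates. Consequently the derivative does not depend on the
    representative. *)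
Lemma rep_at_near (X Y : topologicalType) (c : @chart R X) (c' : @chart R Y) (f : X -> Y) x
    (h k : 'rV[C]_(chart_dim c) -> 'rV[C]_(chart_dim c')) :
  is_chart c -> chart_dom c x -> rep_at f x h -> rep_at f x k ->
  \forall z \near chart_map c x, h z = k z.
Proof.
move=> cc cx [hf _] [kf _].
have hk : \forall y \near x, h (chart_map c y) = k (chart_map c y).
  by apply: filterS2 hf kf => y -> ->.
by apply: filterS (chart_map_open cc cx hk) => _ [y [? _] <-].
Qed.

Lemma rep_at_diff (X Y : topologicalType) (c : @chart R X) (c' : @chart R Y) (f : X -> Y) x
    (h k : 'rV[C]_(chart_dim c) -> 'rV[C]_(chart_dim c')) :
  is_chart c -> chart_dom c x -> rep_at f x h -> rep_at f x k ->
  'd h (chart_map c x) = 'd k (chart_map c x) :> ('rV_ _ -> 'rV_ _).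
Proof.
move=> cc cx hf kf; have hk := rep_at_near cc cx hf kf.
have [_ dh] := hf.
have [_ kh] := near_eq_diff hk dh.
exact: (esym kh).
Qed.

Lemma rep_at_comp (X Y Z : topologicalType) (c : @chart R X) (c' : @chart R Y)
    (c'' : @chart R Z) (f : X -> Y) (g : Y -> Z) x
    (h : 'rV[C]_(chart_dim c) -> 'rV[C]_(chart_dim c'))
    (k : 'rV[C]_(chart_dim c') -> 'rV[C]_(chart_dim c'')) :
  {for x, continuous f} -> rep_at f x h -> rep_at g (f x) k ->
  rep_at (g \o f) x (k \o h).
Proof.
move=> fc [hf dh] [kg dk]; split.
  apply: filterS2 hf (fc _ kg) => y /= -> -> //.
have E : h (chart_map c x) = chart_map c' (f x) := nbhs_singleton hf.
by apply: differentiable_comp; [exact: dh|rewrite E; exact: dk].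
Qed.

Lemma rep_at_comp_diff (X Y Z : topologicalType) (c : @chart R X) (c' : @chart R Y)
    (c'' : @chart R Z) (f : X -> Y) (g : Y -> Z) x
    (h : 'rV[C]_(chart_dim c) -> 'rV[C]_(chart_dim c'))
    (k : 'rV[C]_(chart_dim c') -> 'rV[C]_(chart_dim c'')) :
  rep_at f x h -> rep_at g (f x) k ->
  'd (k \o h) (chart_map c x) =
  'd k (chart_map c' (f x)) \o 'd h (chart_map c x) :> ('rV_ _ -> 'rV_ _).
Proof.
move=> [hf dh] [kg dk].
have E : h (chart_map c x) = chart_map c' (f x) := nbhs_singleton hf.
rewrite -E in dk *; exact: diff_comp.
Qed.

Lemma rep_at_eq (X Y : topologicalType) (c : @chart R X) (c' : @chart R Y) (f g : X -> Y) x
    (h : 'rV[C]_(chart_dim c) -> 'rV[C]_(chart_dim c')) :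
  (\forall y \near x, f y = g y) -> rep_at f x h -> rep_at g x h.
Proof.
by move=> fg [hf dh]; split=> //; apply: filterS2 fg hf => y -> ->.
Qed.

Lemma hol_at_comp (X Y Z : topologicalType) (c : @chart R X) (c' : @chart R Y)
    (c'' : @chart R Z) (f : X -> Y) (g : Y -> Z) x :
  {for x, continuous f} -> hol_at c c' f x -> hol_at c' c'' g (f x) ->
  hol_at c c'' (g \o f) x.
Proof. by move=> fc [h hf] [k kg]; exists (k \o h); exact: rep_at_comp. Qed.

Lemma hol_at_eq (X Y : topologicalType) (c : @chart R X) (c' : @chart R Y) (f g : X -> Y) x :
  (\forall y \near x, f y = g y) -> hol_at c c' f x -> hol_at c c' g x.
Proof. by move=> fg [h hf]; exists h; exact: rep_at_eq fg hf. Qed.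

Lemma sub_at_comp (X Y Z : topologicalType) (c : @chart R X) (c' : @chart R Y)
    (c'' : @chart R Z) (f : X -> Y) (g : Y -> Z) x :
  {for x, continuous f} -> sub_at c c' f x -> sub_at c' c'' g (f x) ->
  sub_at c c'' (g \o f) x.
Proof.
move=> fc [h hf hT] [k kg kT]; exists (k \o h); first exact: rep_at_comp.
rewrite (rep_at_comp_diff hf kg) -subTset => w _.
have [v _ <-] : range ('d k (chart_map c' (f x))) w by rewrite kT.
have [u _ <-] : range ('d h (chart_map c x)) v by rewrite hT.
by exists u.
Qed.

Lemma rep_at_id (X : topologicalType) (c : @chart R X) x : rep_at (c := c) (c' := c) id x id.
Proof. by split=> //; exact: nearW. Qed.

(** If a composite of derivatives is surjective, so is the outer factor. With [f] a local section
    this makes a projection a submersion; with [f] the projection it makes a change of charts a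
    submersion. *)
Lemma sub_at_section (X Y Z : topologicalType) (c : @chart R X) (c' : @chart R Y)
    (c'' : @chart R Z) (f : X -> Y) (g : Y -> Z) x :
  is_chart c -> chart_dom c x -> {for x, continuous f} ->
  hol_at c c' f x -> hol_at c' c'' g (f x) -> sub_at c c'' (g \o f) x ->
  sub_at c' c'' g (f x).
Proof.
move=> cc cx fc [h hf] [k kg] [l lgf lT]; exists k => //.
have kh := rep_at_comp fc hf kg.
move: lT; rewrite -(rep_at_diff cc cx kh lgf) (rep_at_comp_diff hf kg) -!subTset => lT w _.
by have [v _ <-] := lT w I; exists ('d h (chart_map c x) v).
Qed.

Lemma sub_at_id (X : topologicalType) (c : @chart R X) x : sub_at c c id x.
Proof.
exists id; first exact: rep_at_id.
have E : 'd (idfun : 'rV[C]_(chart_dim c) -> _) (chart_map c x) = idfun :> (_ -> _).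
  by apply: diff_lin => ?; exact: cvg_id.
by rewrite E -subTset => w _; exists w.
Qed.

Lemma local_rep_at (X Y : topologicalType) (D : set X) (c : @chart R X) (c' : @chart R Y)
    (f : X -> Y) x h :
  open D -> open (chart_dom c) -> open (chart_dom c') -> {for x, continuous f} ->
  D x -> chart_dom c x -> chart_dom c' (f x) -> local_rep D f c c' h ->
  rep_at f x h.
Proof.
move=> oD oc oc' fc Dx cx cfx hf; split; last by have [] := hf x.
have n1 : nbhs x D by exact: open_nbhs_nbhs.
have n2 : nbhs x (chart_dom c) by exact: open_nbhs_nbhs.
have n3 : nbhs x (f @^-1` chart_dom c') by apply: fc; exact: open_nbhs_nbhs.
by apply: filterS3 n1 n2 n3 => y y1 y2 y3; have [] := hf y.
Qed.

(** Injectivity of the chart map leaves no freedom for the values of [h] on the image of the domain;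
    elsewhere they are 0. Near each image point [h] coincides with the local representative and
    inherits its differentiability. *)
Lemma hol_at_local_rep (X Y : topologicalType) (D : set X) (c : @chart R X)
    (c' : @chart R Y) (f : X -> Y) :
  open D -> is_chart c -> open (chart_dom c') ->
  (forall x, D x -> {for x, continuous f}) ->
  (forall x, D x -> chart_dom c x -> chart_dom c' (f x) -> hol_at c c' f x) ->
  exists h, local_rep D f c c' h.
Proof.
move=> oD cc oc' fc H; have [oc ci _ _] := cc.
pose W := [set x | [/\ D x, chart_dom c x & chart_dom c' (f x)]].
have [h hP] : exists h : 'rV[C]_(chart_dim c) -> 'rV[C]_(chart_dim c'),
    forall x, W x -> h (chart_map c x) = chart_map c' (f x).
  have /choice[h hP] : forall z, exists w, forall x, W x -> chart_map c x = z ->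
      w = chart_map c' (f x).
    move=> z; have [[x Wx xz]|nx] := pselect (exists2 x, W x & chart_map c x = z).
      exists (chart_map c' (f x)) => y Wy; rewrite -xz => /ci -> //.
        by rewrite inE; case: Wy.
      by rewrite inE; case: Wx.
    by exists 0 => x Wx xz; case: nx; exists x.
  by exists h => x Wx; exact: hP.
exists h => x Dx cx cfx; split; first exact: hP.
have [k [kf dk]] := H x Dx cx cfx.
have n1 : nbhs x D by exact: open_nbhs_nbhs.
have n2 : nbhs x (chart_dom c) by exact: open_nbhs_nbhs.
have n3 : nbhs x (f @^-1` chart_dom c') by apply: fc => //; exact: open_nbhs_nbhs.
have nW : nbhs x W by apply: filterS3 n1 n2 n3.
have kh : \forall y \near x, k (chart_map c y) = h (chart_map c y).
  by apply: filterS2 kf nW => y -> Wy; rewrite hP.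
have kh' : \forall z \near chart_map c x, k z = h z.
  by apply: filterS (chart_map_open cc cx kh) => _ [y [? _] <-].
by have [] := near_eq_diff kh' dk.
Qed.

End Charts.

(** * Quotient structures *)

Section QuotientAtlas.
Context {R : realType}.
Local Notation C := (Cx R).

Lemma hol_at_local_repT (X Y : topologicalType) (c : @chart R X) (c' : @chart R Y)
    (f : X -> Y) :
  is_chart c -> is_chart c' -> continuous f ->
  (forall x, chart_dom c x -> chart_dom c' (f x) -> hol_at c c' f x) ->
  exists h, local_rep setT f c c' h.
Proof.
move=> cc [oc' _ _ _] fc H; apply: hol_at_local_rep => //; first exact: openT.
  by move=> x _; exact: fc.
by move=> x _; exact: H.
Qed.

Lemma local_rep_atT (X Y : topologicalType) (c : @chart R X) (c' : @chart R Y)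
    (f : X -> Y) x h :
  is_chart c -> is_chart c' -> {for x, continuous f} ->
  chart_dom c x -> chart_dom c' (f x) -> local_rep setT f c c' h -> rep_at f x h.
Proof.
move=> [oc _ _ _] [oc' _ _ _] fc cx cfx hf.
by apply: (local_rep_at (D := setT)) => //; exact: openT.
Qed.

(** The change of charts is injective, so [submersion_injective_dim] bounds the dimension of [c] by
    that of [c']; surjectivity of the derivative gives the other bound. The derivative is then
    invertible, the inverse change of charts is continuous because both are topological charts, and
    [inverse_differentiable] applies. *)
Lemma sub_at_inverse (Y : topologicalType) (c c' : @chart R Y) :
  is_chart c -> is_chart c' ->
  (forall z, chart_dom c z -> chart_dom c' z -> sub_at c c' id z) ->
  forall z, chart_dom c z -> chart_dom c' z -> sub_at c' c id z.
Proof.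
move=> cc cc' H z cz c'z.
have [oc ci _ _] := cc; have [oc' ci' _ _] := cc'.
have idc y : {for y, continuous (id : Y -> Y)} by exact: cvg_id.
have [h hP] : exists h, local_rep setT id c c' h.
  by apply: (hol_at_local_repT cc cc' idc) => y cy c'y; exact/sub_hol_at/H.
have hrep y : chart_dom c y -> chart_dom c' y -> rep_at (c := c) (c' := c') id y h.
  by move=> cy c'y; exact: local_rep_atT.
have hT y : chart_dom c y -> chart_dom c' y -> range ('d h (chart_map c y)) = setT.
  move=> cy c'y; have [h1 h1r h1T] := H y cy c'y.
  by rewrite (rep_at_diff cc cy (hrep y cy c'y) h1r).
have hE y : chart_dom c y -> chart_dom c' y -> h (chart_map c y) = chart_map c' y.
  by move=> cy c'y; have [] := hP y I cy c'y.
have n1 := chart_dom_nbhs cc' c'z.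
have /nbhs_rnormP[r r0 rP] := chart_map_open cc cz n1.
have dim : (chart_dim c <= chart_dim c')%N.
  apply: (@submersion_injective_dim R _ _ h (chart_map c z) r) => //.
    move=> _ _ /rP[y [c'y cy] <-] /rP[y' [c'y' cy'] <-].
    by rewrite !hE// => /ci' -> //; rewrite inE.
  by move=> _ /rP[y [c'y cy] <-]; have [_ dh] := hrep y cy c'y; split=> //; exact: hT.
have [B BP] := surj_right_inverse (hT z cz c'z).
have [_ dh] := hrep z cz c'z.
have BP' v : 'd h (chart_map c z) v *m B = v.
  (* [B *m D = 1] makes the rank of [D] equal to its number of columns, which is at least its number
     of rows; so [D] has a right inverse as well, and that inverse is [B]. *)
  pose D := lin1_mx ('d h (chart_map c z)).
  have DE u : 'd h (chart_map c z) u = u *m D by rewrite mul_rV_lin1.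
  have BD : B *m D = 1%:M by apply/row_matrixP => i; rewrite row_mul -DE !rowE BP mulmx1.
  have rD : row_free D.
    rewrite -row_leq_rank; apply: leq_trans dim _.
    by rewrite -[leqLHS](mxrank1 C) -BD mxrankS// submxMl.
  have [B' DB] := row_freeP rD.
  have <- : B' = B by rewrite -[RHS]mulmx1 -DB mulmxA BD mul1mx.
  by rewrite DE -mulmxA DB mulmx1.
have [k kP] : exists k : 'rV[C]_(chart_dim c') -> 'rV[C]_(chart_dim c),
    forall y, chart_dom c y -> chart_dom c' y -> k (chart_map c' y) = chart_map c y.
  have /choice[k kP] : forall w, exists v, forall y, chart_dom c y -> chart_dom c' y ->
      chart_map c' y = w -> v = chart_map c y.
    move=> w; have [[y [cy c'y yw]]|ny] :=
      pselect (exists y, [/\ chart_dom c y, chart_dom c' y & chart_map c' y = w]).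
      by exists (chart_map c y) => y' cy' c'y'; rewrite -yw => /ci' -> //; rewrite inE.
    by exists 0 => y cy c'y yw; case: ny; exists y.
  by exists k => y cy c'y; exact: kP.
have n2 := chart_dom_nbhs cc cz.
have n12 : nbhs z (chart_dom c `&` chart_dom c') by exact: filterI.
have hz := hE z cz c'z.
have kc : {for h (chart_map c z), continuous k}.
  rewrite hz => N; rewrite kP// => Nz.
  have n3 : nbhs z (chart_map c @^-1` N) by exact: (chart_map_continuous cc cz).
  apply: filterS (chart_map_open cc' c'z (filterI n3 n2)) => _ [y [[Ny cy] c'y] <-]; by rewrite /= kP.
have hk : \forall w \near h (chart_map c z), h (k w) = w.
  rewrite hz.
  by apply: filterS (chart_map_open cc' c'z n2) => _ [y [cy c'y] <-]; rewrite kP// hE.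
have kz : k (h (chart_map c z)) = chart_map c z by rewrite hz kP.
have [dk dkE] := inverse_differentiable dh BP' BP kz hk kc.
rewrite hz in dk dkE.
exists k.
  split; last exact: dk.
  by apply: filterS n12 => y [cy c'y]; rewrite kP.
rewrite dkE -subTset => v _; by exists ('d h (chart_map c z) v) => //=.
Qed.

Lemma hol_at_id_compatible (X : topologicalType) (c c' : @chart R X) :
  is_chart c -> is_chart c' ->
  (forall z, chart_dom c z -> chart_dom c' z -> hol_at c c' id z) ->
  (forall z, chart_dom c z -> chart_dom c' z -> hol_at c' c id z) -> compatible c c'.
Proof.
move=> cc cc' H H'.
have idc y : {for y, continuous (id : X -> X)} by exact: cvg_id.
by split; [exact: (hol_at_local_repT cc cc' idc H)|exact: (hol_at_local_repT cc' cc idc (fun z c'z cz => H' z cz c'z))].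
Qed.

Lemma compatible_hol_at (X : topologicalType) (c c' : @chart R X) z :
  compatible c c' -> is_chart c -> is_chart c' ->
  chart_dom c z -> chart_dom c' z -> hol_at c c' id z.
Proof.
move=> [[h hP] _] cc cc' cz c'z; exists h.
by apply: local_rep_atT => //; exact: cvg_id.
Qed.

Lemma compatible_sym (X : Type) (c c' : @chart R X) : compatible c c' -> compatible c' c.
Proof. by case. Qed.

Lemma compatible_sub_at (X : topologicalType) (c c' : @chart R X) z :
  compatible c c' -> is_chart c -> is_chart c' ->
  chart_dom c z -> chart_dom c' z -> sub_at c c' id z.
Proof.
move=> comp cc cc' cz c'z.
have idc : {for z, continuous (id : X -> X)} by exact: cvg_id.
have h1 := compatible_hol_at comp cc cc' cz c'z.
have h2 := compatible_hol_at (compatible_sym comp) cc' cc c'z cz.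
exact: (sub_at_section (f := id) (g := id) cc' c'z idc h2 h1 (sub_at_id c' z)).
Qed.

Definition charts_premanifold (X : topologicalType) (A : set (@chart R X)) : Prop :=
  [/\ forall c, A c -> is_chart c,
      forall x, exists2 c, A c & chart_dom c x &
      forall c c', A c -> A c' -> compatible c c'].

Lemma sub_atlas_generated (X : topologicalType) (A : set (@chart R X)) :
  charts_premanifold A -> A `<=` atlas_generated A.
Proof. by move=> [Ac _ Acomp] c cA; split=> [|c' c'A]; [exact: Ac|exact: Acomp]. Qed.

(** Compatibility of charts is not transitive through a single chart, which may miss part of the
    overlap; here each point of the overlap gets its own intermediate chart. *)
Lemma compatible_via (X : topologicalType) (A : set (@chart R X)) c c' :
  charts_premanifold A -> is_chart c -> is_chart c' ->
  (forall c0, A c0 -> compatible c c0) -> (forall c0, A c0 -> compatible c' c0) ->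
  compatible c c'.
Proof.
move=> [Ac Acov _] cc cc' cA c'A.
have idc y : {for y, continuous (id : X -> X)} by exact: cvg_id.
apply: hol_at_id_compatible => // z cz c'z; have [c0 c0A c0z] := Acov z;
  have cc0 := Ac c0 c0A.
  apply: (hol_at_comp (g := id) (f := id) (c' := c0)) => //.
    by apply: compatible_hol_at => //; exact: cA.
  by apply: compatible_hol_at => //; exact/compatible_sym/c'A.
apply: (hol_at_comp (g := id) (f := id) (c' := c0)) => //.
  by apply: compatible_hol_at => //; exact: c'A.
by apply: compatible_hol_at => //; exact/compatible_sym/cA.
Qed.

Lemma atlas_generated_premanifold (X : topologicalType) (A : set (@chart R X)) :
  charts_premanifold A -> premanifold (atlas_generated A).
Proof.
move=> AP; have [Ac Acov _] := AP; split.
- by move=> c [].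
- move=> x; have [c cA cx] := Acov x; exists c => //; exact: sub_atlas_generated.
- by move=> c c' [cc cA] [cc' c'A]; exact: compatible_via AP cc cc' cA c'A.
- move=> c cc cA; split=> // c' /(sub_atlas_generated AP); exact: cA.
Qed.

Lemma compatible_refl (X : topologicalType) (c : @chart R X) : is_chart c -> compatible c c.
Proof. by move=> cc; apply: hol_at_id_compatible => // z _ _; exists id; exact: rep_at_id. Qed.

(* A local section of a submersion through every point is what makes the
   transition maps between charts of the quotient holomorphic. *)
Definition submersion_charts (X Y : topologicalType) (SX : set (@chart R X)) (p : X -> Y)
    (A : set (@chart R Y)) : Prop :=
  [/\ forall c, A c -> is_chart c,
      forall y, exists2 c, A c & chart_dom c y,
      forall c c0 x, A c -> SX c0 -> chart_dom c (p x) -> chart_dom c0 x -> hol_at c0 c p x &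
      forall c x, A c -> chart_dom c (p x) -> exists s : Y -> X,
        [/\ s (p x) = x, {for p x, continuous s}, \forall y \near p x, p (s y) = y &
          forall c0, SX c0 -> chart_dom c0 x -> hol_at c c0 s (p x)]].

Section Quotient.
Variables (X Y : topologicalType) (SX : set (@chart R X)) (p : X -> Y).
Variable A : set (@chart R Y).
Hypothesis SXP : premanifold SX.
Hypothesis pc : continuous p.
Hypothesis psurj : forall y, exists x, p x = y.
Hypothesis AP : submersion_charts SX p A.

Let S := quotient_atlas SX p.

Lemma submersive_in_chartsP (c0 : @chart R X) (c : @chart R Y) : is_chart c0 -> is_chart c ->
  submersive_in_charts p c0 c <->
  forall x, chart_dom c0 x -> chart_dom c (p x) -> sub_at c0 c p x.
Proof.
move=> cc0 cc.
split=> [[h hP hT] x c0x cpx|H].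
  exists h; last exact: hT.
  by apply: local_rep_atT => //; exact: pc.
have [h hP] : exists h, local_rep setT p c0 c h.
  by apply: (hol_at_local_repT cc0 cc pc) => x ? ?; exact/sub_hol_at/H.
exists h => // x c0x cpx; have [h1 h1r h1T] := H x c0x cpx.
rewrite (@rep_at_diff R _ _ c0 c p x h h1)//.
by apply: local_rep_atT => //; exact: pc.
Qed.

(** Near [p x] the composite of [p] with the section is the identity, which is a submersion. *)
Lemma submersion_charts_sub_at c c0 x : A c -> SX c0 -> chart_dom c (p x) ->
  chart_dom c0 x -> sub_at c0 c p x.
Proof.
move=> cA c0S cpx c0x; have [Ac _ Ahol Asec] := AP.
have [s [spx sc ps shol]] := Asec c x cA cpx.
have sh := shol _ c0S c0x.
have ph : hol_at c0 c p (s (p x)) by rewrite spx; exact: Ahol.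
have := sub_at_section (Ac c cA) cpx sc sh ph; rewrite spx; apply.
have [h hr hT] := sub_at_id c (p x); exists h => //.
by apply: rep_at_eq hr; apply: filterS ps => y /= ->.
Qed.

(** Near [p x] the identity equals the section followed by [p], hence is holomorphic from [c] to
    [c']. It is submersive because [p] followed by it is. *)
Lemma quotient_to_special c c' z : A c -> is_chart c' ->
  (forall x, chart_dom c' (p x) -> exists c0, [/\ SX c0, chart_dom c0 x & sub_at c0 c' p x]) ->
  chart_dom c z -> chart_dom c' z -> sub_at c c' id z.
Proof.
move=> cA cc' H; have [x <-] := psurj z => cz c'z; have [Ac _ Ahol Asec] := AP.
have [SXc _ _ _] := SXP.
have [c0 [c0S c0x psub]] := H x c'z.
have [s [spx sc ps shol]] := Asec c x cA cz.
have ph : hol_at c0 c' p (s (p x)) by rewrite spx; exact: sub_hol_at.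
have ih : hol_at c c' id (p x).
  apply: hol_at_eq (hol_at_comp sc (shol _ c0S c0x) ph).
  by apply: filterS ps => y /= ->.
apply: (@sub_at_section R X Y Y c0 c c' p id x) => //; [exact: SXc|exact: pc|].
exact/sub_hol_at/submersion_charts_sub_at.
Qed.

Lemma quotient_atlas_sub_at c' x : S c' -> chart_dom c' (p x) ->
  exists c0, [/\ SX c0, chart_dom c0 x & sub_at c0 c' p x].
Proof.
move=> [cc' H] c'px; have [SXc SXcov _ _] := SXP; have [c0 c0S c0x] := SXcov x.
by exists c0; split=> //; apply: (proj1 (submersive_in_chartsP (SXc c0 c0S) cc') (H c0 c0S)).
Qed.

(** The sections are holomorphic for [c] only, so they give the change of charts from [c] to [c']
    and say nothing on the reverse; [sub_at_inverse] supplies that. *)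
Lemma special_quotient_compatible c c' : A c -> S c' -> compatible c c'.
Proof.
move=> cA c'S; have [Ac _ _ _] := AP; have [cc' _] := c'S.
have H z : chart_dom c z -> chart_dom c' z -> sub_at c c' id z.
  by apply: quotient_to_special => // x; exact: quotient_atlas_sub_at.
apply: hol_at_id_compatible => //; first exact: Ac.
  by move=> z cz c'z; exact/sub_hol_at/H.
by move=> z cz c'z; apply/sub_hol_at/sub_at_inverse => //; exact: Ac.
Qed.

Lemma special_quotient : A `<=` S.
Proof.
have [Ac _ _ _] := AP; have [SXc _ _ _] := SXP.
move=> c cA; split; first exact: Ac.
move=> c0 c0S; apply/submersive_in_chartsP; [exact: SXc|exact: Ac|].
by move=> x c0x cpx; exact: submersion_charts_sub_at.
Qed.

Lemma submersion_charts_premanifold : charts_premanifold A.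
Proof.
have [Ac Acov _ _] := AP; split=> // c c' cA c'A.
exact: special_quotient_compatible cA (special_quotient c'A).
Qed.

Lemma quotient_atlas_premanifold : premanifold S.
Proof.
have [Ac Acov _ _] := AP; have [SXc SXcov _ _] := SXP; split.
- by move=> c [].
- by move=> y; have [c cA cy] := Acov y; exists c => //; exact: special_quotient.
- move=> c c' cS c'S; apply: (compatible_via submersion_charts_premanifold).
  + by case: cS.
  + by case: c'S.
  + by move=> c0 c0A; exact/compatible_sym/special_quotient_compatible.
  + by move=> c0 c0A; exact/compatible_sym/special_quotient_compatible.
- move=> c cc cS; split=> // c0 c0S.
  apply/submersive_in_chartsP => //; first exact: SXc.
  move=> x c0x cpx; have [c1 c1A c1px] := Acov (p x).
  apply: (@sub_at_comp R _ _ _ c0 c1 c p id x); first exact: pc.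
    exact: submersion_charts_sub_at.
  apply: compatible_sub_at => //; last exact: Ac.
  by apply/compatible_sym/cS/special_quotient.
Qed.

Lemma quotient_atlas_submersion : holomorphic_submersion SX S p.
Proof.
split; last by move=> c c' cX [_]; exact.
split; first by apply/within_open_continuousP; [exact: openT|move=> x _; exact: pc].
by move=> c c' cX [_ /(_ c cX)[h]]; exists h.
Qed.

(** [S'] lies in the quotient atlas by the definition of the latter. Since the charts of the
    quotient atlas are mutually compatible, maximality of [S'] gives the converse inclusion. *)
Lemma quotient_atlas_unique S' : premanifold S' -> holomorphic_submersion SX S' p -> S' = S.
Proof.
move=> [S'c S'cov S'comp S'max] [_ S'sub].
have [_ _ Scomp _] := quotient_atlas_premanifold.
have S'S : S' `<=` S by move=> c cS'; split=> [|c0 c0S]; [exact: S'c|exact: S'sub].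
apply/seteqP; split=> // c cS; apply: S'max; first by case: cS.
by move=> c' /S'S; exact: Scomp.
Qed.

End Quotient.
End QuotientAtlas.

(** * Open subsets of a family of vector spaces *)

Section Coordinates.
Context {R : realType}.
Local Notation C := (Cx R).

Section LinearFamily.
Variables (I : finType) (E : I -> vectType C).
Local Notation K := #|{: {i : I & 'I_(\dim {:E i})}}|.

Definition family_inv (z : 'rV[C]_K) : lin_family E :=
  fun i => passmx.vecof (vbasis {:E i})
    (\row_j z 0 (enum_rank (Tagged (fun i => 'I_(\dim {:E i})) j))).

Lemma lin_coordP (V : vectType C) a (x y : V) :
  lin_coord (a *: x + y) = a *: lin_coord x + lin_coord y.
Proof. exact: passmx.rVof_linear. Qed.

Lemma lin_coordK (V : vectType C) : cancel (@lin_coord R V) (passmx.vecof (vbasis {:V})).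
Proof. by apply: passmx.rVofK; exact: vbasisP. Qed.

Lemma family_coordK : cancel (@family_coord R I E) family_inv.
Proof.
move=> x; apply: functional_extensionality_dep => i; rewrite /family_inv -[RHS]lin_coordK.
congr (passmx.vecof _ _); apply/rowP => j; rewrite !mxE.
by rewrite enum_rankK.
Qed.

Lemma family_invK : cancel family_inv (@family_coord R I E).
Proof.
move=> z; apply/rowP => k; rewrite mxE /family_inv /lin_coord passmx.vecofK; last exact: vbasisP.
rewrite mxE; congr (z _ _); rewrite -[RHS]enum_valK; congr enum_rank.
by case: (enum_val k).
Qed.

Lemma family_invP a (y z : 'rV[C]_K) i :
  family_inv (a *: y + z) i = a *: (family_inv y i : E i) + (family_inv z i : E i) :> E i.
Proof.
rewrite /family_inv -passmx.vecof_linear; congr (passmx.vecof _ _).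
by apply/rowP => j; rewrite !mxE.
Qed.

Lemma family_coordP a (x y z : lin_family E) :
  (forall i, z i = a *: (x i : E i) + (y i : E i) :> E i) ->
  family_coord z = a *: family_coord x + family_coord y.
Proof.
by move=> H; apply/rowP => k; rewrite mxE H lin_coordP !mxE.
Qed.

Lemma row_continuous (T : topologicalType) n (f : T -> 'rV[C]_n) :
  (forall j, continuous (fun x => f x 0 j : C)) -> continuous f.
Proof.
move=> H x; apply/rnorm_cvgP => e e0.
have e2 : 0 < e / 2 by rewrite divr_gt0.
have : \forall y \near x, forall j, rnorm (f y 0 j - f x 0 j) < e / 2.
  apply: filter_forall => j; have /rnorm_cvgP := H j x; exact.
apply: filterS => y Hy; apply: (@le_lt_trans _ _ (e / 2)); last by lra.
apply/rnorm_mx_le => [|i j]; first exact: ltW.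
by rewrite !mxE ord1 ltW.
Qed.

Lemma family_coord_continuous : continuous (@family_coord R I E).
Proof.
apply: row_continuous => j.
have -> : (fun x : lin_family E => family_coord x 0 j) = (fun r : 'rV[C]_(\dim {:E (tag (enum_val j))}) =>
    r 0 (tagged (enum_val j)) : C) \o (@lin_coord R (E (tag (enum_val j)))) \o
    (fun x : lin_family E => x (tag (enum_val j))).
  by apply/funext => x; rewrite mxE.
move=> x; apply: continuous_comp; last first.
  apply: continuous_comp; first exact: initial_continuous.
  exact: coord_continuous.
exact: (@proj_continuous I (fun i => lin_topology (E i)) (tag (enum_val j))).
Qed.

Lemma family_inv_continuous : continuous family_inv.
Proof.
move=> z; have FF : Filter (family_inv x @[x --> z]) by exact: (@fmap_filter _ _ family_inv (nbhs z) (nbhs_filter z)).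
apply/(cvg_sup _ _ FF) => i.
apply: (@continuous_comp_initial _ _ (lin_topology (E i)) (fun f : lin_family E => f i) family_inv).
apply: (@continuous_comp_initial _ _ _ (@lin_coord R (E i)) _).
apply: row_continuous => j.
have -> : (fun x : 'rV[C]_K => ((@lin_coord R (E i)) \o ((fun f : lin_family E => f i) \o family_inv)) x 0 j : C) =
    (fun x => x 0 (enum_rank (Tagged (fun i => 'I_(\dim {:E i})) j))).
  by apply/funext => x /=; rewrite /family_inv /lin_coord passmx.vecofK ?vbasisP// mxE.
exact: coord_continuous.
Qed.

Lemma family_open_coord (U : set (lin_family E)) : open U -> open (@family_coord R I E @` U).
Proof.
move=> oU; have -> : @family_coord R I E @` U = family_inv @^-1` U.
  apply/seteqP; split=> [_ [x Ux <-]|z Uz]; first by rewrite /= family_coordK.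
  by exists (family_inv z) => //; rewrite family_invK.
by apply: open_comp => // z _; exact: family_inv_continuous.
Qed.

Section OpenSubset.
Variable U : set (lin_family E).
Hypothesis oU : open U.

Definition sub_coord (x : U) : 'rV[C]_K := family_coord (\val x).

Definition sub_chart : @chart R U := Chart setT sub_coord.

Lemma sub_coord_continuous : continuous sub_coord.
Proof.
move=> x; apply: (@continuous_comp _ _ _ (\val : U -> lin_family E)).
  exact: initial_continuous.
exact: family_coord_continuous.
Qed.

Lemma sub_coord_inj : injective sub_coord.
Proof. by move=> x y /(can_inj family_coordK)/val_inj. Qed.

Lemma sub_coord_nbhs (x : U) (A : set U) :
  nbhs x A <-> exists2 B, nbhs (sub_coord x) B & forall y : U, B (sub_coord y) -> A y.
Proof.
split; last first.
  by move=> [B Bx BA]; apply: filterS BA (sub_coord_continuous Bx).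
move=> [V [[W oW <-] Wx] WA].
have oWc : open (family_inv @^-1` W).
  by apply: open_comp => // z _; exact: family_inv_continuous.
exists (family_inv @^-1` W).
  by apply: open_nbhs_nbhs; split=> //; rewrite /= /sub_coord family_coordK.
by move=> y; rewrite /= /sub_coord family_coordK => Wy; exact: WA.
Qed.

Lemma sub_coord_image (A : set U) : open A -> open (sub_coord @` A).
Proof.
move=> [W oW <-]; have -> : sub_coord @` (set_val @^-1` W) = @family_coord R I E @` (W `&` U).
  apply/seteqP; split=> [_ [x Wx <-]|_ [x [Wx Ux] <-]].
    by exists (\val x) => //; split=> //; exact: set_mem (valP x).
  by exists (exist _ x (mem_set Ux)).
by apply: family_open_coord; exact: openI.
Qed.

Lemma sub_chartP : is_chart sub_chart.
Proof.
split.
- exact: openT.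
- by move=> x y _ _; exact: sub_coord_inj.
- exact/continuous_subspaceT/sub_coord_continuous.
- by move=> V oV _; exact: sub_coord_image.
Qed.

Lemma sub_chart_premanifold : charts_premanifold [set sub_chart].
Proof.
split.
- by move=> c ->; exact: sub_chartP.
- by move=> x; exists sub_chart.
- by move=> c c' -> ->; apply: compatible_refl; exact: sub_chartP.
Qed.

Lemma open_atlas_premanifold : premanifold (open_atlas U).
Proof. exact: atlas_generated_premanifold sub_chart_premanifold. Qed.

Lemma sub_chart_atlas : open_atlas U sub_chart.
Proof. exact: (sub_atlas_generated sub_chart_premanifold). Qed.

End OpenSubset.
End LinearFamily.

(** A representative constrains [f] only through coordinates; as the target chart is injective and
    open on its domain, continuity of the coordinate expression still descends to [f]. Explicit
    formulas thus give continuity together with holomorphy. *)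
Lemma hol_at_continuous (X Y : topologicalType) (c : @chart R X) (c' : @chart R Y)
    (f : X -> Y) x :
  {for x, continuous (chart_map c)} -> is_chart c' -> (\forall y \near x, chart_dom c' (f y)) ->
  hol_at c c' f x -> {for x, continuous f}.
Proof.
move=> cx c'c fdom [h [hf dh]] A nA.
have fx := nbhs_singleton fdom.
have nB := chart_map_open c'c fx nA.
have hol_cont : {for x, continuous (h \o chart_map c)}.
  by apply: continuous_comp => //; exact: differentiable_continuous.
have E : h (chart_map c x) = chart_map c' (f x) := nbhs_singleton hf.
have n1 : nbhs x ((h \o chart_map c) @^-1` (chart_map c' @` (A `&` chart_dom c'))).
  by apply: hol_cont; rewrite /= E.
apply: filterS3 n1 hf fdom => y /= [z [Az c'z] zy] hy c'y.
move: zy; rewrite hy; case: c'c => _ ci _ _ /ci <- //; by rewrite inE.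
Qed.

End Coordinates.

(** * Bilinear maps and quadratic equations *)

Section Bilinear.
Context {R : realType}.
Local Notation C := (Cx R).

Lemma linear_mul_lin1 m n (f : 'rV[C]_m -> 'rV[C]_n) : linear f ->
  forall u, u *m lin1_mx f = f u.
Proof.
move=> fl u; pose fM := GRing.isLinear.Build _ _ _ _ _ fl.
pose fL : {linear _ -> _} := HB.pack f fM.
exact: (mul_rV_lin1 fL u).
Qed.

Lemma linear_sum_delta m n (f : 'rV[C]_m -> 'rV[C]_n) : linear f ->
  forall u, f u = \sum_i u 0 i *: f (delta_mx 0 i).
Proof.
move=> fl u; rewrite -(linear_mul_lin1 fl) mulmx_sum_row; apply: eq_bigr => i _.
by rewrite rowE (linear_mul_lin1 fl).
Qed.

Definition bilin m n p (b : 'rV[C]_m -> 'rV[C]_n -> 'rV[C]_p) : Prop :=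
  (forall w, linear (b^~ w)) /\ (forall u, linear (b u)).

Section BilinearMap.
Variables (m n p : nat) (b : 'rV[C]_m -> 'rV[C]_n -> 'rV[C]_p).
Hypothesis bP : bilin b.

Lemma bilinD u v w : b (u + v) w = b u w + b v w.
Proof. by have := bP.1 w 1 u v; rewrite !scale1r. Qed.
Lemma bilinDr u v w : b u (v + w) = b u v + b u w.
Proof. by have := bP.2 u 1 v w; rewrite !scale1r. Qed.
Lemma bilin0 w : b 0 w = 0.
Proof. by have := bilinD 0 0 w; rewrite addr0 -[X in X = _]addr0 => /addrI. Qed.
Lemma bilin0r u : b u 0 = 0.
Proof. by have := bilinDr u 0 0; rewrite addr0 -[X in X = _]addr0 => /addrI. Qed.
Lemma bilinZ a u w : b (a *: u) w = a *: b u w.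
Proof. by have := bP.1 w a u 0; rewrite !addr0 bilin0 addr0. Qed.
Lemma bilinZr a u w : b u (a *: w) = a *: b u w.
Proof. by have := bP.2 u a w 0; rewrite !addr0 bilin0r addr0. Qed.
Lemma bilinN u w : b (- u) w = - b u w.
Proof. by rewrite -scaleN1r bilinZ scaleN1r. Qed.
Lemma bilinNr u w : b u (- w) = - b u w.
Proof. by rewrite -scaleN1r bilinZr scaleN1r. Qed.
Lemma bilinB u v w : b (u - v) w = b u w - b v w.
Proof. by rewrite bilinD bilinN. Qed.
Lemma bilinBr u v w : b u (v - w) = b u v - b u w.
Proof. by rewrite bilinDr bilinNr. Qed.

Lemma bilin_sum_delta u w : b u w =
  \sum_i \sum_j (u 0 i * w 0 j) *: b (delta_mx 0 i) (delta_mx 0 j).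
Proof.
rewrite (linear_sum_delta (bP.1 w)); apply: eq_bigr => i _.
rewrite (linear_sum_delta (bP.2 _)) scaler_sumr; apply: eq_bigr => j _.
by rewrite scalerA.
Qed.

Lemma bilin_bound : exists2 M : R, 0 < M & forall u w, rnorm (b u w) <= M * rnorm u * rnorm w.
Proof.
exists (1 + \sum_i \sum_j rnorm (b (delta_mx 0 i) (delta_mx 0 j))).
  by rewrite ltr_wpDr// sumr_ge0// => i _; rewrite sumr_ge0// => j _; exact: rnorm_ge0.
move=> u w; rewrite bilin_sum_delta; apply: le_trans (rnorm_sum _ _ _) _.
rewrite -mulrA mulrDl mul1r addrC ler_wpDr ?mulr_ge0 ?rnorm_ge0// mulr_suml ler_sum// => i _.
apply: le_trans (rnorm_sum _ _ _) _; rewrite mulr_suml ler_sum// => j _.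
by rewrite rnormZ rnormM mulrC ler_wpM2l ?rnorm_ge0// ler_pM ?rnorm_ge0// rnorm_coord.
Qed.

Lemma differentiable_bilin2 (V : normedModType C) (f : V -> 'rV[C]_m) (g : V -> 'rV[C]_n) x :
  differentiable f x -> differentiable g x -> differentiable (fun v => b (f v) (g v)) x.
Proof.
move=> df dg.
have -> : (fun v => b (f v) (g v)) = (fun v => \sum_i \sum_j
    (f v 0 i * g v 0 j) *: b (delta_mx 0 i) (delta_mx 0 j)).
  by apply/funext => v; rewrite bilin_sum_delta.
apply: differentiable_sumr => i; apply: differentiable_sumr => j.
apply: differentiableZl.
by apply: differentiable_mul; exact: differentiable_row_coord.
Qed.

End BilinearMap.

Lemma differentiable_linear_comp (V : normedModType C) m n (f : 'rV[C]_m -> 'rV[C]_n)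
    (g : V -> 'rV[C]_m) x : linear f -> differentiable g x ->
  differentiable (fun v => f (g v)) x.
Proof.
move=> fl dg; pose fM := GRing.isLinear.Build _ _ _ _ _ fl.
pose fL : {linear _ -> _} := HB.pack f fM.
apply: (@differentiable_comp _ _ _ _ g fL) => //.
exact/linear_differentiable/linear_row_continuous.
Qed.

(** For small [r] the right-hand side is a contraction in the unknown, and the fixed point satisfies
    [rnorm (Y r) <= 2 * be * rnorm r]. Both quadratic terms are therefore of second order in [r], so
    that the derivative at 0 is [B]. *)
Lemma quadratic_solution n q (b1 : 'rV[C]_n -> 'rV[C]_q -> 'rV[C]_n)
    (b2 : 'rV[C]_q -> 'rV[C]_q -> 'rV[C]_n) (B : 'M[C]_(n, q)) : bilin b1 -> bilin b2 ->
  exists Y : 'rV[C]_n -> 'rV[C]_q, [/\ Y 0 = 0, differentiable Y 0,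
    'd Y 0 = mulmxr B :> ('rV[C]_n -> 'rV[C]_q) &
    \forall r \near (0 : 'rV[C]_n), Y r = (r + b1 r (Y r) - b2 (Y r) (Y r)) *m B].
Proof.
move=> b1P b2P.
have [be be0 BP] := linear_rnorm_bound (mulmxr B : {linear 'rV[C]_n -> 'rV[C]_q}).
have [m1 m10 M1] := bilin_bound b1P.
have [m2 m20 M2] := bilin_bound b2P.
(* On the ball of radius [rad] the two halves of the [b2] difference contribute 1/8 each to the
   Lipschitz constant, and [dl] limits the contribution of [b1] to 1/4. The second bound in [dl]
   makes [T r 0] at most [rad / 2]. *)
pose rad := (8 * be * m2)^-1.
have rad0 : 0 < rad by rewrite invr_gt0 !mulr_gt0.
pose dl := Order.min (4 * be * m1)^-1 (rad / (2 * be)).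
have dl0 : 0 < dl by rewrite lt_min invr_gt0 divr_gt0 ?mulr_gt0.
have dl1 : be * m1 * dl <= 4^-1.
  apply: (@le_trans _ _ (be * m1 * (4 * be * m1)^-1)).
    by rewrite ler_wpM2l ?mulr_ge0 ?(ltW be0) ?(ltW m10)// /dl ge_min lexx.
  by rewrite le_eqVlt; apply/orP; left; apply/eqP; field; rewrite !lt0r_neq0.
have dl2 : be * dl <= rad / 2.
  apply: (@le_trans _ _ (be * (rad / (2 * be)))).
    by rewrite ler_wpM2l ?(ltW be0)// /dl ge_min lexx orbT.
  by rewrite le_eqVlt; apply/orP; left; apply/eqP; field; rewrite !lt0r_neq0.
have rad1 : be * m2 * rad = 8^-1 by rewrite /rad; field; rewrite !lt0r_neq0.
pose T (r : 'rV[C]_n) (z : 'rV[C]_q) := (r + b1 r z - b2 z z) *m B.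
have /choice[Y0 Y0P] : forall r, exists z, rnorm r < dl ->
    rnorm z <= 2 * be * rnorm r /\ T r z = z.
  move=> r; have [rdl|] := pselect (rnorm r < dl); last by exists 0.
  have T0 : T r 0 = r *m B by rewrite /T (bilin0 b2P) (bilin0r b1P) addr0 subr0.
  have [||z [_ z1 z2]] := @contraction_fixpoint R q (T r) rad.
  - move=> u v ur vr.
    have -> : T r u - T r v = (b1 r (u - v) - b2 u (u - v) - b2 (u - v) v) *m B.
      rewrite /T -mulmxBl (bilinBr b1P) (bilinBr b2P) (bilinB b2P).
      by congr (_ *m _); apply/rowP => i; rewrite !mxE; ring.
    apply: le_trans (BP _) _.
    have := rnormD (b1 r (u - v) - b2 u (u - v)) (- b2 (u - v) v).
    have := rnormD (b1 r (u - v)) (- b2 u (u - v)); rewrite !rnormN => h1 h2.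
    have := M1 r (u - v); have := M2 u (u - v); have := M2 (u - v) v.
    have w0 := rnorm_ge0 (u - v); move: (rnorm (u - v)) w0 h1 h2 => w w0 h1 h2 h3 h4 h5.
    have k1 : m1 * rnorm r * w <= m1 * dl * w.
      by rewrite ler_wpM2r// ler_wpM2l// ltW.
    have k2 : m2 * rnorm u * w <= m2 * rad * w.
      by rewrite ler_wpM2r// ler_wpM2l// ltW.
    have k3 : m2 * w * rnorm v <= m2 * rad * w.
      by rewrite mulrAC ler_wpM2r// ler_wpM2l// ltW.
    have k4 : be * (m1 * dl * w + m2 * rad * w + m2 * rad * w) <= w / 2.
      have := ler_wpM2r w0 dl1; have : be * m2 * rad * w = w / 8 by rewrite rad1 mulrC.
      by rewrite !mulrDr !mulrA; lra.
    by apply: le_trans k4; rewrite ler_wpM2l ?(ltW be0)//; lra.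
  - rewrite T0; apply: le_trans (BP _) _; apply: le_trans dl2.
    by rewrite ler_wpM2l// ltW.
  exists z => _; split=> //; rewrite T0 in z1.
  by have := BP r; rewrite /= in z1 *; lra.
pose Y r := if rnorm r < dl then Y0 r else 0.
have YP r : rnorm r < dl -> rnorm (Y r) <= 2 * be * rnorm r /\ T r (Y r) = Y r.
  by move=> rd; rewrite /Y rd; exact: Y0P.
have Y00 : Y 0 = 0.
  apply/eqP; rewrite -rnorm_eq0 eq_le rnorm_ge0 andbT.
  by have [] := YP 0; rewrite rnorm0// mulr0.
have dY : differentiable Y 0 /\ 'd Y 0 = mulmxr B :> ('rV[C]_n -> 'rV[C]_q).
  apply: rnorm_diff => [|e e0]; first exact: linear_row_continuous.
  pose Kc := be * (m1 * (2 * be) + m2 * (2 * be) * (2 * be)).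
  have K0 : 0 < Kc by rewrite mulr_gt0// addr_gt0// !mulr_gt0.
  exists (Order.min dl (e / Kc)); first by rewrite lt_min dl0 divr_gt0.
  move=> v; rewrite lt_min => /andP[vdl ve]; rewrite add0r Y00 subr0.
  have [y1 y2] := YP v vdl.
  have -> : Y v - mulmxr B v = (b1 v (Y v) - b2 (Y v) (Y v)) *m B.
    rewrite -{1}y2 /T /= -mulmxBl; congr (_ *m _).
    by apply/rowP => i; rewrite !mxE; ring.
  apply: le_trans (BP _) _.
  have := rnormD (b1 v (Y v)) (- b2 (Y v) (Y v)); rewrite rnormN.
  have := M1 v (Y v); have := M2 (Y v) (Y v) => h1 h2 h3.
  have v0 := rnorm_ge0 v; have Yv0 := rnorm_ge0 (Y v).
  have k1 : m1 * rnorm v * rnorm (Y v) <= m1 * rnorm v * (2 * be * rnorm v).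
    by rewrite ler_wpM2l// mulr_ge0// ltW.
  have k2 : m2 * rnorm (Y v) * rnorm (Y v) <= m2 * (2 * be * rnorm v) * (2 * be * rnorm v).
    by apply: ler_pM => //; [rewrite mulr_ge0// ltW|rewrite ler_wpM2l// ltW].
  apply: (@le_trans _ _ (Kc * rnorm v * rnorm v)).
    rewrite /Kc -!mulrA ler_wpM2l ?(ltW be0)//; apply: le_trans h3 _.
    apply: (le_trans (lerD h2 h1)); apply: (le_trans (lerD k1 k2)).
    by rewrite le_eqVlt; apply/orP; left; apply/eqP; ring.
  by rewrite ler_wpM2r// mulrC -ler_pdivlMr// ltW.
exists Y; case: dY => dY dYE; split=> //.
apply/rnorm_nearP; exists dl => // v vdl; rewrite add0r.
by have [_ {1}<-] := YP v vdl.
Qed.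

End Bilinear.

(** * Slices for the conjugation action of an algebra on a bimodule *)

Section Bimodule.
Context {R : realType}.
Local Notation C := (Cx R).

Lemma linear_row0 p q (f : 'rV[C]_p -> 'rV[C]_q) : linear f -> f 0 = 0.
Proof. by move=> fl; have := fl (-1) 0 0; rewrite scaler0 addr0 scaleN1r addNr. Qed.

(* A finite-dimensional algebra and a bimodule over it, in coordinates: [bra r x]
   is r x and [bla x r] is x r. *)
Record bimodule (k n : nat) := Bimodule {
  bmul : 'rV[C]_k -> 'rV[C]_k -> 'rV[C]_k;
  bone : 'rV[C]_k;
  bra : 'rV[C]_n -> 'rV[C]_k -> 'rV[C]_n;
  bla : 'rV[C]_k -> 'rV[C]_n -> 'rV[C]_n;
  bmulP : bilin bmul;
  braP : bilin bra;
  blaP : bilin bla;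
  bmulA : associative bmul;
  bmul1 : left_id bone bmul;
  bmulr1 : right_id bone bmul;
  braA : forall r x y, bra r (bmul x y) = bra (bra r x) y;
  bra1 : forall r, bra r bone = r;
  blaA : forall x y r, bla (bmul x y) r = bla x (bla y r);
  bla1 : forall r, bla bone r = r;
  blaraA : forall x r y, bla x (bra r y) = bra (bla x r) y }.

Variables (k n : nat) (M : bimodule k n).
Local Notation "x ** y" := (bmul M x y) (at level 40).
Local Notation one := (bone M).
Local Notation "r <* x" := (bra M r x) (at level 40).
Local Notation "x *> r" := (bla M x r) (at level 40).

Definition rmul_mx (g : 'rV[C]_k) : 'M[C]_k := lin1_mx (fun h => h ** g).

Lemma rmul_mxE g h : h *m rmul_mx g = h ** g.
Proof. exact: (linear_mul_lin1 ((bmulP M).1 g)). Qed.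

(** Read on the matrix of right multiplication, invertibility becomes an open determinant condition,
    and Cramer's rule makes inversion differentiable. *)
Definition bunit g := rmul_mx g \in unitmx.
Definition binv g := one *m invmx (rmul_mx g).

Lemma bmulVx g : bunit g -> binv g ** g = one.
Proof. by move=> gu; rewrite -rmul_mxE /binv mulmxKV. Qed.

Lemma bmulxV g : bunit g -> g ** binv g = one.
Proof.
move=> gu; apply: (can_inj (mulmxK gu)).
by rewrite !rmul_mxE -(bmulA M) bmulVx// (bmul1 M) (bmulr1 M).
Qed.

Lemma bunitP g h : g ** h = one -> h ** g = one -> bunit g /\ binv g = h.
Proof.
move=> gh hg; have gu : bunit g.
  apply: (proj1 (@mulmx1_unit _ _ (rmul_mx g) (rmul_mx h) _)); apply/row_matrixP => i.
  rewrite row_mul rowE; rewrite !rmul_mxE -(bmulA M) gh (bmulr1 M).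
  by rewrite rowE mulmx1.
by split=> //; rewrite -[LHS](bmulr1 M) -gh (bmulA M) bmulVx// (bmul1 M).
Qed.

Lemma bunit1 : bunit one.
Proof. by have [] := @bunitP one one (bmul1 M one) (bmul1 M one). Qed.

Lemma bunit_neq0 g : one != 0 -> bunit g -> g != 0.
Proof.
move=> o0 gu; apply: contraNneq o0 => g0.
by rewrite -(bmulxV gu) g0 (bilin0 (bmulP M)).
Qed.

Section UnitDiff.
Variables (V : normedModType C) (f : V -> 'rV[C]_k) (x : V).
Hypothesis df : differentiable f x.

Lemma differentiable_rmul_mx i j : differentiable (fun v => rmul_mx (f v) i j : C) x.
Proof.
have -> : (fun v => rmul_mx (f v) i j) = (fun v => (delta_mx 0 i ** f v) 0 j).
  by apply/funext => v; rewrite -rmul_mxE -rowE [RHS]mxE.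
by apply: differentiable_row_coord; apply: (differentiable_bilin2 (bmulP M)).
Qed.

Lemma bunit_near : bunit (f x) -> \forall y \near x, bunit (f y).
Proof. exact: (unitmx_near (A := fun v => rmul_mx (f v)) differentiable_rmul_mx). Qed.

Lemma differentiable_binv : bunit (f x) -> differentiable (fun v => binv (f v)) x.
Proof.
move=> fu; apply: differentiable_row => j; apply: differentiable_mulmx => a b.
  exact: differentiable_cst.
by apply: differentiable_invmx => // i' j'; exact: differentiable_rmul_mx.
Qed.

End UnitDiff.

Definition bact r g := binv g *> (r <* g).

Lemma differentiable_bact (V : normedModType C) (f : V -> 'rV[C]_n) (g : V -> 'rV[C]_k) (x : V) :
  differentiable f x -> differentiable g x -> bunit (g x) ->
  differentiable (fun v => bact (f v) (g v)) x.
Proof.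
move=> df dg gu; apply: (differentiable_bilin2 (blaP M)); first exact: differentiable_binv.
exact: (differentiable_bilin2 (braP M)).
Qed.

Lemma bactE r s g : bunit g -> r <* g = g *> s <-> bact r g = s.
Proof.
move=> gu; rewrite /bact; split=> [->|<-].
  by rewrite -(blaA M) bmulVx// (bla1 M).
by rewrite -(blaA M) bmulxV// (bla1 M).
Qed.

Lemma bactK r g : bunit g -> bact (bact r g) (binv g) = r.
Proof.
move=> gu; have [gi _] : bunit (binv g) /\ binv (binv g) = g.
  by apply: bunitP; [exact: bmulVx|exact: bmulxV].
apply/(bactE _ _ gi).
by rewrite /bact -(blaraA M) -(braA M) bmulxV// (bra1 M).
Qed.

(** The form of the Schur condition accessible to linear algebra: the centraliser is reduced to the
    scalars. [schur_bschur] and [bschur_schur] give the equivalence for a non-zero family. *)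
Definition bschur r := forall x, r <* x = x *> r -> exists l, x = l *: one.

Lemma ext_exists (i0 : 'I_k) : exists ext : 'rV[C]_(k.-1) -> 'rV[C]_k,
  [/\ linear ext, forall y, ext y 0 i0 = 0, forall x : 'rV[C]_k, x 0 i0 = 0 -> exists y, x = ext y &
    forall y, ext y = 0 -> y = 0].
Proof.
exists (fun y => \row_l (if unlift i0 l is Some j then y 0 j else 0)); split.
- by move=> a u v; apply/rowP => l; rewrite !mxE; case: unliftP => [j _|_]; rewrite ?mxE ?mulr0 ?addr0.
- by move=> y; rewrite mxE unlift_none.
- move=> x xi0; exists (col' i0 x); apply/rowP => l; rewrite mxE.
  by case: unliftP => [j ->|->//]; rewrite mxE.
- move=> y /rowP y0; apply/rowP => j; have := y0 (lift i0 j).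
  by rewrite !mxE liftK.
Qed.

Section Slice.
(* [ext] parametrises the complement {x | x 0 i0 = 0} of C.1 in the algebra. *)
Variables (rho0 : 'rV[C]_n) (i0 : 'I_k) (ext : 'rV[C]_(k.-1) -> 'rV[C]_k).
Hypothesis one0 : one 0 i0 != 0.
Hypothesis extl : linear ext.
Hypothesis ext0 : forall y, ext y 0 i0 = 0.
Hypothesis ext_surj : forall x : 'rV[C]_k, x 0 i0 = 0 -> exists y, x = ext y.
Hypothesis ext_inj : forall y, ext y = 0 -> y = 0.
Hypothesis schur0 : bschur rho0.

(** The commutator map restricted to the complement of the scalars; for [r = s] it is the derivative
    at the unit of the orbit map of [r]. *)
Definition bad r s (y : 'rV[C]_(k.-1)) := r <* ext y - ext y *> s.

Lemma bad_linear r s : linear (bad r s).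
Proof.
move=> a u v; rewrite /bad extl (bilinDr (braP M)) (bilinD (blaP M)).
rewrite (bilinZr (braP M)) (bilinZ (blaP M)).
by apply/rowP => i; rewrite !mxE; ring.
Qed.

Definition bad_mx r s := lin1_mx (bad r s).

Lemma bad_mxE r s y : y *m bad_mx r s = bad r s y.
Proof. exact: (linear_mul_lin1 (bad_linear r s)). Qed.

Lemma ext_decomp g : exists l y, g = l *: one + ext y.
Proof.
pose l := g 0 i0 / one 0 i0.
have [|y yE] := @ext_surj (g - l *: one).
  by rewrite !mxE /l divfK// subrr.
by exists l, y; rewrite -yE addrC subrK.
Qed.

Lemma row_free_kernel p q (A : 'M[C]_(p, q)) :
  (forall u : 'rV_p, u *m A = 0 -> u = 0) -> row_free A.
Proof.
move=> H; rewrite -kermx_eq0; apply/eqP/row_matrixP => i; rewrite row0.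
by apply: H; rewrite -row_mul mulmx_ker row0.
Qed.

Lemma bad_free : row_free (bad_mx rho0 rho0).
Proof.
apply: row_free_kernel => y; rewrite bad_mxE => /eqP; rewrite subr_eq0 => /eqP /schur0[l yl].
apply: ext_inj; have := ext0 y; rewrite yl mxE => /eqP; rewrite mulf_eq0 (negPf one0) orbF.
by move=> /eqP ->; rewrite scale0r.
Qed.

Variable P : 'M[C]_(n, k.-1).
Hypothesis PE : bad_mx rho0 rho0 *m P = 1%:M.

(** The map [x |-> pi(r x - x s)] of the overview, with [pi] given by [P]. It measures
    transversality of the slice to the orbits; being invertible is an open condition on the pair. *)
Definition trans_mx r s : 'M[C]_(k.-1) := bad_mx r s *m P.

(* Write g = l + ext y; applying P to r g - g s = 0 kills l (r - s) and leaves
   y *m trans_mx r s = 0. *)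
Lemma intertwiner_scalar r s g : trans_mx r s \in unitmx -> (r - s) *m P = 0 ->
  r <* g = g *> s -> exists l, g = l *: one.
Proof.
move=> mu rsP; have [l [y ->]] := ext_decomp g => /eqP; rewrite -subr_eq0 => /eqP H.
exists l; suff -> : y = 0.
  by rewrite (linear_row0 extl) addr0.
have : (l *: (r - s) + bad r s y) *m P = 0.
  rewrite -[RHS](mul0mx _ P) -H; congr (_ *m _).
  rewrite (bilinDr (braP M)) (bilinD (blaP M)) (bilinZr (braP M)) (bilinZ (blaP M)).
  by rewrite (bra1 M) (bla1 M) /bad; apply/rowP => i; rewrite !mxE; ring.
rewrite mulmxDl -scalemxAl rsP scaler0 add0r -bad_mxE -mulmxA -/(trans_mx r s) => yM.
by rewrite -[y](mulmxK mu) yM mul0mx.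
Qed.

Lemma trans_schur r : trans_mx r r \in unitmx -> bschur r.
Proof.
by move=> mu x; apply: intertwiner_scalar => //; rewrite subrr mul0mx.
Qed.

Lemma differentiable_trans_mx (V : normedModType C) (f g : V -> 'rV[C]_n) (x : V) :
  differentiable f x -> differentiable g x ->
  forall i j, differentiable (fun v => trans_mx (f v) (g v) i j : C) x.
Proof.
move=> df dg; apply: differentiable_mulmx => [i j|i j]; last exact: differentiable_cst.
have -> : (fun v => bad_mx (f v) (g v) i j) = (fun v =>
    (f v <* ext (delta_mx 0 i)) 0 j - (ext (delta_mx 0 i) *> g v) 0 j).
  apply/funext => v; have -> : bad_mx (f v) (g v) i j = bad (f v) (g v) (delta_mx 0 i) 0 j.
    by rewrite -bad_mxE -rowE [RHS]mxE.
  by rewrite /bad !mxE.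
apply: differentiableB; apply: differentiable_row_coord.
  exact: (differentiable_bilin2 (braP M)).
exact: (differentiable_bilin2 (blaP M)).
Qed.

Lemma trans_mx0 : trans_mx rho0 rho0 \in unitmx.
Proof. by rewrite /trans_mx PE unitmx1. Qed.

Lemma bschur_near : \forall r \near rho0, bschur r.
Proof.
have : \forall r \near rho0, trans_mx r r \in unitmx.
  apply: unitmx_near; last exact: trans_mx0.
  by apply: differentiable_trans_mx; exact: ex_diff.
by apply: filterS => r; exact: trans_schur.
Qed.

Local Notation rr := (\rank (kermx P)).
Definition slice_mx : 'M[C]_(rr, n) := row_base (kermx P).
Definition slice (t : 'rV[C]_rr) := rho0 + t *m slice_mx.

Lemma slice_mx_P : slice_mx *m P = 0.
Proof. by apply/sub_kermxP; rewrite eq_row_base. Qed.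

Lemma slice_mx_inj (t : 'rV[C]_rr) : t *m slice_mx = 0 -> t = 0.
Proof.
move=> t0; have /row_freeP[B BE] := row_base_free (kermx P).
by rewrite -[t]mulmx1 -BE mulmxA -/slice_mx t0 mul0mx.
Qed.

Lemma slice_diff t t' : (slice t - slice t') *m P = 0.
Proof. by rewrite /slice opprD addrACA subrr add0r -mulmxBl -mulmxA slice_mx_P mulmx0. Qed.

Lemma differentiable_slice (V : normedModType C) (f : V -> 'rV[C]_rr) (x : V) :
  differentiable f x -> differentiable (fun v => slice (f v)) x.
Proof.
move=> df; apply: (differentiableD (f := cst rho0) (g := fun v => f v *m slice_mx)).
  exact: differentiable_cst.
apply: (@differentiable_linear_comp R V rr n (fun u => u *m slice_mx)) => // a u v.
by rewrite mulmxDl scalemxAl.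
Qed.

(** The two parameters are packed into one row, so that invertibility near 0 yields one radius valid
    for all pairs. *)
Lemma slice_radius : exists2 d : R, 0 < d & forall t t', rnorm t < d -> rnorm t' < d ->
  trans_mx (slice t) (slice t') \in unitmx.
Proof.
have : \forall z \near (0 : 'rV[C]_(rr + rr)),
    trans_mx (slice (lsubmx z)) (slice (rsubmx z)) \in unitmx.
  apply: unitmx_near.
    by apply: differentiable_trans_mx; apply: differentiable_slice;
      [exact: differentiable_lsubmx|exact: differentiable_rsubmx].
  by rewrite !linear0 /slice mul0mx addr0 trans_mx0.
move=> /rnorm_nearP[d d0 H]; exists d => // t t' td t'd.
have := H (row_mx t t'); rewrite add0r row_mxKl row_mxKr; apply.
apply: (@le_lt_trans _ _ (Order.max (rnorm t) (rnorm t'))); last by rewrite gt_max td.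
apply/rnorm_mx_le => [|i j]; first by rewrite le_max rnorm_ge0.
by rewrite mxE ord1; case: splitP => j' _; rewrite le_max rnorm_coord ?orbT.
Qed.

Lemma slice_intertwiner t t' g : one != 0 -> trans_mx (slice t) (slice t') \in unitmx ->
  slice t <* g = g *> slice t' -> bunit g -> t = t' /\ exists2 l, l != 0 & g = l *: one.
Proof.
move=> o0 mu gE gu.
have [l gl] := intertwiner_scalar mu (slice_diff t t') gE.
have l0 : l != 0.
  by apply: contraNneq (bunit_neq0 o0 gu) => l0; rewrite gl l0 scale0r.
split; last by exists l.
apply/eqP; rewrite -subr_eq0; apply/eqP/slice_mx_inj.
move: gE; rewrite gl (bilinZr (braP M)) (bilinZ (blaP M)) (bra1 M) (bla1 M).
by move=> /(scalerI l0)/addrI; rewrite mulmxBl => ->; rewrite subrr.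
Qed.

(** The linearised problem: the slice directions and the orbit directions at [slice t] together span
    everything. They are independent because [P] kills the former and is injective on the latter,
    and their numbers add up to [n] since [P] has rank [k.-1]. *)
Lemma slice_square t : trans_mx (slice t) (slice t) \in unitmx ->
  exists B : 'M[C]_(n, rr + k.-1),
    B *m col_mx slice_mx (- bad_mx (slice t) (slice t)) = 1%:M.
Proof.
move=> mu; set D := col_mx _ _.
have Df : row_free D.
  apply: row_free_kernel => u; rewrite -[u]hsubmxK mul_row_col mulmxN => /eqP.
  rewrite subr_eq0 => /eqP H.
  have y0 : rsubmx u = 0.
    have H2 : rsubmx u *m trans_mx (slice t) (slice t) = 0.
      by rewrite /trans_mx mulmxA -H -mulmxA slice_mx_P mulmx0.
    by rewrite -[LHS](mulmxK mu) H2 mul0mx.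
  rewrite y0 mul0mx in H; rewrite (slice_mx_inj H) y0.
  by rewrite row_mx0.
have rP : \rank P = k.-1.
  apply/eqP; rewrite eqn_leq rank_leq_col /=.
  by rewrite -[leqLHS](mxrank1 C) -PE mxrankS// submxMl.
apply/row_fullP; rewrite /row_full; move: Df; rewrite /row_free => /eqP ->.
by rewrite mxrank_ker rP subnK// -rP rank_leq_row.
Qed.

(* With r = s + r', s = slice t, g = 1 + x and z = (t', x), the equation
   r g = g (s + t' *m slice_mx) reads z *m D = r' + r' x - x (t' *m slice_mx) for the
   invertible matrix D of slice_square. *)
Lemma slice_local t : trans_mx (slice t) (slice t) \in unitmx ->
  exists (tau : 'rV[C]_n -> 'rV[C]_rr) (g : 'rV[C]_n -> 'rV[C]_k),
  [/\ differentiable tau (slice t), differentiable g (slice t),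
      tau (slice t) = t, g (slice t) = one &
      \forall r \near slice t, r <* g r = g r *> slice (tau r)].
Proof.
move=> mu; have [B BD] := slice_square mu; set s := slice t.
pose b1 (r : 'rV[C]_n) (z : 'rV[C]_(rr + k.-1)) := r <* ext (rsubmx z).
pose b2 (z z' : 'rV[C]_(rr + k.-1)) := ext (rsubmx z) *> (lsubmx z' *m slice_mx).
have b1P : bilin b1.
  split=> [w|u] a x y; rewrite /b1.
    by rewrite (bilinD (braP M)) (bilinZ (braP M)).
  by rewrite linearP extl (bilinDr (braP M)) (bilinZr (braP M)).
have b2P : bilin b2.
  split=> [w|u] a x y; rewrite /b2.
    by rewrite linearP extl (bilinD (blaP M)) (bilinZ (blaP M)).
  by rewrite linearP mulmxDl -scalemxAl (bilinDr (blaP M)) (bilinZr (blaP M)).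
have [Y [Y0 dY _ YE]] := quadratic_solution B b1P b2P.
have dYs : differentiable (fun r => Y (r - s)) s.
  apply: (@differentiable_comp _ _ _ _ (fun r => r - s) Y).
    apply: (differentiableB (f := id) (g := cst s)); first exact: ex_diff.
    exact: differentiable_cst.
  by rewrite subrr; exact: dY.
exists (fun r => t + lsubmx (Y (r - s))), (fun r => one + ext (rsubmx (Y (r - s)))); split.
- apply: (differentiableD (f := cst t) (g := fun r => lsubmx (Y (r - s)))).
    exact: differentiable_cst.
  apply: (@differentiable_comp _ _ _ _ (fun r => Y (r - s)) lsubmx); first exact: dYs.
  exact: differentiable_lsubmx.
- apply: (differentiableD (f := cst one) (g := fun r => ext (rsubmx (Y (r - s))))).
    exact: differentiable_cst.
  apply: (differentiable_linear_comp extl).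
  apply: (@differentiable_comp _ _ _ _ (fun r => Y (r - s)) rsubmx); first exact: dYs.
  exact: differentiable_rsubmx.
- by rewrite subrr Y0 linear0 addr0.
- by rewrite subrr Y0 linear0 (linear_row0 extl) addr0.
- have /rnorm_nearP[d d0 H] := YE; apply/rnorm_nearP; exists d => // v vd.
  have := H v vd; rewrite add0r [s + v]addrC addrK; set z := Y v => zE.
  have : z *m col_mx slice_mx (- bad_mx s s) = v + b1 v z - b2 z z.
    by rewrite {1}zE -mulmxA BD mulmx1.
  rewrite -{1}[z]hsubmxK mul_row_col mulmxN bad_mxE /bad /b1 /b2 => E.
  rewrite (bilinDr (braP M)) (bra1 M) (bilinD (blaP M)) (bla1 M) (bilinD (braP M)).
  have -> : slice (t + lsubmx z) = s + lsubmx z *m slice_mx.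
    by rewrite /s /slice mulmxDl addrA.
  rewrite (bilinDr (blaP M)).
  move: (lsubmx z *m slice_mx) E => w E.
  have wE : w = v + v <* ext (rsubmx z) - ext (rsubmx z) *> w
      + (s <* ext (rsubmx z) - ext (rsubmx z) *> s) by rewrite -E subrK.
  by rewrite {1}wE; apply/rowP => i; rewrite !mxE; ring.
Qed.

End Slice.
End Bimodule.

(** * Continuous holomorphic maps, charts of products and of quotients *)

Section HolContinuous.
Context {R : realType}.
Local Notation C := (Cx R).

(** Composing germs requires continuity of the inner map, which [hol_at] does not contain; the pair
    is closed under composition. *)
Definition hol_cont (X Y : topologicalType) (c : @chart R X) (c' : @chart R Y) (f : X -> Y)
    (x : X) : Prop := {for x, continuous f} /\ hol_at c c' f x.

Lemma hol_cont_comp (X Y Z : topologicalType) (c : @chart R X) (c' : @chart R Y)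
    (c'' : @chart R Z) (f : X -> Y) (g : Y -> Z) x :
  hol_cont c c' f x -> hol_cont c' c'' g (f x) -> hol_cont c c'' (g \o f) x.
Proof.
by move=> [fc hf] [gc hg]; split; [exact: continuous_comp|exact: hol_at_comp hg].
Qed.

Lemma near_eq_continuous (X Y : topologicalType) (f g : X -> Y) x :
  (\forall y \near x, f y = g y) -> {for x, continuous f} -> {for x, continuous g}.
Proof.
move=> fg fc A; rewrite -(nbhs_singleton fg) => /fc fA.
by apply: filterS2 fg fA => y /= ->.
Qed.

Lemma hol_cont_eq (X Y : topologicalType) (c : @chart R X) (c' : @chart R Y) (f g : X -> Y) x :
  (\forall y \near x, f y = g y) -> hol_cont c c' f x -> hol_cont c c' g x.
Proof.
by move=> fg [fc hf]; split; [exact: near_eq_continuous fc|exact: hol_at_eq hf].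
Qed.

Lemma differentiable_row_mx (V : normedModType C) m n (f : V -> 'rV[C]_m)
    (g : V -> 'rV[C]_n) x : differentiable f x -> differentiable g x ->
  differentiable (fun v => row_mx (f v) (g v)) x.
Proof.
move=> df dg; apply: differentiable_row => j.
case: (splitP j) => [j' jj'|j' jj'].
  have -> : (fun v => row_mx (f v) (g v) 0 j) = (fun v => f v 0 j').
    by apply/funext => v; rewrite -(row_mxEl (f v) (g v)); congr (row_mx _ _ _ _); exact: val_inj.
  exact: differentiable_row_coord.
have -> : (fun v => row_mx (f v) (g v) 0 j) = (fun v => g v 0 j').
  by apply/funext => v; rewrite -(row_mxEr (f v) (g v)); congr (row_mx _ _ _ _); exact: val_inj.
exact: differentiable_row_coord.
Qed.

Lemma hol_cont_pair (X Y Z : topologicalType) (c : @chart R X) (c' : @chart R Y)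
    (c'' : @chart R Z) (f : X -> Y) (g : X -> Z) x :
  hol_cont c c' f x -> hol_cont c c'' g x -> hol_cont c (prod_chart c' c'') (fun y => (f y, g y)) x.
Proof.
move=> [fc [h [hf dh]]] [gc [k [kg dk]]]; split; first exact: cvg_pair.
exists (fun v => row_mx (h v) (k v)); split; last exact: differentiable_row_mx.
by apply: filterS2 hf kg => y /= -> ->.
Qed.

Lemma hol_cont_fst (X Y : topologicalType) (c : @chart R X) (c' : @chart R Y) z :
  hol_cont (prod_chart c c') c fst z.
Proof.
split.
  by move=> A nA; exists (A, setT) => [|y []//]; split=> //; exact: filterT.
exists lsubmx; split; last exact: differentiable_lsubmx.
by apply: (@filterE _ _ (nbhs_filter z)) => y; rewrite row_mxKl.
Qed.

Lemma hol_cont_snd (X Y : topologicalType) (c : @chart R X) (c' : @chart R Y) z :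
  hol_cont (prod_chart c c') c' snd z.
Proof.
split.
  by move=> A nA; exists (setT, A) => [|y []//]; split=> //; exact: filterT.
exists rsubmx; split; last exact: differentiable_rsubmx.
by apply: (@filterE _ _ (nbhs_filter z)) => y; rewrite row_mxKr.
Qed.

Lemma hol_cont_id (X : topologicalType) (c : @chart R X) x : hol_cont c c id x.
Proof. by split; [exact: cvg_id|exists id; exact: rep_at_id]. Qed.

Lemma hol_cont_cst (X Y : topologicalType) (c : @chart R X) (c' : @chart R Y) (y : Y) x :
  hol_cont c c' (fun=> y) x.
Proof.
split; first exact: cvg_cst.
exists (fun=> chart_map c' y); split; first exact: nearW.
exact: differentiable_cst.
Qed.

Lemma hol_cont_source (X Y : topologicalType) (c c1 : @chart R X) (c' : @chart R Y) f x :
  compatible c c1 -> is_chart c -> is_chart c1 -> chart_dom c x -> chart_dom c1 x ->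
  hol_cont c1 c' f x -> hol_cont c c' f x.
Proof.
move=> comp cc cc1 cx c1x [fc hf]; split=> //.
apply: (@hol_at_comp R _ _ _ c c1 c' id f x); [exact: cvg_id| |exact: hf].
exact: compatible_hol_at.
Qed.

Lemma hol_cont_target (X Y : topologicalType) (c : @chart R X) (c' c1 : @chart R Y) f x :
  compatible c1 c' -> is_chart c' -> is_chart c1 -> chart_dom c' (f x) ->
  chart_dom c1 (f x) -> hol_cont c c1 f x -> hol_cont c c' f x.
Proof.
move=> comp cc cc1 cx c1x [fc hf]; split=> //.
apply: (@hol_at_comp R _ _ _ c c1 c' f id x); [exact: fc|exact: hf|].
exact: compatible_hol_at.
Qed.

(** [A] is the small family of charts in which computations are made, [S] the full atlas for which
    holomorphy is claimed. *)
Definition compatible_atlas (X : topologicalType) (A S : set (@chart R X)) : Prop :=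
  (forall c, A c -> is_chart c) /\
  (forall c, S c -> is_chart c /\ forall c0, A c0 -> compatible c c0).

Lemma premanifold_compatible (X : topologicalType) (S : set (@chart R X)) :
  premanifold S -> compatible_atlas S S.
Proof.
by move=> [Sc _ Scomp _]; split=> // c cS; split=> [|c0 c0S]; [exact: Sc|exact: Scomp].
Qed.

Lemma generated_compatible (X : topologicalType) (A : set (@chart R X)) :
  (forall c, A c -> is_chart c) -> compatible_atlas A (atlas_generated A).
Proof. by move=> Ac; split. Qed.

(** Around each point one pair of convenient charts is enough, since all other charts are compatible
    with these. *)
Lemma holomorphic_on_hol_cont (X Y : topologicalType) (AX SX : set (@chart R X))
    (AY SY : set (@chart R Y)) (D : set X) (f : X -> Y) :
  compatible_atlas AX SX -> compatible_atlas AY SY -> open D ->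
  (forall x, D x -> exists c c', [/\ AX c, AY c', chart_dom c x, chart_dom c' (f x) &
    hol_cont c c' f x]) ->
  holomorphic_on SX SY D f.
Proof.
move=> [AXc SXP] [AYc SYP] oD H.
have fc x : D x -> {for x, continuous f} by move=> /H[c [c' [_ _ _ _ []]]].
split; first exact/within_open_continuousP.
move=> c c' /SXP[cc cA] /SYP[cc' c'A]; have [oc' _ _ _] := cc'.
apply: hol_at_local_rep => // x Dx cx c'fx.
have [c1 [c1' [A1 A1' c1x c1'fx h]]] := H x Dx.
have [] // : hol_cont c c' f x.
apply: (hol_cont_source (cA _ A1)) => //; first exact: AXc.
apply: (hol_cont_target (compatible_sym (c'A _ A1'))) => //; exact: AYc.
Qed.

Lemma continuous_pair (T X1 X2 : topologicalType) (f : T -> X1) (g : T -> X2) t :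
  {for t, continuous f} -> {for t, continuous g} ->
  {for t, continuous (fun y => (f y, g y))}.
Proof. by move=> fc gc; exact: cvg_pair. Qed.

Lemma near_fst (X1 X2 : topologicalType) (z : X1 * X2) (A : set X1) : nbhs z.1 A ->
  \forall z' \near z, A z'.1.
Proof. by move=> nA; exists (A, setT) => [|y []//]; split=> //; exact: filterT. Qed.

Lemma near_snd (X1 X2 : topologicalType) (z : X1 * X2) (A : set X2) : nbhs z.2 A ->
  \forall z' \near z, A z'.2.
Proof. by move=> nA; exists (setT, A) => [|y []//]; split=> //; exact: filterT. Qed.

Lemma open_prod (X Y : topologicalType) (A : set X) (B : set Y) :
  open A -> open B -> open (A `*` B).
Proof.
move=> oA oB; rewrite openE => -[x y] [/= Ax By].
by exists (A, B) => //; split; exact: open_nbhs_nbhs.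
Qed.

Lemma prod_chartP (X Y : topologicalType) (c : @chart R X) (c' : @chart R Y) :
  is_chart c -> is_chart c' -> is_chart (prod_chart c c').
Proof.
move=> cc cc'; have [oc ci _ _] := cc; have [oc' ci' _ _] := cc'.
have nb x y A : nbhs (x : 'rV[C]_(chart_dim c)) A -> forall B, nbhs (y : 'rV[C]_(chart_dim c')) B ->
    nbhs (row_mx x y) [set z | A (lsubmx z) /\ B (rsubmx z)].
  move=> nA B nB; set z := row_mx x y.
  have n1 : nbhs z (lsubmx @^-1` A).
    by apply: (differentiable_continuous (differentiable_lsubmx z)); rewrite row_mxKl.
  have n2 : nbhs z (rsubmx @^-1` B).
    by apply: (differentiable_continuous (differentiable_rsubmx z)); rewrite row_mxKr.
  exact: filterI n1 n2.
split.
- exact: open_prod.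
- move=> [x y] [x' y']; rewrite !inE /= => -[cx cy] [cx' cy'] /eq_row_mx[ex ey].
  by congr (_, _); [apply: ci|apply: ci'] => //; rewrite inE.
- apply/within_open_continuousP; first exact: open_prod.
  move=> [x y] [/= cx cy]; apply/rnorm_cvgP => e e0.
  have /rnorm_cvgP/(_ e e0) n1 := chart_map_continuous cc cx.
  have /rnorm_cvgP/(_ e e0) n2 := chart_map_continuous cc' cy.
  exists ([set x' | rnorm (chart_map c x' - chart_map c x) < e],
    [set y' | rnorm (chart_map c' y' - chart_map c' y) < e]); first by split.
  move=> [x' y'] [/= h1 h2]; rewrite /= opp_row_mx add_row_mx.
  apply: (@le_lt_trans _ _ (Order.max (rnorm (chart_map c x' - chart_map c x))
    (rnorm (chart_map c' y' - chart_map c' y)))); last by rewrite gt_max h1.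
  apply/rnorm_mx_le => [|i j]; first by rewrite le_max rnorm_ge0.
  by rewrite mxE; case: splitP => j' _; rewrite le_max rnorm_coord ?orbT.
- move=> U oU UD; rewrite openE => _ [[x y] Uxy <-].
  have [/= cx cy] := UD _ Uxy.
  have [[A B] [/= nA nB] AB] : nbhs (x, y) U by exact: open_nbhs_nbhs.
  have := nb _ _ _ (chart_map_open cc cx nA) _ (chart_map_open cc' cy nB).
  apply: filterS => z [[x' [Ax' _] zx'] [y' [By' _] zy']].
  by exists (x', y'); [exact: AB|rewrite /= zx' zy' hsubmxK].
Qed.

Lemma prod_compatible (X Y : topologicalType) (SX : set (@chart R X)) (SY : set (@chart R Y)) :
  (forall c, SX c -> is_chart c) -> (forall c, SY c -> is_chart c) ->
  compatible_atlas [set prod_chart c c' | c in SX & c' in SY] (prod_atlas SX SY).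
Proof.
move=> SXc SYc; apply: generated_compatible => _ [c cS [c' c'S <-]].
by apply: prod_chartP; [exact: SXc|exact: SYc].
Qed.

(** [sec] is a continuous lift of the inverse of [m], which makes [m] open; continuity of [m]
    follows from that of [m \o p] because [p] is open. *)
Lemma quotient_chart (X Y : topologicalType) (p : X -> Y) (D : set Y) n
    (m : Y -> 'rV[C]_n) (O : set 'rV[C]_n) (sec : 'rV[C]_n -> X) :
  continuous p -> (forall A, open A -> open (p @` A)) -> (forall y, exists x, p x = y) ->
  open D -> open O ->
  (forall t, O t -> D (p (sec t)) /\ m (p (sec t)) = t) ->
  (forall y, D y -> O (m y) /\ p (sec (m y)) = y) ->
  (forall t, O t -> {for t, continuous sec}) ->
  (forall x, D (p x) -> {for x, continuous (m \o p)}) ->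
  is_chart (Chart D m).
Proof.
move=> pc po psurj oD oO secD mD secc mc; split => //=.
- move=> y y'; rewrite !inE => Dy Dy' yy'.
  by rewrite -(mD y Dy).2 -(mD y' Dy').2 yy'.
- apply/within_open_continuousP => // y; have [x <-] := psurj y => Dx A nA.
  have [B [oB Bx] BA] : exists2 B, open_nbhs x B & B `<=` (m \o p) @^-1` A.
    by have := mc x Dx A nA; rewrite nbhsE => -[B]; exists B.
  have nB : nbhs (p x) (p @` B) by apply: open_nbhs_nbhs; split; [exact: po|exists x].
  by apply: filterS nB => _ [z Bz <-]; exact: BA.
- move=> U oU UD; have -> : m @` U = O `&` (p \o sec) @^-1` U.
    apply/seteqP; split=> [_ [y Uy <-]|t [Ot Ut]].
      by have [Om pm] := mD y (UD _ Uy); split=> //=; rewrite pm.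
    by exists (p (sec t)) => //; exact: (secD t Ot).2.
  rewrite openE => t [Ot Ut]; apply: filterI; first exact: open_nbhs_nbhs.
  have c : {for t, continuous (p \o sec)} by apply: continuous_comp; [exact: secc|exact: pc].
  by apply: c; exact: open_nbhs_nbhs.
Qed.

End HolContinuous.

(** * The bimodule of representations of a quiver *)

Section QuiverBimodule.
Context {R : realType} {Q : quiver}.
Local Notation C := (Cx R).
Variable V : vertex Q -> vectType C.

Local Notation endE := (fun a : vertex Q => 'Hom(V a, V a)).
Local Notation homE := (fun al : arrow Q => 'Hom(V (source al), V (target al))).
Local Notation KE := #|{: {a : vertex Q & 'I_(\dim {:'Hom(V a, V a)})}}|.
Local Notation KA := #|{: {al : arrow Q & 'I_(\dim {:'Hom(V (source al), V (target al))})}}|.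
Local Notation kE := (@family_coord R (vertex Q) endE).
Local Notation kA := (@family_coord R (arrow Q) homE).
Local Notation iE := (@family_inv R (vertex Q) endE).
Local Notation iA := (@family_inv R (arrow Q) homE).

Definition endo_mul (x y : 'rV[C]_KE) : 'rV[C]_KE :=
  kE (fun a => (iE x a : 'Hom(V a, V a)) \o (iE y a : 'Hom(V a, V a)))%VF.
Definition endo_one : 'rV[C]_KE := kE (fun a => \1%VF).
Definition rep_ra (r : 'rV[C]_KA) (x : 'rV[C]_KE) : 'rV[C]_KA :=
  kA (fun al => ((iA r al : 'Hom(_, _)) \o (iE x (source al) : 'Hom(_, _)))%VF).
Definition rep_la (x : 'rV[C]_KE) (r : 'rV[C]_KA) : 'rV[C]_KA :=
  kA (fun al => ((iE x (target al) : 'Hom(_, _)) \o (iA r al : 'Hom(_, _)))%VF).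

Lemma endo_mulP : bilin endo_mul.
Proof.
split=> [w a x y|u a x y]; apply: family_coordP => i; rewrite family_invP.
  by rewrite comp_lfunDl comp_lfunZl.
by rewrite comp_lfunDr comp_lfunZr.
Qed.

Lemma rep_raP : bilin rep_ra.
Proof.
split=> [w a x y|u a x y]; apply: family_coordP => i; rewrite family_invP.
  by rewrite comp_lfunDl comp_lfunZl.
by rewrite comp_lfunDr comp_lfunZr.
Qed.

Lemma rep_laP : bilin rep_la.
Proof.
split=> [w a x y|u a x y]; apply: family_coordP => i; rewrite family_invP.
  by rewrite comp_lfunDl comp_lfunZl.
by rewrite comp_lfunDr comp_lfunZr.
Qed.

Lemma family_eq (I : finType) (E : I -> vectType C) (x y : lin_family E) :
  (forall i, x i = y i) -> x = y.
Proof. by move=> H; apply: functional_extensionality_dep. Qed.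

Lemma endo_mulA : associative endo_mul.
Proof.
move=> x y z; rewrite /endo_mul; congr family_coord; apply: family_eq => a.
by rewrite !family_coordK comp_lfunA.
Qed.

Lemma endo_mul1 : left_id endo_one endo_mul.
Proof.
move=> x; rewrite /endo_mul /endo_one -[RHS]family_invK; congr family_coord.
by apply: family_eq => a; rewrite family_coordK comp_lfun1l.
Qed.

Lemma endo_mulr1 : right_id endo_one endo_mul.
Proof.
move=> x; rewrite /endo_mul /endo_one -[RHS]family_invK; congr family_coord.
by apply: family_eq => a; rewrite family_coordK comp_lfun1r.
Qed.

Lemma rep_raA r x y : rep_ra r (endo_mul x y) = rep_ra (rep_ra r x) y.
Proof.
rewrite /rep_ra /endo_mul; congr family_coord; apply: family_eq => a.
by rewrite !family_coordK comp_lfunA.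
Qed.

Lemma rep_ra1 r : rep_ra r endo_one = r.
Proof.
rewrite /rep_ra /endo_one -[RHS]family_invK; congr family_coord.
by apply: family_eq => a; rewrite family_coordK comp_lfun1r.
Qed.

Lemma rep_laA x y r : rep_la (endo_mul x y) r = rep_la x (rep_la y r).
Proof.
rewrite /rep_la /endo_mul; congr family_coord; apply: family_eq => a.
by rewrite !family_coordK comp_lfunA.
Qed.

Lemma rep_la1 r : rep_la endo_one r = r.
Proof.
rewrite /rep_la /endo_one -[RHS]family_invK; congr family_coord.
by apply: family_eq => a; rewrite family_coordK comp_lfun1l.
Qed.

Lemma rep_laraA x r y : rep_la x (rep_ra r y) = rep_ra (rep_la x r) y.
Proof.
rewrite /rep_la /rep_ra; congr family_coord; apply: family_eq => a.
by rewrite !family_coordK comp_lfunA.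
Qed.

Definition rep_bimodule : bimodule KE KA :=
  Bimodule endo_mulP rep_raP rep_laP endo_mulA endo_mul1 endo_mulr1 rep_raA rep_ra1
    rep_laA rep_la1 rep_laraA.

Local Notation M := rep_bimodule.

Definition AutV_row (g : AutV V) : 'rV[C]_KE := kE (\val g).

Lemma AutV_rowM g h : AutV_row (g * h)%g = endo_mul (AutV_row g) (AutV_row h).
Proof.
by rewrite /AutV_row /endo_mul; congr family_coord; apply: family_eq => a; rewrite !family_coordK.
Qed.

Lemma AutV_row1 : AutV_row 1%g = endo_one. Proof. by []. Qed.

Lemma AutV_row_unit g : bunit M (AutV_row g) /\ binv M (AutV_row g) = AutV_row g^-1%g.
Proof.
by apply: bunitP; rewrite /= -AutV_rowM ?mulgV ?mulVg AutV_row1.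
Qed.

Lemma AutV_row_inj : injective AutV_row.
Proof. by move=> g h /(can_inj (@family_coordK R (vertex Q) endE))/val_inj. Qed.

Lemma bunit_AutV z : bunit M z -> @AutV_set R Q V (iE z).
Proof.
move=> zu a.
have zV := bmulxV zu; have Vz := bmulVx zu.
have zVa : ((iE z a : 'Hom(V a, V a)) \o (iE (binv M z) a : 'Hom(V a, V a)) = \1)%VF.
  have := congr1 (fun w => iE w a) zV; rewrite /= /endo_mul /endo_one !family_coordK; exact.
have Vza : ((iE (binv M z) a : 'Hom(V a, V a)) \o (iE z a : 'Hom(V a, V a)) = \1)%VF.
  have := congr1 (fun w => iE w a) Vz; rewrite /= /endo_mul /endo_one !family_coordK; exact.
exists (iE (binv M z) a : 'Hom(V a, V a)) => x.
  by rewrite -comp_lfunE Vza id_lfunE.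
by rewrite -comp_lfunE zVa id_lfunE.
Qed.

Lemma AutV_bunit x : @AutV_set R Q V x -> bunit M (kE x).
Proof. by move=> xa; have [] := AutV_row_unit (exist _ x (mem_set xa)). Qed.

Lemma AutV_set_open : open (@AutV_set R Q V).
Proof.
have -> : @AutV_set R Q V = kE @^-1` [set z | bunit M z].
  apply/seteqP; split=> x /=; first exact: AutV_bunit.
  by move=> /bunit_AutV; rewrite family_coordK.
apply: open_comp; first by move=> x _; exact: family_coord_continuous.
rewrite openE => z zu; exact: (bunit_near (f := id) ex_diff zu).
Qed.

(* The value is 1 when [z] is not invertible. *)
Definition AutV_of_row (z : 'rV[C]_KE) : AutV V :=
  if pselect (@AutV_set R Q V (iE z)) is left zP then exist _ (iE z) (mem_set zP) else 1%g.

Lemma AutV_of_rowK z : bunit M z -> AutV_row (AutV_of_row z) = z.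
Proof.
move=> zu; rewrite /AutV_of_row; case: pselect => [zP|]; last by move=> /(_ (bunit_AutV zu)).
by rewrite /AutV_row /= family_invK.
Qed.

Definition rep_row (x : rep_space V) : 'rV[C]_KA := kA x.

Lemma rep_act_row x g : rep_row (rep_act x g) = bact M (rep_row x) (AutV_row g).
Proof.
have [gu _] := AutV_row_unit g.
apply/esym/(bactE _ _ gu); rewrite /= /rep_ra /rep_la; congr family_coord.
apply: family_eq => al; rewrite !family_coordK.
by rewrite /rep_act lker0_compVKf ?AutV_lker.
Qed.

Lemma rep_morphism_row (x : rep_space V) (f : forall a, 'Hom(V a, V a)) :
  rep_morphism x x f <->
  bra M (rep_row x) (kE f) = bla M (kE f) (rep_row x).
Proof.
split=> [H|H].
  rewrite /= /rep_ra /rep_la; congr family_coord; apply: family_eq => al.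
  by rewrite !family_coordK H.
move=> al; have := congr1 (fun w => iA w al) H.
by rewrite /= /rep_ra /rep_la !family_coordK => ->.
Qed.

Lemma family_inv0 (I : finType) (E : I -> vectType C) i : family_inv 0 i = 0 :> E i.
Proof.
by have := @family_invP R I E (-1) 0 0 i; rewrite scaler0 addr0 scaleN1r addNr.
Qed.

Lemma family_invZ (I : finType) (E : I -> vectType C) l z i :
  family_inv (l *: z) i = l *: (family_inv z i : E i) :> E i.
Proof. by have := @family_invP R I E l z 0 i; rewrite addr0 family_inv0 addr0. Qed.

Lemma scalar_row (f : forall a, 'Hom(V a, V a)) l :
  (forall a, f a = l *: \1%VF) <-> kE f = l *: endo_one.
Proof.
have oneE a : iE endo_one a = \1%VF by rewrite family_coordK.
split=> [H|H a].
  rewrite -[RHS]family_invK; congr family_coord; apply: family_eq => a.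
  by rewrite family_invZ oneE H.
by rewrite -(family_coordK (f : lin_family endE)) H family_invZ oneE.
Qed.

(** C is algebraically closed, and a non-zero identity means a space of positive dimension. *)
Lemma lfun_eigenvalue (W : vectType C) (f : 'Hom(W, W)) : \1%VF != 0 :> 'Hom(W, W) ->
  exists l, lker (f - l *: \1)%VF != 0%VS.
Proof.
move=> W1; pose e := vbasis {:W}.
have eB : basis_of fullv e := vbasisP _.
have n0 : (0 < \dim {:W})%N.
  rewrite lt0n; apply: contraNneq W1 => /eqP; rewrite dimv_eq0 => /eqP W0.
  apply/eqP/lfunP => x; rewrite id_lfunE zero_lfunE.
  by apply/eqP; rewrite -memv0 -W0 memvf.
have [l /eigenvalueP[v vA v0]] := eigenvalue_closed (passmx.mxof e e f) n0.
exists l; apply/negP => /lker0P H.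
case/negP: v0; rewrite -(passmx.vecof_eq0 eB); apply/eqP; apply: H.
rewrite linear0 add_lfunE opp_lfunE scale_lfunE id_lfunE.
have vl : passmx.vecof e (l *: v) = l *: passmx.vecof e v.
  by rewrite /passmx.vecof scaler_sumr; apply: eq_bigr => i _; rewrite mxE scalerA.
by rewrite (passmx.hom_vecof e eB) vA vl subrr.
Qed.

(** Schur's lemma: subtracting an eigenvalue at one vertex gives an endomorphism that is not
    invertible there, hence zero at all vertices. *)
Lemma schur_bschur x : schur x -> bschur M (rep_row x).
Proof.
move=> [[a a1] H] z zP.
have zf : rep_morphism x x (iE z) by apply/rep_morphism_row; rewrite family_invK.
have [l lP] := lfun_eigenvalue (iE z a) a1.
pose f b : 'Hom(V b, V b) := (iE z b : 'Hom(V b, V b)) - l *: \1%VF.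
have fP : rep_morphism x x f.
  move=> al; rewrite /f; have := zf al.
  rewrite !comp_lfunDl !comp_lfunDr !comp_lfunNl !comp_lfunNr => ->.
  by rewrite -!comp_lfunZl -!comp_lfunZr comp_lfun1l comp_lfun1r.
exists l; rewrite -[z]family_invK; apply/scalar_row => b.
apply/eqP; rewrite -subr_eq0; apply: contraT => fb.
have [|g _ gf] := H f fP; first by exists b.
case/negP: lP; apply/lker0P => u v uv.
have := congr1 (g a) uv; rewrite -!comp_lfunE.
by have [gfa _] := gf a; rewrite gfa !id_lfunE.
Qed.

Lemma bschur_schur x : (exists a, \1%VF != 0 :> 'Hom(V a, V a)) ->
  bschur M (rep_row x) -> schur x.
Proof.
move=> one0 H; split=> // f /rep_morphism_row /H[l /scalar_row fl] [a fa].
have l0 : l != 0 by apply: contraNneq fa => l0; rewrite fl l0 scale0r.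
exists (fun a => l^-1 *: \1%VF) => [al|b].
  by rewrite -comp_lfunZl -comp_lfunZr comp_lfun1l comp_lfun1r.
rewrite fl -!comp_lfunZl -!comp_lfunZr !comp_lfun1l !scalerA mulVf// mulfV//.
by rewrite !scale1r.
Qed.

Hypothesis V_neq0 : exists a, \1%VF != 0 :> 'Hom(V a, V a).

Lemma endo_one_neq0 : endo_one != 0.
Proof.
have [a a1] := V_neq0; apply: contraNneq a1 => o0.
have /scalar_row -> : kE (fun a => \1%VF) = 0 *: endo_one by rewrite scale0r.
by rewrite scale0r.
Qed.

Lemma endo_one_coord : exists i0 : 'I_KE, endo_one 0 i0 != 0.
Proof.
apply: contrapT => H; case/negP: endo_one_neq0; apply/eqP/rowP => i; rewrite [RHS]mxE.
by apply/eqP; apply: contraT => ?; case: H; exists i.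
Qed.

Definition slice_data (r0 : 'rV[C]_KA) : Prop :=
  exists i0 (ext : 'rV[C]_(KE.-1) -> 'rV[C]_KE) (P : 'M[C]_(KA, KE.-1)),
  [/\ [/\ endo_one 0 i0 != 0, linear ext & forall y, ext y 0 i0 = 0],
      forall x : 'rV[C]_KE, x 0 i0 = 0 -> exists y, x = ext y,
      forall y, ext y = 0 -> y = 0 &
      bad_mx M ext r0 r0 *m P = 1%:M].

Lemma bschur_slice_data r0 : bschur M r0 -> slice_data r0.
Proof.
move=> s0; have [i0 i00] := endo_one_coord.
have [ext [e1 e2 e3 e4]] := @ext_exists R _ i0.
have /row_freeP[P PE] := bad_free (M := M) i00 e1 e2 e4 s0.
by exists i0, ext, P.
Qed.

Lemma schur_set_open : open (@schur_set R Q V).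
Proof.
rewrite openE => x /schur_bschur s0.
have [i0 [ext [P [[i00 e1 e2] e3 e4 PE]]]] := bschur_slice_data s0.
have n1 := bschur_near (M := M) i00 e1 e3 PE.
have n2 : nbhs x (kA @^-1` [set r | bschur M r]) by exact: family_coord_continuous.
by apply: (@filterS _ _ (nbhs_filter x) _ _ _ n2) => y ys; exact: bschur_schur.
Qed.

End QuiverBimodule.

(** * The projective automorphism group *)

Section ProjectiveGroup.
Context {R : realType} {Q : quiver}.
Local Notation C := (Cx R).
Variable V : vertex Q -> vectType C.
Local Notation M := (rep_bimodule V).
Local Notation KA := #|{: {al : arrow Q & 'I_(\dim {:'Hom(V (source al), V (target al))})}}|.
Local Notation KE := #|{: {a : vertex Q & 'I_(\dim {:'Hom(V a, V a)})}}|.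

Hypothesis V_neq0 : exists a, \1%VF != 0 :> 'Hom(V a, V a).

Definition AutV_chart : @chart R (AutV V) := sub_chart (@AutV_set R Q V).
Definition schur_chart : @chart R (schur_space V) := sub_chart (@schur_set R Q V).
Local Notation cG := AutV_chart.
Local Notation cX := schur_chart.

Lemma AutV_chartP : is_chart cG.
Proof. exact: sub_chartP (@AutV_set_open R Q V). Qed.

Lemma schur_chartP : is_chart cX.
Proof. exact: sub_chartP (schur_set_open V_neq0). Qed.

Lemma AutV_premanifold : premanifold (@AutV_atlas R Q V).
Proof. exact: open_atlas_premanifold (@AutV_set_open R Q V). Qed.

Lemma schur_premanifold : premanifold (@schur_atlas R Q V).
Proof. exact: open_atlas_premanifold (schur_set_open V_neq0). Qed.

Lemma AutV_chart_atlas : @AutV_atlas R Q V cG.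
Proof. exact: sub_chart_atlas (@AutV_set_open R Q V). Qed.

Lemma schur_chart_atlas : @schur_atlas R Q V cX.
Proof. exact: sub_chart_atlas (schur_set_open V_neq0). Qed.

(** When the target chart is defined everywhere, a coordinate formula alone gives continuity too.
    Both [AutV] and the Schur space have such a chart. *)
Lemma hol_cont_global (X Y : topologicalType) (c : @chart R X) (c' : @chart R Y) (f : X -> Y) x
    (h : 'rV[C]_(chart_dim c) -> 'rV[C]_(chart_dim c')) :
  {for x, continuous (chart_map c)} -> is_chart c' -> chart_dom c' = setT ->
  (\forall y \near x, h (chart_map c y) = chart_map c' (f y)) ->
  differentiable h (chart_map c x) -> hol_cont c c' f x.
Proof.
move=> cx cc' cT hf dh; have hol : hol_at c c' f x by exists h.
split=> //; apply: hol_at_continuous hol => //.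
by rewrite cT; apply: (@filterE _ _ (nbhs_filter x)).
Qed.

Lemma AutV_mul_hol_cont (z : AutV V * AutV V) :
  hol_cont (prod_chart cG cG) cG (fun z : AutV V * AutV V => (z.1 * z.2)%g) z.
Proof.
apply: (@hol_cont_global _ _ (prod_chart cG cG) cG _ z
  (fun w : 'rV[C]_(KE + KE) => endo_mul (lsubmx w) (rsubmx w))) => //.
- exact: chart_map_continuous (prod_chartP AutV_chartP AutV_chartP) _.
- exact: AutV_chartP.
- apply: (@filterE _ _ (nbhs_filter z)) => -[g h] /=.
  by rewrite row_mxKl row_mxKr; exact/esym/AutV_rowM.
- apply: (differentiable_bilin2 (endo_mulP V)).
    exact: differentiable_lsubmx.
  exact: differentiable_rsubmx.
Qed.

Lemma AutV_inv_hol_cont (g : AutV V) : hol_cont cG cG (fun g : AutV V => g^-1%g) g.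
Proof.
have [gu _] := AutV_row_unit g.
apply: (@hol_cont_global _ _ cG cG _ g (binv M)) => //.
- exact: chart_map_continuous AutV_chartP _.
- exact: AutV_chartP.
- by apply: (@filterE _ _ (nbhs_filter g)) => h; have [_ ] := AutV_row_unit h.
- exact: (differentiable_binv (M := M) (f := id) ex_diff gu).
Qed.

Lemma schur_act_hol_cont (z : schur_space V * AutV V) :
  hol_cont (prod_chart cX cG) cX (fun z : schur_space V * AutV V => schur_act_AutV z.1 z.2) z.
Proof.
have [gu _] := AutV_row_unit z.2.
apply: (@hol_cont_global _ _ (prod_chart cX cG) cX _ z
  (fun w : 'rV[C]_(KA + KE) => bact M (lsubmx w) (rsubmx w))) => //.
- exact: chart_map_continuous (prod_chartP schur_chartP AutV_chartP) _.
- exact: schur_chartP.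
- apply: (@filterE _ _ (nbhs_filter z)) => -[x h] /=.
  by rewrite row_mxKl row_mxKr; exact/esym/rep_act_row.
- apply: differentiable_bact.
  + exact: differentiable_lsubmx.
  + exact: differentiable_rsubmx.
  + by rewrite row_mxKr.
Qed.

Lemma AutV_row_nbhs (g : AutV V) (A : set (AutV V)) : nbhs g A ->
  exists2 B : set 'rV[C]_KE, nbhs (AutV_row g) B & forall h : AutV V, B (AutV_row h) -> A h.
Proof. by move=> /(sub_coord_nbhs (g : @AutV_set R Q V) A). Qed.

Lemma bunit_nbhs z : bunit M z -> exists2 U, nbhs z U & forall z', U z' -> bunit M z'.
Proof.
by move=> zu; exists [set z' | bunit M z'] => //; exact: (bunit_near (M := M) (f := id) ex_diff zu).
Qed.

Lemma AutV_of_row_continuous (T : topologicalType) (h : T -> 'rV[C]_KE) t :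
  {for t, continuous h} -> bunit M (h t) -> {for t, continuous (fun y => AutV_of_row (h y))}.
Proof.
move=> hcont hu A /AutV_row_nbhs[B]; rewrite (AutV_of_rowK hu) => nB BA.
have n1 : nbhs t (h @^-1` B) by exact: hcont nB.
have [U nU UP] := bunit_nbhs hu.
have n2 : nbhs t (h @^-1` U) by exact: hcont nU.
apply: filterS2 n1 n2 => y By /UP yu.
by apply: BA; rewrite AutV_of_rowK.
Qed.

Lemma AutV_of_row_hol_cont (X : topologicalType) (c : @chart R X) (h : 'rV[C]_(chart_dim c) -> 'rV[C]_KE) x :
  {for x, continuous (chart_map c)} -> differentiable h (chart_map c x) ->
  bunit M (h (chart_map c x)) ->
  hol_cont c cG (fun y => AutV_of_row (h (chart_map c y))) x.
Proof.
move=> cx dh hu; apply: (@hol_cont_global _ _ c cG _ _ h) => //; first exact: AutV_chartP.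
have hcont : {for x, continuous (h \o chart_map c)}.
  by apply: continuous_comp => //; exact: differentiable_continuous.
have [U nU UP] := bunit_nbhs hu.
have n1 : nbhs x ((h \o chart_map c) @^-1` U) by exact: hcont nU.
by apply: filterS n1 => y /UP yu; exact/esym/AutV_of_rowK.
Qed.

Lemma AutV_row_scalar (z g : AutV V) : scalars z -> exists2 l, l != 0 & AutV_row (z * g)%g = l *: AutV_row g.
Proof.
move=> [l l0 zl]; exists l => //; rewrite AutV_rowM.
have -> : AutV_row z = l *: endo_one V by exact/scalar_row.
by rewrite (bilinZ (endo_mulP V)) endo_mul1.
Qed.

Lemma AutV_row_neq0 (g : AutV V) : AutV_row g != 0.
Proof.
have [u _] := AutV_row_unit g; apply: (@bunit_neq0 _ _ _ M _ _ u).
exact: endo_one_neq0.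
Qed.

(** The factor [l] is automatically non-zero, since the row of a group element never vanishes. *)
Lemma AutV_row_proportional (g h : AutV V) l : AutV_row h = l *: AutV_row g -> PAutV_pi g = PAutV_pi h.
Proof.
move=> hg; apply/PAutV_piP; exists (h * g^-1)%g; last by rewrite -mulgA mulVg mulg1.
have E : AutV_row (h * g^-1)%g = l *: endo_one V.
  rewrite AutV_rowM hg (bilinZ (endo_mulP V)) -AutV_rowM mulgV.
  by rewrite AutV_row1.
have /scalar_row H : AutV_row (h * g^-1)%g = l *: endo_one V := E.
exists l; last exact: H.
apply: contra_eq_neq E => ->; rewrite scale0r.
exact: AutV_row_neq0.
Qed.

Lemma AutV_row_repr (g : AutV V) : exists2 l, l != 0 & AutV_row (PAutV_repr (PAutV_pi g)) = l *: AutV_row g.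
Proof.
have /PAutV_piP[z zs ->] := esym (PAutV_reprK (PAutV_pi g)).
exact: AutV_row_scalar.
Qed.

(** Affine coordinates on projective space: division by the [i]-th homogeneous coordinate, which
    [proj_lift] sets back to 1. *)
Definition proj_coord (i : 'I_KE) (z : 'rV[C]_KE) : 'rV[C]_(KE.-1) := (z 0 i)^-1 *: col' i z.
Definition proj_lift (i : 'I_KE) (w : 'rV[C]_(KE.-1)) : 'rV[C]_KE :=
  \row_l (if unlift i l is Some j then w 0 j else 1).

Lemma proj_coordZ i l z : l != 0 -> proj_coord i (l *: z) = proj_coord i z.
Proof.
by move=> l0; apply/rowP => j; rewrite !mxE invfM mulrACA mulVf// mul1r.
Qed.

Lemma proj_lift_i i w : proj_lift i w 0 i = 1.
Proof. by rewrite mxE unlift_none. Qed.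

Lemma proj_liftK i : cancel (proj_lift i) (proj_coord i).
Proof.
move=> w; apply/rowP => j; rewrite /proj_coord proj_lift_i invr1 scale1r.
by rewrite !mxE liftK.
Qed.

Lemma proj_coordK i (z : 'rV[C]_KE) : z 0 i != 0 -> z = z 0 i *: proj_lift i (proj_coord i z).
Proof.
move=> zi; apply/rowP => l; rewrite !mxE.
case: unliftP => [j ->|->]; last by rewrite mulr1.
by rewrite !mxE mulrA divff// mul1r.
Qed.

Lemma differentiable_proj_lift i w : differentiable (proj_lift i) w.
Proof.
apply: differentiable_row => l.
case E : (unlift i l) => [j|].
  have -> : (fun v => proj_lift i v 0 l) = (fun v => v 0 j).
    by apply/funext => v; rewrite mxE E.
  exact: differentiable_coord.
have -> : (fun v => proj_lift i v 0 l) = cst 1.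
  by apply/funext => v; rewrite mxE E.
exact: differentiable_cst.
Qed.

Lemma differentiable_proj_coord i (z : 'rV[C]_KE) : z 0 i != 0 -> differentiable (proj_coord i) z.
Proof.
move=> zi; apply: differentiable_row => j.
have -> : (fun v => proj_coord i v 0 j) = (fun v => (v 0 i)^-1 * v 0 (lift i j)).
  by apply/funext => v; rewrite !mxE.
apply: differentiable_mul; last exact: differentiable_coord.
by apply: differentiableV => //; exact: differentiable_coord.
Qed.

(* PAutV is an open subset of a projective space; these are its affine charts. *)
Definition PAutV_chart (i : 'I_KE) : @chart R (PAutV V) :=
  Chart [set c | AutV_row (PAutV_repr c) 0 i != 0]
    (fun c => proj_coord i (AutV_row (PAutV_repr c))).

Lemma PAutV_chart_dom i (g : AutV V) : chart_dom (PAutV_chart i) (PAutV_pi g) = (AutV_row g 0 i != 0).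
Proof.
have [l l0 E] := AutV_row_repr g.
by rewrite /= E mxE mulf_eq0 (negPf l0).
Qed.

Lemma PAutV_chart_map i (g : AutV V) : chart_map (PAutV_chart i) (PAutV_pi g) = proj_coord i (AutV_row g).
Proof. by have [l l0 E] := AutV_row_repr g; rewrite /= E proj_coordZ. Qed.

Lemma PAutV_pi_continuous : continuous (@PAutV_pi R Q V).
Proof. exact: pi_continuous. Qed.

Lemma PAutV_pi_surj (y : PAutV V) : exists g, PAutV_pi g = y.
Proof. by exists (PAutV_repr y); exact: PAutV_reprK. Qed.

Lemma AutV_mul_continuous (g h : AutV V) : {for h, continuous (fun h : AutV V => (g * h)%g)}.
Proof.
have [] // : hol_cont cG cG (fun h : AutV V => (g * h)%g) h.
exact: (hol_cont_comp (hol_cont_pair (hol_cont_cst cG cG g h) (hol_cont_id cG h)) (AutV_mul_hol_cont (g, h))).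
Qed.

(** The saturation of [A] is the union of its translates by scalars, each open. *)
Lemma PAutV_pi_open (A : set (AutV V)) : open A -> open (@PAutV_pi R Q V @` A).
Proof.
move=> oA; have -> : open (@PAutV_pi R Q V @` A) = open (@PAutV_pi R Q V @^-1` (@PAutV_pi R Q V @` A)) by [].
have -> : @PAutV_pi R Q V @^-1` (@PAutV_pi R Q V @` A) =
    \bigcup_(z in @scalars R Q V) [set g | A (z * g)%g].
  apply/seteqP; split=> [g [h Ah /esym/PAutV_piP[z zs hz]]|g [z zs Azg]].
    by exists z => //=; rewrite -hz.
  by exists (z * g)%g => //; apply/esym/PAutV_piP; exists z.
apply: bigcup_open => z _.
by apply: (open_comp (f := fun g : AutV V => (z * g)%g)) => // g _; exact: AutV_mul_continuous.
Qed.

Lemma AutV_row_continuous : continuous (@AutV_row R Q V).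
Proof. exact: (@sub_coord_continuous R _ _ (@AutV_set R Q V)). Qed.

Lemma PAutV_chart_dom_open i : open (chart_dom (PAutV_chart i)).
Proof.
have -> : open (chart_dom (PAutV_chart i)) = open (@PAutV_pi R Q V @^-1` chart_dom (PAutV_chart i)) by [].
have -> : @PAutV_pi R Q V @^-1` chart_dom (PAutV_chart i) = [set g | AutV_row g 0 i != 0].
  by apply/seteqP; split=> g; rewrite /preimage /mkset PAutV_chart_dom.
rewrite openE => g gi.
have c : {for g, continuous (fun g => AutV_row g 0 i : C)}.
  apply: (continuous_comp (f := @AutV_row R Q V) (g := fun z : 'rV[C]_KE => z 0 i : C)).
    exact: AutV_row_continuous.
  exact: coord_continuous.
exact: cvgr_neq0 c gi.
Qed.

Lemma bunitZ l z : l != 0 -> bunit M z -> bunit M (l *: z).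
Proof.
move=> l0 zu; have [] // := @bunitP R _ _ M (l *: z) (l^-1 *: binv M z).
  by rewrite (bilinZ (bmulP M)) (bilinZr (bmulP M)) scalerA mulfV// scale1r bmulxV.
by rewrite (bilinZ (bmulP M)) (bilinZr (bmulP M)) scalerA mulVf// scale1r bmulVx.
Qed.

Lemma PAutV_chart_of_row i (z : 'rV[C]_KE) : bunit M z -> z 0 i != 0 ->
  chart_dom (PAutV_chart i) (PAutV_pi (AutV_of_row z)) /\
  chart_map (PAutV_chart i) (PAutV_pi (AutV_of_row z)) = proj_coord i z.
Proof. by move=> zu zi; rewrite PAutV_chart_dom PAutV_chart_map AutV_of_rowK. Qed.

(** The free factor [l] serves two ends: [l = 1] gives the inverse of the affine chart, and [l]
    equal to the [i]-th coordinate of a chosen element makes the section pass through that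
    element. *)
Lemma PAutV_section i (g : AutV V) l : AutV_row g 0 i != 0 -> l != 0 ->
  bunit M (l *: proj_lift i (proj_coord i (AutV_row g))) /\
  PAutV_pi (AutV_of_row (l *: proj_lift i (proj_coord i (AutV_row g)))) = PAutV_pi g.
Proof.
move=> gi l0; set w := proj_lift i _.
have gE : AutV_row g = AutV_row g 0 i *: w by exact: proj_coordK.
have wE : l *: w = (l / AutV_row g 0 i) *: AutV_row g.
  by rewrite [X in _ = _ *: X]gE scalerA divfK.
have wu : bunit M (l *: w).
  rewrite wE; apply: bunitZ; first by rewrite mulf_neq0// invr_eq0.
  by have [] := AutV_row_unit g.
split=> //; apply/esym/(@AutV_row_proportional _ _ (l / AutV_row g 0 i)).
by rewrite AutV_of_rowK.
Qed.

Lemma PAutV_chartP i : is_chart (PAutV_chart i).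
Proof.
apply: (@quotient_chart R _ _ (@PAutV_pi R Q V) _ _ _ [set w | bunit M (proj_lift i w)]
  (fun w => AutV_of_row (proj_lift i w))).
- exact: PAutV_pi_continuous.
- exact: PAutV_pi_open.
- exact: PAutV_pi_surj.
- exact: PAutV_chart_dom_open.
- rewrite openE => w wu; apply: (bunit_near (M := M) (f := proj_lift i)) => //.
  exact: differentiable_proj_lift.
- move=> w wu; have := @PAutV_chart_of_row i _ wu.
  by rewrite proj_lift_i proj_liftK; apply; exact: oner_neq0.
- move=> y; have [g <-] := PAutV_pi_surj y.
  rewrite -[X in X -> _]/(chart_dom (PAutV_chart i) (PAutV_pi g)) PAutV_chart_dom => gi.
  rewrite -[proj_coord i _]/(chart_map (PAutV_chart i) (PAutV_pi g)) PAutV_chart_map.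
  by have := @PAutV_section i g 1 gi (oner_neq0 _); rewrite scale1r.
- move=> w wu; apply: AutV_of_row_continuous => //.
  exact/differentiable_continuous/differentiable_proj_lift.
- move=> g; rewrite -[X in X -> _]/(chart_dom (PAutV_chart i) (PAutV_pi g)) PAutV_chart_dom => gi.
  have -> : (fun c => proj_coord i (AutV_row (PAutV_repr c))) \o (@PAutV_pi R Q V) =
      proj_coord i \o @AutV_row R Q V.
    by apply/funext => h; exact: PAutV_chart_map.
  apply: continuous_comp; first exact: AutV_row_continuous.
  exact/differentiable_continuous/differentiable_proj_coord.
Qed.

Lemma PAutV_pi_hol_cont i (g : AutV V) : chart_dom (PAutV_chart i) (PAutV_pi g) ->
  hol_cont cG (PAutV_chart i) (@PAutV_pi R Q V) g.
Proof.
rewrite PAutV_chart_dom => gi; split; first exact: PAutV_pi_continuous.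
exists (proj_coord i); split; last exact: differentiable_proj_coord.
by apply: (@filterE _ _ (nbhs_filter g)) => h; exact/esym/PAutV_chart_map.
Qed.

Lemma PAutV_section_hol_cont i (g : AutV V) : chart_dom (PAutV_chart i) (PAutV_pi g) ->
  exists s : PAutV V -> AutV V, [/\ s (PAutV_pi g) = g,
    hol_cont (PAutV_chart i) cG s (PAutV_pi g) &
    forall y, chart_dom (PAutV_chart i) y -> PAutV_pi (s y) = y].
Proof.
move=> gD; have gi := gD; rewrite PAutV_chart_dom in gi.
pose h w := AutV_row g 0 i *: proj_lift i w.
exists (fun y => AutV_of_row (h (chart_map (PAutV_chart i) y))); split.
- rewrite PAutV_chart_map /h -proj_coordK//; apply: AutV_row_inj.
  by rewrite AutV_of_rowK//; have [] := AutV_row_unit g.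
- apply: AutV_of_row_hol_cont.
  + by apply: chart_map_continuous => //; exact: PAutV_chartP.
  + apply: (@differentiable_linear_comp R _ _ _ (fun u => AutV_row g 0 i *: u)).
      by move=> a u v; rewrite scalerDr !scalerA mulrC.
    exact: differentiable_proj_lift.
  + by rewrite PAutV_chart_map; have [] := PAutV_section gi gi.
- move=> y; have [g' <-] := PAutV_pi_surj y; rewrite PAutV_chart_dom => g'i.
  by rewrite PAutV_chart_map; have [] := PAutV_section g'i gi.
Qed.

Lemma PAutV_chart_cover (y : PAutV V) : exists i, chart_dom (PAutV_chart i) y.
Proof.
have [g <-] := PAutV_pi_surj y; apply: contrapT => H.
case/negP: (AutV_row_neq0 g); apply/eqP/rowP => i; rewrite [RHS]mxE.
apply/eqP; apply: contraT => gi; case: H; exists i; by rewrite PAutV_chart_dom.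
Qed.

Lemma hol_cont_atlas_source (X Y : topologicalType) (S : set (@chart R X)) (c c0 : @chart R X)
    (c' : @chart R Y) (f : X -> Y) x :
  premanifold S -> S c -> S c0 -> chart_dom c x -> chart_dom c0 x -> hol_cont c0 c' f x ->
  hol_cont c c' f x.
Proof.
move=> [Sc _ Scomp _] cS c0S cx c0x; apply: hol_cont_source => //.
- exact: Scomp.
- exact: Sc.
- exact: Sc.
Qed.

Lemma hol_cont_atlas_target (X Y : topologicalType) (S : set (@chart R Y)) (c : @chart R X)
    (c' c0 : @chart R Y) (f : X -> Y) x :
  premanifold S -> S c' -> S c0 -> chart_dom c' (f x) -> chart_dom c0 (f x) -> hol_cont c c0 f x ->
  hol_cont c c' f x.
Proof.
move=> [Sc _ Scomp _] cS c0S cx c0x; apply: hol_cont_target => //.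
- exact: Scomp.
- exact: Sc.
- exact: Sc.
Qed.

Lemma PAutV_submersion_charts :
  submersion_charts (@AutV_atlas R Q V) (@PAutV_pi R Q V) [set PAutV_chart i | i in setT].
Proof.
have SP := AutV_premanifold; have cS := AutV_chart_atlas.
split.
- by move=> _ [i _ <-]; exact: PAutV_chartP.
- by move=> y; have [i iy] := PAutV_chart_cover y; exists (PAutV_chart i) => //; exists i.
- move=> _ c0 g [i _ <-] c0S gi c0g.
  by have [] := hol_cont_atlas_source SP c0S cS c0g I (PAutV_pi_hol_cont gi).
- move=> _ g [i _ <-] gi; have [s [sg sh ps]] := PAutV_section_hol_cont gi.
  exists s; split=> //.
  + by case: sh.
  + by apply: filterS (chart_dom_nbhs (PAutV_chartP i) gi) => y; exact: ps.
  + move=> c0 c0S c0g.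
    by have [] : hol_cont (PAutV_chart i) c0 s (PAutV_pi g);
      first by apply: hol_cont_atlas_target SP c0S cS _ _ sh; rewrite ?sg.
Qed.

Lemma PAutV_premanifold : premanifold (@PAutV_atlas R Q V).
Proof.
exact: (quotient_atlas_premanifold AutV_premanifold PAutV_pi_continuous PAutV_pi_surj
  PAutV_submersion_charts).
Qed.

Lemma PAutV_chart_atlas i : @PAutV_atlas R Q V (PAutV_chart i).
Proof.
by apply: (special_quotient AutV_premanifold PAutV_pi_continuous PAutV_submersion_charts); exists i.
Qed.

End ProjectiveGroup.

(** * Slice charts of the moduli space *)

Section ModuliCharts.
Context {R : realType} {Q : quiver}.
Local Notation C := (Cx R).
Variable V : vertex Q -> vectType C.
Local Notation M := (rep_bimodule V).
Local Notation KA := #|{: {al : arrow Q & 'I_(\dim {:'Hom(V (source al), V (target al))})}}|.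
Local Notation KE := #|{: {a : vertex Q & 'I_(\dim {:'Hom(V a, V a)})}}|.
Local Notation cG := (AutV_chart V).
Local Notation cX := (schur_chart V).
Local Notation X := (schur_space V).
Local Notation p := (@moduli_pi R Q V).

Hypothesis V_neq0 : exists a, \1%VF != 0 :> 'Hom(V a, V a).

Definition schur_row (x : X) : 'rV[C]_KA := rep_row (\val x).

Lemma schur_row_inj : injective schur_row.
Proof. by move=> x y /(can_inj (@family_coordK R (arrow Q) _))/val_inj. Qed.

Lemma schur_row_schur x : bschur M (schur_row x).
Proof. by apply: schur_bschur; exact: set_mem (valP x). Qed.

Lemma schur_row_act x g : schur_row (schur_act_AutV x g) = bact M (schur_row x) (AutV_row g).
Proof. exact: rep_act_row. Qed.

(* The value is [x0] when [z] is not Schur. *)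
Definition schur_of_row (x0 : X) (z : 'rV[C]_KA) : X :=
  if pselect (@schur_set R Q V (@family_inv R (arrow Q) _ z)) is left zP
  then exist _ (family_inv z) (mem_set zP) else x0.

Lemma schur_of_rowK x0 z : bschur M z -> schur_row (schur_of_row x0 z) = z.
Proof.
move=> zs; rewrite /schur_of_row; case: pselect => [zP|[]].
  by rewrite /schur_row /rep_row /= family_invK.
by apply: (bschur_schur V_neq0); rewrite /rep_row family_invK; exact: zs.
Qed.

Lemma moduli_piP (x y : X) : p x = p y <-> exists g, y = schur_act_AutV x g.
Proof.
have eP := @eqmodP _ (orbit_equiv V) x y.
by split=> [/eP/asboolP //|xgy]; apply/eP/asboolP.
Qed.

Lemma moduli_pi_act x g : p (schur_act_AutV x g) = p x.
Proof. by apply/esym/moduli_piP; exists g. Qed.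

Lemma moduli_pi_continuous : continuous p.
Proof. exact: pi_continuous. Qed.

Lemma moduli_pi_surj (y : moduli V) : exists x, p x = y.
Proof. by exists (repr (y : {eq_quot orbit_equiv V}%qT)); exact: reprK. Qed.

Lemma schur_act_fix_hol_cont (g : AutV V) (x : X) : hol_cont cX cX (fun x => schur_act_AutV x g) x.
Proof.
exact: (hol_cont_comp (hol_cont_pair (hol_cont_id cX x) (hol_cont_cst cX cG g x)) (schur_act_hol_cont V_neq0 (x, g))).
Qed.

Lemma moduli_pi_open (A : set X) : open A -> open (p @` A).
Proof.
move=> oA; have -> : open (p @` A) = open (p @^-1` (p @` A)) by [].
have -> : p @^-1` (p @` A) = \bigcup_(g in [set: AutV V]) [set x | A (schur_act_AutV x g)].
  apply/seteqP; split=> [x [y Ay /esym/moduli_piP[g yx]]|x [g _ Axg]].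
    by exists g => //=; rewrite -yx.
  by exists (schur_act_AutV x g) => //; exact: moduli_pi_act.
apply: bigcup_open => g _.
apply: (open_comp (f := fun x : X => schur_act_AutV x g)) => // x _.
by case: (schur_act_fix_hol_cont g x).
Qed.

Lemma schur_row_nbhs (x : X) (A : set X) : nbhs x A ->
  exists2 B : set 'rV[C]_KA, nbhs (schur_row x) B & forall y : X, B (schur_row y) -> A y.
Proof. by move=> /(sub_coord_nbhs (x : @schur_set R Q V) A). Qed.

Lemma schur_row_continuous : continuous schur_row.
Proof. exact: (@sub_coord_continuous R _ _ (@schur_set R Q V)). Qed.

(** Besides the chart this records a holomorphic section [sec] and, near each point above the
    domain, a holomorphic group element carrying the section to the point. [ga] is chosen anew at
    each [x]: only its class modulo scalars is determined. *)
Definition moduli_slice_chart (c : @chart R (moduli V)) : Prop :=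
  is_chart c /\ exists sec : moduli V -> X,
    (forall y, chart_dom c y -> hol_cont c cX sec y /\ p (sec y) = y) /\
    forall x, chart_dom c (p x) -> hol_cont cX c p x /\
      exists2 ga : X -> AutV V, hol_cont cX cG ga x &
        \forall y \near x, schur_act_AutV (sec (p y)) (ga y) = y.

(** [D] is the set of orbits meeting a small slice through [x0], and [m] reads off the slice
    parameter, well defined because an orbit meets this slice at most once. *)
Lemma moduli_slice_chart_exists (x0 : X) :
  exists2 c, moduli_slice_chart c & chart_dom c (p x0).
Proof.
pose r0 := schur_row x0.
have [i0 [ext [P [[i00 e1 e2] e3 e4 PE]]]] := bschur_slice_data V_neq0 (@schur_row_schur x0).
have [d d0 dP] := slice_radius e1 PE.
pose sl := slice r0 (P := P).
pose O := [set t : 'rV[C]_(\rank (kermx P)) | rnorm t < d].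
pose sec t := schur_of_row x0 (sl t).
have slS t : O t -> bschur M (sl t).
  by move=> Ot; apply: (trans_schur (M := M) i00 e1 e3 (dP t t Ot Ot)).
have secE t : O t -> schur_row (sec t) = sl t by move=> Ot; exact/schur_of_rowK/slS.
have sec_inj t t' : O t -> O t' -> p (sec t) = p (sec t') -> t = t'.
  move=> Ot Ot' /moduli_piP[g tg].
  have [gu _] := AutV_row_unit g.
  have : bact M (sl t) (AutV_row g) = sl t' by rewrite -!secE// tg schur_row_act.
  move=> /(bactE _ _ gu) H.
  by have [] := slice_intertwiner (M := M) i00 e1 e3 (endo_one_neq0 V_neq0) (dP t t' Ot Ot') H gu.
pose D := [set y | exists2 t, O t & p (sec t) = y].
have /choice[m mP] : forall y, exists t, D y -> O t /\ p (sec t) = y.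
  move=> y; have [[t Ot ty]|nD] := pselect (D y); first by exists t.
  by exists 0.
have mE t : O t -> m (p (sec t)) = t.
  move=> Ot; have Dt : D (p (sec t)) by exists t.
  by have [Om /sec_inj] := mP _ Dt; apply.
(* At a slice point [slice_local] gives [y g = g s] with [s] in the slice, that is [y = g s g^-1];
   so the element carrying [s] to [y] under the right action is the inverse of [g]. *)
have local t : O t -> exists (tau : 'rV[C]_KA -> 'rV[C]_(\rank (kermx P))) (ga : X -> AutV V),
    [/\ differentiable tau (schur_row (sec t)), hol_cont cX cG ga (sec t),
      \forall y \near sec t, O (tau (schur_row y)) &
      \forall y \near sec t, schur_act_AutV (sec (tau (schur_row y))) (ga y) = y].
  move=> Ot; have [tau [g [dtau dg taut gt Hnear]]] := slice_local e1 PE (dP t t Ot Ot).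
  rewrite -/sl in dtau dg taut gt Hnear.
  rewrite -(secE t Ot) in dtau dg taut gt Hnear.
  have gu : bunit M (g (schur_row (sec t))) by rewrite gt; exact: (bunit1 M).
  have rc : {for sec t, continuous schur_row} by exact: schur_row_continuous.
  have nO : \forall y \near sec t, O (tau (schur_row y)).
    have tc : {for schur_row (sec t), continuous tau} by exact: differentiable_continuous.
    have nB : nbhs (tau (schur_row (sec t))) O.
      apply/nbhs_rnormP; exists (d - rnorm t); first by rewrite subr_gt0.
      move=> y; rewrite taut => yt; rewrite /O /=.
      have := rnormD (y - t) t; rewrite subrK => /le_lt_trans; apply.
      by rewrite -ltrBrDr.
    exact: (rc _ (tc _ nB)).
  exists tau, (fun y => AutV_of_row (binv M (g (schur_row y)))).
  have giu : bunit M (binv M (g (schur_row (sec t)))).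
    by have [] // := @bunitP _ _ _ M (binv M (g (schur_row (sec t)))) (g (schur_row (sec t)));
      [exact: bmulVx|exact: bmulxV].
  split=> //.
    apply: (@AutV_of_row_hol_cont R Q V _ cX (fun z => binv M (g z)) (sec t)) => //.
    exact: (differentiable_binv (M := M) dg gu).
  have [U nU UP] : exists2 U, nbhs (schur_row (sec t)) U & forall z, U z -> bunit M (g z).
    by exists [set z | bunit M (g z)] => //; exact: (bunit_near (M := M) dg gu).
  have nU' : \forall y \near sec t, U (schur_row y) by exact: rc _ nU.
  have nH : \forall y \near sec t, bra M (schur_row y) (g (schur_row y)) =
      bla M (g (schur_row y)) (sl (tau (schur_row y))).
    exact: rc _ Hnear.
  apply: filterS3 nO nU' nH => y Oy /UP gyu H; apply: schur_row_inj.
  have [gi1 _] : bunit M (binv M (g (schur_row y))) /\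
      binv M (binv M (g (schur_row y))) = g (schur_row y).
    by apply: bunitP; [exact: bmulVx|exact: bmulxV].
  rewrite schur_row_act (secE _ Oy) (AutV_of_rowK gi1).
  have /(bactE _ _ gyu) <- := H.
  exact: (@bactK R KE KA M _ _ gyu).
(* A point over [D] is [sec t] moved by some [g0]. The fixed translation by the inverse of [g0]
   brings it to the slice, where [local] applies; the group element is then multiplied by [g0]. *)
have glob x : D (p x) -> exists (tau : X -> 'rV[C]_(\rank (kermx P))) (ga : X -> AutV V),
    [/\ exists2 h : 'rV[C]_KA -> 'rV[C]_(\rank (kermx P)), differentiable h (schur_row x) &
          \forall y \near x, h (schur_row y) = tau y,
      hol_cont cX cG ga x, \forall y \near x, O (tau y) &
      \forall y \near x, schur_act_AutV (sec (tau y)) (ga y) = y].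
  move=> /mP[Ot /moduli_piP[g0 xE]]; set t := m (p x) in Ot xE.
  pose back (y : X) := schur_act_AutV y g0^-1%g.
  have backx : back x = sec t by rewrite /back xE -schur_act_AutVM mulgV schur_act_AutV1.
  have bh : hol_cont cX cX back x by exact: schur_act_fix_hol_cont.
  have [bc [k [kE dk]]] := bh.
  have [tau [ga [dtau gah nO nE]]] := local t Ot.
  rewrite -backx in dtau gah nO nE.
  exists (fun y => tau (schur_row (back y))), (fun y => (ga (back y) * g0)%g); split.
  - exists (tau \o k).
      have kx : k (schur_row x) = schur_row (back x) := nbhs_singleton kE.
      by apply: differentiable_comp; [exact: dk|rewrite kx; exact: dtau].
    by apply: filterS kE => y /= yE; congr tau; exact: yE.
  - exact: (hol_cont_comp (hol_cont_pair (hol_cont_comp bh gah) (hol_cont_cst cX cG g0 x)) (AutV_mul_hol_cont (ga (back x), g0))).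
  - exact: bc _ nO.
  - have nE' : \forall y \near x,
        schur_act_AutV (sec (tau (schur_row (back y)))) (ga (back y)) = back y by exact: bc _ nE.
    apply: filterS nE' => y yE.
    by rewrite schur_act_AutVM yE /back -schur_act_AutVM mulVg schur_act_AutV1.
(* All the functions [tau] found at different points compute [m \o p]. This turns differentiability
   at single points into holomorphy of one chart map. *)
have globD (x : X) tau ga : (\forall y \near x, O (tau y)) ->
    (\forall y \near x, schur_act_AutV (sec (tau y)) (ga y) = y) ->
    \forall y \near x, D (p y) /\ m (p y) = tau y.
  move=> nO nE; apply: filterS2 nO nE => y Oy yE.
  have -> : p y = p (sec (tau y)) by rewrite -{1}yE moduli_pi_act.
  by split; [exists (tau y)|exact: mE].
have oD : open D.
  rewrite openE => y; have [x <-] := moduli_pi_surj y => Dx.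
  have [tau [ga [_ _ nO nE]]] := glob x Dx.
  have [B [oB Bx] BD] : exists2 B, open_nbhs x B & B `<=` [set y | D (p y)].
    have : nbhs x [set y | D (p y)] by apply: filterS (globD x tau ga nO nE) => ? [].
    by rewrite nbhsE => -[B]; exists B.
  have nB : nbhs (p x) (p @` B).
    by apply: open_nbhs_nbhs; split; [exact: moduli_pi_open|exists x].
  by apply: filterS nB => _ [z Bz <-]; exact: BD.
have Onbhs t : O t -> nbhs t O.
  move=> Ot; apply/nbhs_rnormP; exists (d - rnorm t); first by rewrite subr_gt0.
  move=> y yt; have := rnormD (y - t) t; rewrite subrK => /le_lt_trans; apply.
  by rewrite -ltrBrDr.
have dsl t : differentiable sl t by apply: differentiable_slice; exact: ex_diff.
have sec_cont t : O t -> {for t, continuous sec}.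
  move=> Ot A /schur_row_nbhs[B]; rewrite secE// => nB BA.
  have n1 : nbhs t (sl @^-1` B) by exact: (differentiable_continuous (dsl t)) _ nB.
  by apply: filterS2 n1 (Onbhs t Ot) => y By Oy; apply: BA; rewrite secE.
have cc : is_chart (Chart D m).
  apply: (@quotient_chart R X (moduli V) p D _ m O sec).
  - exact: moduli_pi_continuous.
  - exact: moduli_pi_open.
  - exact: moduli_pi_surj.
  - exact: oD.
  - by rewrite openE => t; exact: Onbhs.
  - by move=> t Ot; split; [exists t|exact: mE].
  - exact: mP.
  - exact: sec_cont.
  - move=> x Dx; have [tau [ga [[h dh hE] _ nO nE]]] := glob x Dx.
    have hc' : {for x, continuous (h \o schur_row)}.
      apply: continuous_comp; first exact: schur_row_continuous.
      exact: differentiable_continuous.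
    apply: near_eq_continuous hc'.
    by apply: filterS2 hE (globD x tau ga nO nE) => y /= -> [_ ->].
have O0 : O 0 by rewrite /O /= rnorm0.
have sec0 : sec 0 = x0.
  by apply: schur_row_inj; rewrite (secE _ O0) /sl /slice mul0mx addr0.
exists (Chart D m); last by exists 0; rewrite ?sec0.
split; first exact: cc.
exists (fun y => sec (m y)); split=> [y Dy|x Dx].
  have [Oy yE] := mP y Dy; split=> //.
  apply: (@hol_cont_global R _ _ (Chart D m) cX _ y sl).
  - by apply: (chart_map_continuous cc); exact: Dy.
  - exact: schur_chartP.
  - by [].
  - have nD : nbhs y D by exact: open_nbhs_nbhs.
    by apply: filterS nD => z Dz; have [Oz _] := mP z Dz; exact/esym/(secE _ Oz).
  - exact: dsl.
have [tau [ga [[h dh hE] gah nO nE]]] := glob x Dx; have nD := globD x tau ga nO nE.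
split.
  split; first exact: moduli_pi_continuous.
  by exists h; split=> //; apply: filterS2 hE nD => y /= -> [_ ->].
exists ga; first exact: gah.
by apply: filterS2 nE nD => y yE [_ mpy]; rewrite mpy; exact: yE.
Qed.

End ModuliCharts.

(** * The principal bundle *)

Section ModuliBundle.
Context {R : realType} {Q : quiver}.
Local Notation C := (Cx R).
Variable V : vertex Q -> vectType C.
Local Notation M := (rep_bimodule V).
Local Notation KE := #|{: {a : vertex Q & 'I_(\dim {:'Hom(V a, V a)})}}|.
Local Notation cG := (AutV_chart V).
Local Notation cX := (schur_chart V).
Local Notation X := (schur_space V).
Local Notation G := (PAutV V).
Local Notation p := (@moduli_pi R Q V).
Local Notation act := (@schur_act_PAutV R Q V).

Hypothesis V_neq0 : exists a, \1%VF != 0 :> 'Hom(V a, V a).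

Lemma moduli_submersion_charts :
  submersion_charts (@schur_atlas R Q V) p [set c | moduli_slice_chart c].
Proof.
have SP := schur_premanifold V_neq0; have cS := schur_chart_atlas V_neq0.
split.
- by move=> c [].
- move=> y; have [x <-] := moduli_pi_surj y.
  by have [c ? ?] := moduli_slice_chart_exists V_neq0 x; exists c.
- move=> c c0 x [_ [sec [_ secx]]] c0S cpx c0x.
  have [ph _] := secx x cpx.
  by have [] := hol_cont_atlas_source SP c0S cS c0x I ph.
- move=> c x [cc [sec [secy secx]]] cpx.
  have [_ [ga _ gaE]] := secx x cpx; have xE := nbhs_singleton gaE.
  have [sech _] := secy _ cpx.
  (* The slice section is moved by the constant element [ga x], so that it passes through the
     prescribed point [x]. *)
  pose s y := schur_act_AutV (sec y) (ga x).
  have sh : hol_cont c cX s (p x).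
    exact: (hol_cont_comp (hol_cont_pair sech (hol_cont_cst c cG (ga x) (p x)))
      (schur_act_hol_cont V_neq0 (sec (p x), ga x))).
  exists s; split.
  + exact: xE.
  + by case: sh.
  + apply: filterS (chart_dom_nbhs cc cpx) => y cy.
    by rewrite /s moduli_pi_act; case: (secy y cy).
  + move=> c0 c0S c0x.
    have sx : s (p x) = x := xE.
    have [] // : hol_cont c c0 s (p x).
    by apply: hol_cont_atlas_target SP c0S cS _ _ sh; rewrite ?sx.
Qed.

(** An element fixing [x] intertwines [x] with itself, hence is scalar and trivial in the quotient
    group. *)
Lemma schur_act_free (x : X) (g : G) : act x g = x -> g = 1%g.
Proof.
rewrite -[g]PAutV_reprK schur_act_PAutVE => gx.
have [gu _] := AutV_row_unit (PAutV_repr g).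
have := schur_row_act x (PAutV_repr g); rewrite gx => /esym/(bactE _ _ gu) H.
have [l lE] := schur_row_schur H.
apply/esym/(AutV_row_proportional V_neq0 (l := l)).
by rewrite lE AutV_row1.
Qed.

Lemma schur_act_right_action : right_action act.
Proof.
split=> [x|x g h].
  by rewrite -[1%g]/(PAutV_pi 1%g) schur_act_PAutVE schur_act_AutV1.
rewrite -[g]PAutV_reprK -[h]PAutV_reprK -[(_ * _)%g]PAutV_piM !schur_act_PAutVE.
exact: schur_act_AutVM.
Qed.

Lemma schur_act_inj (x : X) (g h : G) : act x g = act x h -> g = h.
Proof.
have [a1 aM] := schur_act_right_action => gh.
have /schur_act_free H : act x (g * h^-1)%g = x by rewrite aM gh -aM mulgV a1.
by rewrite -[g]mulg1 -(mulVg h) mulgA H mul1g.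
Qed.

(** Both factors are lifted by local sections to [AutV], where the product is bilinear in
    coordinates; inversion and the action are treated in the same way. *)
Lemma PAutV_mul_hol_cont (a b : G) i j k : chart_dom (PAutV_chart i) a ->
  chart_dom (PAutV_chart j) b -> chart_dom (PAutV_chart k) (a * b)%g ->
  hol_cont (prod_chart (PAutV_chart i) (PAutV_chart j)) (PAutV_chart k)
    (fun z : G * G => (z.1 * z.2)%g) (a, b).
Proof.
have [g <-] := PAutV_pi_surj a; have [h <-] := PAutV_pi_surj b => gi hj ghk.
have [s [sg sh sE]] := PAutV_section_hol_cont V_neq0 gi.
have [t [th tc tE]] := PAutV_section_hol_cont V_neq0 hj.
have kD : chart_dom (PAutV_chart k) (PAutV_pi (g * h)%g) by rewrite PAutV_piM.
pose z0 : G * G := (PAutV_pi g, PAutV_pi h).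
have c1 : hol_cont (prod_chart (PAutV_chart i) (PAutV_chart j)) (prod_chart cG cG)
    (fun z : G * G => (s z.1, t z.2)) z0.
  exact: (hol_cont_pair (hol_cont_comp (hol_cont_fst (PAutV_chart i) (PAutV_chart j) z0) sh)
    (hol_cont_comp (hol_cont_snd (PAutV_chart i) (PAutV_chart j) z0) tc)).
have c2 := hol_cont_comp c1 (AutV_mul_hol_cont (s (PAutV_pi g), t (PAutV_pi h))).
have c3 : hol_cont cG (PAutV_chart k) (@PAutV_pi R Q V) (s (PAutV_pi g) * t (PAutV_pi h))%g.
  by apply: PAutV_pi_hol_cont; rewrite sg th.
apply: hol_cont_eq (hol_cont_comp c2 c3).
have n1 := near_fst (z := z0) (chart_dom_nbhs (PAutV_chartP V_neq0 i) gi).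
have n2 := near_snd (z := z0) (chart_dom_nbhs (PAutV_chartP V_neq0 j) hj).
apply: filterS2 n1 n2 => z /sE z1 /tE z2 /=.
by rewrite PAutV_piM z1 z2.
Qed.

Lemma PAutV_inv_hol_cont (a : G) i k : chart_dom (PAutV_chart i) a ->
  chart_dom (PAutV_chart k) (a^-1)%g ->
  hol_cont (PAutV_chart i) (PAutV_chart k) (fun g : G => g^-1%g) a.
Proof.
have [g <-] := PAutV_pi_surj a => gi gk.
have [s [sg sh sE]] := PAutV_section_hol_cont V_neq0 gi.
have c3 : hol_cont cG (PAutV_chart k) (@PAutV_pi R Q V) (s (PAutV_pi g))^-1%g.
  by apply: PAutV_pi_hol_cont; rewrite sg PAutV_piV.
apply: hol_cont_eq (hol_cont_comp (hol_cont_comp sh (AutV_inv_hol_cont (s (PAutV_pi g)))) c3).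
apply: filterS (chart_dom_nbhs (PAutV_chartP V_neq0 i) gi) => y /sE y1 /=.
by rewrite PAutV_piV y1.
Qed.

Lemma schur_act_PAutV_hol_cont (x : X) (a : G) i : chart_dom (PAutV_chart i) a ->
  hol_cont (prod_chart cX (PAutV_chart i)) cX (fun z : X * G => act z.1 z.2) (x, a).
Proof.
have [g <-] := PAutV_pi_surj a => gi.
have [s [sg sh sE]] := PAutV_section_hol_cont V_neq0 gi.
pose z0 : X * G := (x, PAutV_pi g).
have c1 : hol_cont (prod_chart cX (PAutV_chart i)) (prod_chart cX cG)
    (fun z : X * G => (z.1, s z.2)) z0.
  exact: (hol_cont_pair (hol_cont_fst cX (PAutV_chart i) z0)
    (hol_cont_comp (hol_cont_snd cX (PAutV_chart i) z0) sh)).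
apply: hol_cont_eq (hol_cont_comp c1 (schur_act_hol_cont V_neq0 (x, s (PAutV_pi g)))).
have n2 := near_snd (z := z0) (chart_dom_nbhs (PAutV_chartP V_neq0 i) gi).
apply: filterS n2 => z /sE z2 /=.
by rewrite -schur_act_PAutVE z2.
Qed.

Lemma PAutV_mul_continuous : continuous (fun z : G * G => (z.1 * z.2)%g).
Proof.
move=> [a b]; have [i ia] := PAutV_chart_cover V_neq0 a.
have [j jb] := PAutV_chart_cover V_neq0 b.
have [k kab] := PAutV_chart_cover V_neq0 (a * b)%g.
by case: (PAutV_mul_hol_cont ia jb kab).
Qed.

Lemma PAutV_inv_continuous : continuous (fun g : G => g^-1%g).
Proof.
move=> a; have [i ia] := PAutV_chart_cover V_neq0 a.
have [k kab] := PAutV_chart_cover V_neq0 (a^-1)%g.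
by case: (PAutV_inv_hol_cont ia kab).
Qed.

Lemma schur_act_continuous : continuous (fun z : X * G => act z.1 z.2).
Proof.
move=> [x a]; have [i ia] := PAutV_chart_cover V_neq0 a.
by case: (schur_act_PAutV_hol_cont x ia).
Qed.

Lemma translation_exists : exists phi : X * X -> G, forall x g, phi (x, act x g) = g.
Proof.
have /choice[phi phiP] : forall z : X * X, exists g : G, forall h, act z.1 h = z.2 -> g = h.
  move=> z; have [[g gz]|nz] := pselect (exists g, act z.1 g = z.2).
    by exists g => h; rewrite -gz => /schur_act_inj.
  by exists 1%g => h hz; case: nz; exists h.
by exists phi => x g; exact: phiP.
Qed.

(** Near [x] this translation is the class of [ga], so it is holomorphic although [phi] itself comes
    from a mere choice. *)
Lemma translation_hol_cont (phi : X * X -> G) sec :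
  (forall x g, phi (x, act x g) = g) ->
  forall (x : X) (ga : X -> AutV V) i, hol_cont cX cG ga x ->
  (\forall y \near x, schur_act_AutV (sec (p y)) (ga y) = y) ->
  chart_dom (PAutV_chart i) (phi (sec (p x), x)) ->
  hol_cont cX (PAutV_chart i) (fun y => phi (sec (p y), y)) x.
Proof.
move=> phiP x ga i gah gaE.
have nE : \forall y \near x, PAutV_pi (ga y) = phi (sec (p y), y).
  apply: filterS gaE => y yE; rewrite -{3}yE -schur_act_PAutVE; exact/esym/phiP.
rewrite -(nbhs_singleton nE) => ix.
exact: hol_cont_eq nE (hol_cont_comp gah (PAutV_pi_hol_cont ix)).
Qed.

Lemma slice_translation (phi : X * X -> G) (c : @chart R (moduli V)) (sec : moduli V -> X) :
  (forall x g, phi (x, act x g) = g) ->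
  (forall x, chart_dom c (p x) -> hol_cont cX c p x /\
      exists2 ga : X -> AutV V, hol_cont cX cG ga x &
        \forall y \near x, schur_act_AutV (sec (p y)) (ga y) = y) ->
  forall x, chart_dom c (p x) -> act (sec (p x)) (phi (sec (p x), x)) = x.
Proof.
move=> phiP secx x /secx[_ [ga _ gaE]]; have xE := nbhs_singleton gaE.
by rewrite -{3}xE -schur_act_PAutVE phiP schur_act_PAutVE.
Qed.

Lemma schur_act_principal : principal_action act.
Proof.
have [phi phiP] := translation_exists.
split.
- by split; [exact: PAutV_mul_continuous|exact: PAutV_inv_continuous].
- exact: schur_act_right_action.
- exact: schur_act_continuous.
- exact: schur_act_free.
exists phi => //; apply/subspace_continuousP => _ [[x g] _ <-] /=.
have [c [cc [sec [secy secx]]] cpx] := moduli_slice_chart_exists V_neq0 x.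
have [a1 aM] := schur_act_right_action.
(* [chi] compares a point with the slice point of its orbit. For two points of one orbit, [phi] is
   the quotient of the two values of [chi], which reduces its continuity to that of [chi]. *)
pose chi y := phi (sec (p y), y).
have chiE := slice_translation phiP secx.
have pact y h : p (act y h) = p y by rewrite -[h]PAutV_reprK schur_act_PAutVE moduli_pi_act.
have chic y : chart_dom c (p y) -> {for y, continuous chi}.
  move=> cy; have [_ [ga gah gaE]] := secx y cy.
  have [i iD] := PAutV_chart_cover V_neq0 (chi y).
  by case: (translation_hol_cont phiP gah gaE iD).
have phi_chi y h : chart_dom c (p y) -> phi (y, act y h) = ((chi y)^-1 * chi (act y h))%g.
  move=> cy; rewrite phiP; apply/(@schur_act_inj y).
  have cyh : chart_dom c (p (act y h)) by rewrite pact.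
  have e1 : act y (chi y)^-1%g = sec (p y).
    by have := congr1 (act^~ (chi y)^-1%g) (chiE y cy); rewrite /= -aM mulgV a1 => <-.
  by rewrite aM e1 /chi -[X in X = _](chiE _ cyh) pact.
pose k (z : X * X) := ((chi z.1)^-1 * chi z.2)%g.
have f1 : {for (x, act x g), continuous (fun z : X * X => (chi z.1)^-1%g)}.
  apply: (@continuous_comp _ _ _ (fun z : X * X => chi z.1) (fun g : G => g^-1%g));
    last exact: PAutV_inv_continuous.
  apply: (@continuous_comp _ _ _ fst chi); last exact: chic.
  by case: (hol_cont_fst cX cX (x, act x g)).
have f2 : {for (x, act x g), continuous (fun z : X * X => chi z.2)}.
  apply: (@continuous_comp _ _ _ snd chi); last by apply: chic; rewrite pact.
  by case: (hol_cont_snd cX cX (x, act x g)).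
have f12 : {for (x, act x g), continuous (fun z : X * X => ((chi z.1)^-1%g, chi z.2))}.
  exact: continuous_pair.
have kc : {for (x, act x g), continuous k}.
  apply: (@continuous_comp _ _ _ (fun z : X * X => ((chi z.1)^-1%g, chi z.2))
    (fun z : G * G => (z.1 * z.2)%g)); [exact: f12|exact: PAutV_mul_continuous].
(* [k] is continuous on a full neighbourhood but agrees with [phi] only on pairs in a common orbit,
   which is all that the subspace topology sees. *)
move=> A nA.
have nD := near_fst (z := (x, act x g)) (moduli_pi_continuous (chart_dom_nbhs cc cpx)).
have nA' : nbhs (k (x, act x g)) A by rewrite /k -phi_chi.
have nK : nbhs (x, act x g) (k @^-1` A) by exact: kc nA'.
apply: filterS2 nD nK => -[y y'] /= yD kA [[y1 h] _ [y1y yy']].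
rewrite /= in y1y yy'; rewrite y1y in yy'; rewrite -yy' in kA *.
rewrite -[from_subspace _ _ _]/(phi (y, act y h)) (phi_chi _ _ yD).
exact: kA.
Qed.

Lemma schur_bundle (S := quotient_atlas (@schur_atlas R Q V) p) :
  holomorphic_principal_bundle (@PAutV_atlas R Q V) (@schur_atlas R Q V) S act p.
Proof.
have SXP := schur_premanifold V_neq0; have SGP := PAutV_premanifold V_neq0.
have cXS := schur_chart_atlas V_neq0; have ciS := PAutV_chart_atlas V_neq0.
have SP : premanifold S.
  exact: (quotient_atlas_premanifold SXP (@moduli_pi_continuous R Q V)
    (@moduli_pi_surj R Q V) moduli_submersion_charts).
have SXc := premanifold_compatible SXP; have SGc := premanifold_compatible SGP.
have Sc := premanifold_compatible SP.
have [SX1 _ _ _] := SXP; have [SG1 _ _ _] := SGP; have [S1 _ _ _] := SP.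
have [phi phiP] := translation_exists.
have mul_hol : @holomorphic R (G * G)%type G (prod_atlas (@PAutV_atlas R Q V) (@PAutV_atlas R Q V))
    (@PAutV_atlas R Q V) (fun z : G * G => (z.1 * z.2)%g).
  apply: (holomorphic_on_hol_cont (prod_compatible SG1 SG1) SGc openT) => -[a b] _.
  have [i ia] := PAutV_chart_cover V_neq0 a.
  have [j jb] := PAutV_chart_cover V_neq0 b.
  have [k kab] := PAutV_chart_cover V_neq0 (a * b)%g.
  exists (prod_chart (PAutV_chart i) (PAutV_chart j)), (PAutV_chart k); split=> //.
    by exists (PAutV_chart i); [exact: ciS|exists (PAutV_chart j); [exact: ciS|]].
  exact: PAutV_mul_hol_cont.
have inv_hol : @holomorphic R G G (@PAutV_atlas R Q V) (@PAutV_atlas R Q V) (fun g : G => g^-1%g).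
  apply: (holomorphic_on_hol_cont SGc SGc openT) => a _.
  have [i ia] := PAutV_chart_cover V_neq0 a.
  have [k kab] := PAutV_chart_cover V_neq0 (a^-1)%g.
  by exists (PAutV_chart i), (PAutV_chart k); split=> //; exact: PAutV_inv_hol_cont.
have act_hol : @holomorphic R (X * G)%type X (prod_atlas (@schur_atlas R Q V) (@PAutV_atlas R Q V))
    (@schur_atlas R Q V) (fun z : X * G => act z.1 z.2).
  apply: (holomorphic_on_hol_cont (prod_compatible SX1 SG1) SXc openT) => -[x a] _.
  have [i ia] := PAutV_chart_cover V_neq0 a.
  exists (prod_chart cX (PAutV_chart i)), cX; split=> //.
    by exists cX => //; exists (PAutV_chart i).
  exact: schur_act_PAutV_hol_cont.
split.
- by split=> //; split.
- exact: schur_act_right_action.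
- exact: act_hol.
- by case: (quotient_atlas_submersion (@schur_atlas R Q V) (@moduli_pi_continuous R Q V)).
move=> m; have [x0 <-] := moduli_pi_surj m.
have [c cA cpx0] := moduli_slice_chart_exists V_neq0 x0.
have [cc [sec [secy secx]]] := cA.
have cS : S c.
  have sub := special_quotient SXP (@moduli_pi_continuous R Q V) moduli_submersion_charts.
  exact: (sub c cA).
have oU : open (chart_dom c) by case: cc.
have [_ aM] := schur_act_right_action.
have chiE := slice_translation phiP secx.
have pact y h : p (act y h) = p y by rewrite -[h]PAutV_reprK schur_act_PAutVE moduli_pi_act.
exists (chart_dom c), (fun z : moduli V * G => act (sec z.1) z.2),
  (fun x => (p x, phi (sec (p x), x))); split=> //; split.
- apply: (holomorphic_on_hol_cont (prod_compatible S1 SG1) SXc (open_prod oU openT)) => -[y a] [/= Uy _].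
  have [i ia] := PAutV_chart_cover V_neq0 a.
  exists (prod_chart c (PAutV_chart i)), cX; split=> //.
    by exists c => //; exists (PAutV_chart i).
  have [sech _] := secy y Uy.
  pose z0 : moduli V * G := (y, a).
  exact: (hol_cont_comp (hol_cont_pair (hol_cont_comp (hol_cont_fst c (PAutV_chart i) z0) sech)
    (hol_cont_snd c (PAutV_chart i) z0)) (schur_act_PAutV_hol_cont (sec y) ia)).
- have oV : open (p @^-1` chart_dom c).
    by apply: open_comp => // x _; exact: moduli_pi_continuous.
  apply: (holomorphic_on_hol_cont SXc (prod_compatible S1 SG1) oV) => x Ux.
  have [ph [ga gah gaE]] := secx x Ux.
  have [i iD] := PAutV_chart_cover V_neq0 (phi (sec (p x), x)).
  exists cX, (prod_chart c (PAutV_chart i)); split=> //.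
    by exists c => //; exists (PAutV_chart i).
  exact: hol_cont_pair ph (translation_hol_cont phiP gah gaE iD).
- move=> y g Uy /=; have [_ py] := secy y Uy.
  by rewrite pact py phiP.
- by move=> x Ux; split=> //=; exact: chiE.
- by move=> y g h Uy /=; exact: aM.
Qed.

End ModuliBundle.

Theorem theorem5p7 (R : realType) (Q : quiver) (d : vertex Q -> nat)
    (V : vertex Q -> vectType (Cx R))
    (Q_nonempty : (0 < #|vertex Q|)%N)
    (d_nonzero : exists a, d a <> 0%N)
    (dimV : forall a, \dim {:V a} = d a) :
  [/\ principal_action (@schur_act_PAutV R Q V),
      exists! S : set (@chart R (moduli V)),
        premanifold S /\
        holomorphic_submersion (@schur_atlas R Q V) S (@moduli_pi R Q V) &
      forall S : set (@chart R (moduli V)),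
        premanifold S ->
        holomorphic_submersion (@schur_atlas R Q V) S (@moduli_pi R Q V) ->
        holomorphic_principal_bundle (@PAutV_atlas R Q V) (@schur_atlas R Q V) S
          (@schur_act_PAutV R Q V) (@moduli_pi R Q V)].
Proof.
have V_neq0 : exists a, \1%VF != 0 :> 'Hom(V a, V a).
  have [a da] := d_nonzero; exists a; apply: contra_not_neq da => a0.
  rewrite -dimV; apply/eqP; rewrite dimv_eq0; apply/eqP/vspaceP => x.
  by rewrite memvf memv0 -[x]id_lfunE a0 zero_lfunE eqxx.
have SXP := schur_premanifold V_neq0.
have pc := @moduli_pi_continuous R Q V; have ps := @moduli_pi_surj R Q V.
have AP := moduli_submersion_charts V_neq0.
split.
- exact: schur_act_principal.
- exists (quotient_atlas (@schur_atlas R Q V) (@moduli_pi R Q V)); split.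
    by split; [exact: quotient_atlas_premanifold AP|exact: quotient_atlas_submersion].
  by move=> S [SP Ssub]; apply/esym; exact: quotient_atlas_unique AP _ SP Ssub.
(* By uniqueness an arbitrary admissible [S] is the quotient atlas, for which the slice charts
   provide the trivialisations. *)
- move=> S SP Ssub; rewrite (quotient_atlas_unique SXP pc ps AP SP Ssub).
  exact: schur_bundle.
Qed.
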